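(* Let $G=PSL(2,7)$ and let $\mathcal{C}G$ be its coset poset. Then $$\widetilde H_0(\Delta\mathcal{C}G)=0,\qquad \widetilde H_1(\Delta\mathcal{C}G)=0,\qquad \widetilde H_4(\Delta\mathcal{C}G)=0,$$ the group $\widetilde H_3(\Delta\mathcal{C}G)$ is torsion-free, and $$\chi(\Delta\mathcal{C}G)\leq\dim\widetilde H_2(\Delta\mathcal{C}G)\leq 14616,\qquad \dim\widetilde H_3(\Delta\mathcal{C}G)\leq 11760 .$$
   Context: For a finite group $G$, $\mathcal{C}G=\{xH\mid H<G,\ x\in G\}$ is the poset of all left cosets of all proper subgroups of $G$ (the trivial subgroup included), ordered by inclusion. For a finite poset $P$, $\Delta P$ denotes its order complex (simplices are the nonempty finite chains of $P$). $\widetilde H_m$ is reduced integral homology and $H_m$ is ordinary integral homology, $\dim$ of an abelian group is its torsion-free rank, and $\chi$ is the (unreduced) Euler characteristic $\chi(X)=\sum_m(-1)^m\dim H_m(X)$. $PSL(2,7)$ is the projective special linear group of $2\times2$ matrices over the field with $7$ elements. *)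

(* Defs.v *)
From HB Require Import structures.
From mathcomp Require Import all_boot all_order all_algebra all_fingroup.
From mathcomp Require Import all_solvable.
From mathcomp Require Import zify.
From mathcomp Require Import boolp.

Set Implicit Arguments.
Unset Strict Implicit.
Unset Printing Implicit Defensive.

Import Order.TTheory GRing.Theory Num.Theory.

Local Open Scope ring_scope.
Local Open Scope quotient_scope.

Section AbelianGroups.
Variable A : zmodType.

Definition trivial_zmod := forall x : A, x = 0.

Definition torsion_free := forall (x : A) (n : nat),
  (0 < n)%N -> x *+ n = 0 -> x = 0.

Definition zfree n (a : 'I_n -> A) := forall c : 'I_n -> int,
  \sum_i a i *~ c i = 0 -> forall i, c i = 0.

Definition has_tfrank (n : nat) :=
  (exists a : 'I_n -> A, zfree a) /\ ~ (exists a : 'I_n.+1 -> A, zfree a).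

(* The torsion-free rank. The default value 0 is only used for groups of
   infinite rank; see homology_has_tfrank below. *)
Definition tfrank : nat :=
  if pselect (exists n, has_tfrank n) is left h then sval (cid h) else 0%N.

End AbelianGroups.

(* ker g / im f. No relation between f and g is required: the quotient is
   taken by the elements of ker g that lie in the image of f. *)
Section Homology.
Variables (C2 C1 C0 : zmodType).
Variables (f : {additive C2 -> C1}) (g : {additive C1 -> C0}).

Definition is_cycle (x : C1) : bool := g x == 0.

Lemma is_cycle_zmod_closed : zmod_closed is_cycle.
Proof.
split=> [|x y]; rewrite !unfold_in ?raddf0 // => /eqP gx /eqP gy.
by rewrite raddfB gx gy subr0.
Qed.
HB.instance Definition _ :=
  GRing.isZmodClosed.Build C1 is_cycle is_cycle_zmod_closed.

Record cycles := Cycle { cycle_val :> C1; _ : cycle_val \in is_cycle }.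
HB.instance Definition _ := [isSub for cycle_val].
HB.instance Definition _ := [Choice of cycles by <:].
HB.instance Definition _ := [SubChoice_isSubZmodule of cycles by <:].

Definition is_boundary (z : cycles) : bool := `[< exists c, f c = val z >].

Lemma is_boundary_zmod_closed : zmod_closed is_boundary.
Proof.
split=> [|x y]; first by apply/asboolP; exists 0; rewrite !raddf0.
move=> /asboolP[c fc] /asboolP[d fd]; apply/asboolP; exists (c - d).
by rewrite !raddfB fc fd.
Qed.
HB.instance Definition _ :=
  GRing.isZmodClosed.Build cycles is_boundary is_boundary_zmod_closed.

Definition homology : zmodType := Quotient.quot (GRing.ZmodClosed.clone cycles is_boundary _).

End Homology.

Lemma int_dependence n m (M : 'M[int]_(n, m)) : (m < n)%N ->
  exists2 c : 'I_n -> int, (exists i, c i != 0) &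
    forall j, \sum_i c i * M i j = 0.
Proof.
move=> ltmn; pose MQ := map_mx (intr : int -> rat) M.
have : kermx MQ != 0.
  rewrite -mxrank_eq0 mxrank_ker subn_eq0 -ltnNge.
  exact: leq_ltn_trans (rank_leq_col _) ltmn.
case/rowV0Pn => v /sub_kermxP vM /rV0Pn[i0 vi0].
exists (fun i => numq (v 0 i) * \prod_(j | j != i) denq (v 0 j)).
  exists i0; rewrite mulf_neq0 ?numq_eq0 //.
  by apply/prodf_neq0 => j _; apply: denq_neq0.
move=> j; apply/eqP; rewrite -(intr_eq0 rat) rmorph_sum /=; apply/eqP.
transitivity ((\prod_i (denq (v 0 i))%:~R) * (v *m MQ) 0 j); last first.
  by rewrite vM mxE mulr0.
rewrite mxE mulr_sumr; apply: eq_bigr => i _.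
rewrite !rmorphM /= numqE rmorph_prod /= [in RHS](bigD1 i) //= mxE.
by rewrite [v 0 i * _]mulrC -!mulrA; congr (_ * _); rewrite mulrCA.
Qed.

Lemma zfree_homology_bound (T : finType) (C2 C0 : zmodType)
    (f : {additive C2 -> {ffun T -> int}}) (g : {additive {ffun T -> int} -> C0})
    n (a : 'I_n -> homology f g) : zfree a -> (n <= #|T|)%N.
Proof.
move=> a_free; rewrite leqNgt; apply/negP => ltTn.
pose x i : {ffun T -> int} := val (generic_quotient.repr (a i)).
have [c [i ci] cx] := int_dependence (\matrix_(i < n, j < #|T|) x i (enum_val j)) ltTn.
suff /a_free/(_ i)/eqP : \sum_i a i *~ c i = 0 by rewrite (negPf ci).
have -> : \sum_i a i *~ c i = \pi_(homology f g) (\sum_i generic_quotient.repr (a i) *~ c i).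
  rewrite raddf_sum; apply: eq_bigr => k _.
  by rewrite raddfMz /= reprK.
rewrite [X in \pi_ _ X](_ : _ = 0) ?raddf0 //.
apply: val_inj; rewrite raddf0 raddf_sum; apply/ffunP=> t.
rewrite sum_ffunE ffunE -(enum_rankK t) -[RHS](cx (enum_rank t)).
apply: eq_bigr => k _; rewrite raddfMz mxE ffunMzE -/(x k).
by rewrite -mulrzl intz.
Qed.

Lemma homology_has_tfrank (T : finType) (C2 C0 : zmodType)
    (f : {additive C2 -> {ffun T -> int}}) (g : {additive {ffun T -> int} -> C0}) :
  has_tfrank (homology f g) (tfrank (homology f g)).
Proof.
rewrite /tfrank; case: pselect => [h|[]]; first by case: (cid h).
pose Q n := `[< exists a : 'I_n -> homology f g, zfree a >].
have Q0 : exists n, Q n.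
  by exists 0%N; apply/asboolP; exists (fun=> 0) => c _ [].
have Qle n : Q n -> (n <= #|T|)%N.
  by move=> /asboolP[a]; apply: zfree_homology_bound.
case: (ex_maxnP Q0 Qle) => n /asboolP Qn n_max; exists n; split=> // Qn1.
by have := n_max n.+1 (asboolT Qn1); rewrite ltnn.
Qed.

Section OrderComplex.
Variables (d : Order.disp_t) (P : finPOrderType d).

(* The simplices of the order complex with n vertices (of dimension n - 1):
   chains of P listed in increasing order. The empty simplex (n = 0) spans the
   degree -1 part of the augmented chain complex. *)
Definition simplex (n : nat) := {t : n.-tuple P | sorted <%O t}.

Lemma face_subproof n (i : 'I_n.+1) (t : simplex n.+1) :
  sorted <%O [tuple tnth (val t) (lift i j) | j < n].
Proof.
case: t => t t_sorted /=.
have t_homo (j k : 'I_n.+1) : (j < k)%N -> (tnth t j < tnth t k)%O.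
  move=> ltjk; have x0 := tnth t j; rewrite !(tnth_nth x0).
  by rewrite (sorted_ltn_nth lt_trans) // inE size_tuple.
have le_lift (j k : 'I_n) : (j < k)%N -> (lift i j < lift i k)%N.
  by rewrite /= /bump; case: (leqP i j) => ij; case: (leqP i k) => ik //; lia.
rewrite /= sorted_map; apply: (@sub_sorted _ (fun j k : 'I_n => (j < k)%N)).
  by move=> j k jk /=; apply: t_homo; apply: le_lift.
by have := iota_ltn_sorted 0 n; rewrite -val_enum_ord sorted_map.
Qed.

Definition face n (i : 'I_n.+1) (t : simplex n.+1) : simplex n :=
  exist (fun u : n.-tuple P => sorted <%O u) _ (face_subproof i t).

Definition chain n := {ffun simplex n -> int}.

Definition bdry n (x : chain n.+1) : chain n :=
  [ffun s => \sum_(t : simplex n.+1) \sum_(i < n.+1 | face i t == s)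
               (-1) ^+ i * x t].

Lemma bdry_is_zmod_morphism n : zmod_morphism (@bdry n).
Proof.
move=> x y; apply/ffunP=> s; rewrite !ffunE -sumrB; apply: eq_bigr => t _.
by rewrite -sumrB; apply: eq_bigr => i _; rewrite !ffunE mulrBr.
Qed.
HB.instance Definition _ n :=
  GRing.isZmodMorphism.Build (chain n.+1) (chain n) (@bdry n)
    (@bdry_is_zmod_morphism n).

Definition rhomology (m : nat) : zmodType := homology (@bdry m.+1) (@bdry m).

(* Ordinary homology: the degree 0 differential is zero instead of the
   augmentation. *)
Definition ohomology (m : nat) : zmodType :=
  if m is 0 then homology (@bdry 1) (\0 : {additive chain 1 -> chain 0})
  else rhomology m.

(* Simplices have at most #|P| vertices, so the homology vanishes in degrees
   m >= #|P|. *)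
Definition euler_char : int :=
  \sum_(m < #|P|) (-1) ^+ m * (tfrank (ohomology m))%:Z.

End OrderComplex.

Section CosetPoset.
Variables (gT : finGroupType) (G : {group gT}).

(* Membership in lcosets H G is being a left coset x *: H with x in G. *)
Definition proper_coset (A : {set gT}) : bool :=
  [exists H : {group gT}, (H \proper G) && (A \in lcosets H G)].

Record coset_poset := CosetPoset {
  coset_poset_val :> {set gT};
  _ : proper_coset coset_poset_val }.

HB.instance Definition _ := [isSub for coset_poset_val].
HB.instance Definition _ := [Finite of coset_poset by <:].

Definition coset_le : rel coset_poset := fun A B => \val A \subset \val B.

Lemma coset_le_refl : reflexive coset_le.
Proof. by move=> A; apply: subxx. Qed.

Lemma coset_le_anti : antisymmetric coset_le.
Proof. by move=> A B; rewrite -eqEsubset => /eqP/val_inj. Qed.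

Lemma coset_le_trans : transitive coset_le.
Proof. by move=> B A C; apply: subset_trans. Qed.

HB.instance Definition _ := Order.Le_isPOrder.Build
  (Order.Disp tt tt) coset_poset coset_le_refl coset_le_anti coset_le_trans.

Lemma coset_poset_leE (A B : coset_poset) :
  (A <= B)%O = (\val A \subset \val B).
Proof. by []. Qed.

End CosetPoset.

Section ProjectiveSpecialLinear.
Variables (n : nat) (F : finFieldType).

Definition SL : {set {'GL_n[F]}} := [set u | \det (GLval u) == 1].

Lemma SL_group_set : group_set SL.
Proof.
apply/group_setP; split=> [|u v]; rewrite !inE ?det1 //.
by move=> /eqP du /eqP dv; rewrite -[GLval _]/(GLval u *m GLval v)
   det_mulmx du dv mulr1.
Qed.
Canonical SL_group := group SL_group_set.

Definition PSL : {group coset_of 'Z(SL)} := (SL / 'Z(SL))%G.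

End ProjectiveSpecialLinear.

(* Main.v *)
Require Import Defs.
From mathcomp Require Import all_boot all_order all_algebra all_fingroup all_solvable.
From HB Require Import structures.
From mathcomp Require Import zify ring boolp.

(** The group G = PSL(2,7) acts on the seven points and the seven lines of the
    Fano plane, with stabilisers of order 24, and on the eight points of the
    projective line over F_7, with stabilisers of order 21. A proper subgroup
    of order greater than 3 either fixes no point of the projective line, and
    then fixes exactly one point or exactly one line of the plane, or fixes
    exactly one point of the projective line and no point and no line of the
    plane ([subgroup_types]). Join two cosets by an edge when one contains the
    other, and also when they meet and are cosets of the stabilisers of a point
    and of a line. In this graph a coset of a subgroup of order greater than 3
    is dominated by the coset of the stabiliser singled out above, so that all
    cosets can be removed from the clique complex except the maximal ones of
    the three kinds and those of at most 3 elements ([dismantle],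
    [retr_kinds]); and an edge between two cosets which meet is dominated by
    their intersection, so that these edges can be removed as well
    ([remove_edges], [retr_edges]), which leaves the order complex. Hence the
    coset poset has the homology of the clique complex on the elements g, the
    cosets t and u with two and three elements, and the cosets a, b, c of the
    stabilisers of a point, of a line, and of a point of the projective line.

    The simplices of this complex have at most four vertices
    ([no_simplex5]), so that its homology vanishes in degrees greater than 3
    and is torsion-free in degree 3. If the boundary of a chain vanishes and
    all cofaces of a simplex but one have coefficient zero, then so has the
    last one ([last_coface]). Thus a 3-cycle is determined by its values on
    6 simplices {g, t, a, b} for each of the 1764 cosets t, whence
    rank H_3 <= 10584 ([H3_bound]). A 2-cycle which vanishes on 4 simplices
    {g, u, c} for each of the 1568 cosets u is homologous to one without
    vertices t and u, and such a cycle is determined by its values on 36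
    simplices {g, a, b} for each of the 168 elements g, whence
    rank H_2 <= 6272 + 6048 = 12320 ([H2_bound]).

    In degree 1 the vertices c, u, t, g have connected links and can be
    avoided in turn, which leaves the bipartite graph between the cosets a and
    b. Any three cosets a have a common neighbour b, so that 4-cycles generate
    its cycles, and a 4-cycle bounds because an element of G takes any two
    points and two lines to any other ones with the same incidences
    ([H1_trivial]).

    Since H_0 and H_1 vanish, chi = 1 + rank H_2 - rank H_3, and the lower
    bound on rank H_2 says that H_3 is not a torsion group. The link of each t
    contains four independent octahedral spheres made of simplices {g, a, b}.
    There are 4 * 1764 = 7056 of them in all, whereas cycles supported by such
    simplices form a group of rank at most 36 * 168 = 6048. So a nontrivial
    combination of these spheres vanishes, and the same combination of the
    cones with apices t is a nonzero 3-cycle ([H3_nonzero]).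

    The facts about G are finite checks over a list of 168 triples of
    permutations, the images of the elements of G in the three actions. *)

Set Implicit Arguments.
Unset Strict Implicit.
Unset Printing Implicit Defensive.

Import Order.TTheory GRing.Theory Num.Theory.
Local Open Scope ring_scope.

(** * Chains as elements of an exterior algebra *)

Section Exterior.
Variables (V : finType) (r : V -> nat).
Hypothesis r_inj : injective r.

(** Chains of all degrees live in one group, indexed by all sets of vertices: a
    simplex is a set in the support of the chain, and subcomplexes are handled
    as conditions on the support. This is the exterior algebra on V over the
    integers, with the basis of monomials whose factors are ordered by r. *)
Definition ch : Type := {ffun {set V} -> int}.
HB.instance Definition _ := GRing.Zmodule.on ch.

Implicit Types (u v a b : V) (s t : {set V}) (x y z w : ch) (K L M : {set V} -> bool).

Lemma sum_chE (I : Type) (e : seq I) (P : pred I) (F : I -> ch) s :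
  (\sum_(i <- e | P i) F i) s = \sum_(i <- e | P i) F i s.
Proof. by elim/big_rec2: _ => [|i c x _ <-]; rewrite ffunE. Qed.

Lemma chDE x y s : (x + y) s = x s + y s.
Proof. by rewrite ffunE. Qed.

Lemma chNE x s : (- x) s = - x s.
Proof. by rewrite ffunE. Qed.

(** The sign of moving v to the front of the monomial of v and s. *)
Definition sg v s : int := (-1) ^+ #|[set u in s | (r u < r v)%N]|.

(** The contraction by v: the part of x which lives in the star of v, seen as a
    chain of the link. *)
Definition rho v x : ch := [ffun s : {set V} => if v \in s then 0 else sg v s * x (v |: s)].
(** Exterior multiplication by v, that is, the cone with apex v. *)
Definition wdg v x : ch := [ffun s : {set V} => if v \in s then sg v s * x (s :\ v) else 0].

Lemma rho_is_zmod_morphism v : zmod_morphism (rho v).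
Proof.
move=> x y; apply/ffunP=> s; rewrite !ffunE.
by case: ifP => _; rewrite ?subr0 ?mulrBr.
Qed.
HB.instance Definition _ v :=
  GRing.isZmodMorphism.Build ch ch (rho v) (rho_is_zmod_morphism v).

Lemma wdg_is_zmod_morphism v : zmod_morphism (wdg v).
Proof.
move=> x y; apply/ffunP=> s; rewrite !ffunE.
by case: ifP => _; rewrite ?subr0 ?mulrBr.
Qed.
HB.instance Definition _ v :=
  GRing.isZmodMorphism.Build ch ch (wdg v) (wdg_is_zmod_morphism v).

(** The contraction by the sum of all vertices: the augmented simplicial
    boundary, in which the empty simplex has degree -1. *)
Definition del x : ch := \sum_v rho v x.

Lemma del_is_zmod_morphism : zmod_morphism del.
Proof.
by move=> x y; rewrite /del -sumrB; apply: eq_bigr => v _; rewrite raddfB.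
Qed.
HB.instance Definition _ :=
  GRing.isZmodMorphism.Build ch ch del del_is_zmod_morphism.

Lemma sgU u v s : v \notin s ->
  sg u (v |: s) = (-1) ^+ (r v < r u)%N * sg u s.
Proof.
move=> vs; rewrite /sg -exprD; congr (_ ^+ _).
have -> : [set w in v |: s | (r w < r u)%N] =
  (if (r v < r u)%N then v |: [set w in s | (r w < r u)%N]
   else [set w in s | (r w < r u)%N]).
  by apply/setP=> w; case: ifP => vu; rewrite !inE; have [->|//] := eqVneq w v;
     rewrite vu ?andbF.
by case: ifP => vu; rewrite ?cardsU1 ?inE ?(negPf vs).
Qed.

Lemma sg_sq v s : sg v s * sg v s = 1.
Proof. by rewrite /sg -expr2 sqrr_sign. Qed.

Lemma sgUv v s : sg v (v |: s) = sg v s.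
Proof.
rewrite /sg; congr (_ ^+ _); apply: eq_card => w; rewrite !inE.
by have [->|] := eqVneq w v; rewrite ?ltnn ?andbF.
Qed.

Lemma sgDv v s : sg v (s :\ v) = sg v s.
Proof.
rewrite /sg; congr (_ ^+ _); apply: eq_card => w; rewrite !inE.
by have [->|] := eqVneq w v; rewrite ?ltnn ?andbF.
Qed.

Lemma sign_ltC u v : u != v ->
  (-1) ^+ (r v < r u)%N = - (-1) ^+ (r u < r v)%N :> int.
Proof.
move=> uv; have : r u != r v by rewrite (inj_eq r_inj).
by case: ltngtP.
Qed.

Lemma rho_anti u v x : rho u (rho v x) = - rho v (rho u x).
Proof.
apply/ffunP=> s; rewrite !ffunE !inE.
have [->|uv] := eqVneq u v.
  by rewrite /= mulr0 if_same oppr0.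
rewrite /=.
case: ifP => us; case: ifP => vs; rewrite ?mulr0 ?oppr0 //.
rewrite !sgU ?us ?vs // (sign_ltC uv) setUCA.
ring.
Qed.

Lemma rho_wdg_anti u v x : u != v -> rho u (wdg v x) = - wdg v (rho u x).
Proof.
move=> uv; have vu : v != u by rewrite eq_sym.
apply/ffunP=> s; rewrite !ffunE !inE (negPf uv) (negPf vu) /=.
case: ifP => us; case: ifP => vs; rewrite ?mulr0 ?oppr0 //.
have -> : (u |: s) :\ v = u |: (s :\ v).
  apply/setP=> w; rewrite !inE; case: (w =P u) => [->|]; rewrite ?uv ?andbF //.
have -> : sg u s = - ((-1) ^+ (r u < r v)%N * sg u (s :\ v)).
  by rewrite -{1}(setD1K vs) sgU ?inE ?eqxx // (sign_ltC uv) mulNr.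
rewrite sgU ?us //; set e : int := (-1) ^+ _.
have ee : e * e = 1 by rewrite -expr2 sqrr_sign.
rewrite -[RHS]mul1r -ee; ring.
Qed.

Lemma rho_wdg_id v x : rho v (wdg v x) + wdg v (rho v x) = x.
Proof.
apply/ffunP=> s; rewrite !ffunE !inE eqxx /=; case: ifP => vs.
  by rewrite add0r setD1K // sgDv mulrA sg_sq mul1r.
by rewrite addr0 sgUv setU1K ?vs // mulrA sg_sq mul1r.
Qed.

Lemma wdg_neq0 v x s : wdg v x s != 0 -> v \in s /\ x (s :\ v) != 0.
Proof.
rewrite ffunE; case: ifP => // vs; first by rewrite mulf_eq0 negb_or => /andP[].
Qed.

Lemma wdg_rho v x s : wdg v (rho v x) s = if v \in s then x s else 0.
Proof.
rewrite !ffunE !inE eqxx /=; case: ifP => // vs.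
by rewrite setD1K // sgDv mulrA sg_sq mul1r.
Qed.

(** A contraction is an antiderivation, and contracting the vertex v by the sum
    of all vertices gives 1. Thus the cone over a cycle bounds it. *)
Lemma del_wdg v x : del (wdg v x) = x - wdg v (del x).
Proof.
rewrite /del (bigD1 v) //= raddf_sum /= [in RHS](bigD1 v) //= opprD addrA.
have -> : rho v (wdg v x) = x - wdg v (rho v x).
  by apply/eqP; rewrite eq_sym subr_eq rho_wdg_id.
congr (_ + _).
by rewrite -sumrN; apply: eq_bigr => u uv; rewrite rho_wdg_anti.
Qed.

Lemma rho_del v x : rho v (del x) = - del (rho v x).
Proof.
by rewrite /del raddf_sum /= -sumrN; apply: eq_bigr => u _; rewrite rho_anti.
Qed.

Lemma del_del x : del (del x) = 0.
Proof.
have E : del (del x) = - del (del x).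
  transitivity (\sum_v - del (rho v x)); first by apply: eq_bigr => v _; apply: rho_del.
  by rewrite sumrN; congr (- _); rewrite -raddf_sum.
apply/ffunP=> s; rewrite [RHS]ffunE; have /ffunP/(_ s) := E.
by rewrite [RHS]ffunE; move: (del _ _) => c; lia.
Qed.

(** The coefficient of the boundary at s is the signed sum of the coefficients
    of the cofaces of s, and only one of them can be nonzero. *)
Lemma free_face z v s : del z = 0 -> v \notin s ->
  (forall u, u \notin s -> u != v -> z (u |: s) = 0) -> z (v |: s) = 0.
Proof.
move=> /ffunP/(_ s) + vs z0; rewrite /del sum_ffunE (bigD1 v) //= big1.
  rewrite !ffunE (negPf vs) addr0 => /(congr1 (fun c => sg v s * c)).
  by rewrite mulrA sg_sq mul1r mulr0.
by move=> u uv; rewrite !ffunE; case: ifPn => // us; rewrite z0 ?mulr0.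
Qed.

Lemma wdgU v x s : v \notin s -> wdg v x (v |: s) = sg v s * x s.
Proof. by move=> vs; rewrite !ffunE !inE eqxx /= sgUv setU1K. Qed.

Lemma wdgF v x s : v \notin s -> wdg v x s = 0.
Proof. by move=> /negPf vs; rewrite !ffunE vs. Qed.

Definition on K x := forall s, x s != 0 -> K s.
(** Homogeneous of degree n in the exterior algebra, hence of dimension n - 1. *)
Definition hom n x := on (fun s => #|s| == n) x.

Lemma on0 K : on K 0.
Proof. by move=> s; rewrite ffunE eqxx. Qed.

Lemma onD K x y : on K x -> on K y -> on K (x + y).
Proof.
move=> Kx Ky s; rewrite ffunE; have [x0|/Kx//] := eqVneq (x s) 0.
by rewrite x0 add0r => /Ky.
Qed.

Lemma onN K x : on K x -> on K (- x).
Proof. by move=> Kx s; rewrite ffunE oppr_eq0 => /Kx. Qed.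

Lemma onB K x y : on K x -> on K y -> on K (x - y).
Proof. by move=> Kx Ky; apply/onD/onN. Qed.

Lemma on_sum K (I : Type) (e : seq I) (P : pred I) (F : I -> ch) :
  (forall i, P i -> on K (F i)) -> on K (\sum_(i <- e | P i) F i).
Proof. by move=> KF; elim/big_rec: _ => [|i x Pi]; [exact: on0 | apply/onD/KF]. Qed.

Lemma onMz K x (c : int) : on K x -> on K (x *~ c).
Proof.
move=> Kx s; rewrite ffunMzE; have [->|/Kx//] := eqVneq (x s) 0.
by rewrite mul0rz eqxx.
Qed.

Lemma on_sub K L x : (forall s, K s -> L s) -> on K x -> on L x.
Proof. by move=> KL Kx s /Kx/KL. Qed.

Lemma on_out K x s : on K x -> ~~ K s -> x s = 0.
Proof. by move=> Kx Ks; apply/eqP; apply: contraNT Ks => /Kx. Qed.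

Definition down K := forall s t, t \subset s -> K s -> K t.
Definition lk K v s := (v \notin s) && K (v |: s).

Lemma down_lk K v : down K -> down (lk K v).
Proof.
move=> dK s t ts /andP[vs Ks]; apply/andP; split.
  by apply: contra vs; apply: (subsetP ts).
by apply: dK Ks; apply: setUS.
Qed.

Lemma on_rho K v x : on K x -> on (lk K v) (rho v x).
Proof.
move=> Kx s; rewrite ffunE /lk; case: ifP => //= _.
by rewrite mulf_eq0 negb_or => /andP[_ /Kx].
Qed.

Lemma on_lk K v x : down K -> on (lk K v) x -> on K x.
Proof.
by move=> dK; apply: on_sub => s /andP[_]; apply: dK; apply: subsetUr.
Qed.

Lemma on_del K x : down K -> on K x -> on K (del x).
Proof. by move=> dK Kx; apply: on_sum => v _; apply: on_lk dK _; apply: on_rho. Qed.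

Lemma on_wdg K v x : (forall s, x s != 0 -> K (v |: s)) -> on K (wdg v x).
Proof.
move=> Kx s; rewrite ffunE; case: ifP => vs; rewrite ?eqxx //.
by rewrite mulf_eq0 negb_or => /andP[_ /Kx]; rewrite setD1K.
Qed.

Lemma on_wdg_lk K v x : on (lk K v) x -> on K (wdg v x).
Proof. by move=> Kx; apply: on_wdg => s /Kx /andP[]. Qed.

Lemma hom_rho n v x : hom n.+1 x -> hom n (rho v x).
Proof.
move=> hx s; rewrite ffunE; case: ifPn => vs; rewrite ?eqxx //.
by rewrite mulf_eq0 negb_or => /andP[_ /hx]; rewrite cardsU1 vs.
Qed.

Lemma hom_del n x : hom n.+1 x -> hom n (del x).
Proof. by move=> hx; apply: on_sum => v _; apply: hom_rho. Qed.

Lemma hom_wdg n v x : (forall s, x s != 0 -> v \notin s) -> hom n x -> hom n.+1 (wdg v x).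
Proof.
move=> nx hx s; rewrite ffunE; case: ifP => vs; rewrite ?eqxx //.
rewrite mulf_eq0 negb_or => /andP[_ /hx].
by rewrite (cardsD1 v s) vs.
Qed.

Lemma hom0_del x : hom 0 x -> del x = 0.
Proof.
move=> hx; apply: big1 => v _; apply/ffunP=> s; rewrite !ffunE.
by case: ifPn => // vs; rewrite (on_out hx) ?mulr0 // cardsU1 vs.
Qed.

Definition part n x : ch := [ffun s : {set V} => if #|s| == n then x s else 0].

Lemma part_is_zmod_morphism n : zmod_morphism (part n).
Proof.
by move=> x y; apply/ffunP=> s; rewrite !ffunE; case: ifP; rewrite ?subr0.
Qed.
HB.instance Definition _ n :=
  GRing.isZmodMorphism.Build ch ch (part n) (part_is_zmod_morphism n).

Lemma on_part K n x : on K x -> on K (part n x).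
Proof. by move=> Kx s; rewrite ffunE; case: ifP; rewrite ?eqxx // => _ /Kx. Qed.

Lemma hom_part n x : hom n (part n x).
Proof. by move=> s; rewrite ffunE; case: ifP; rewrite ?eqxx. Qed.

Lemma part_id n x : hom n x -> part n x = x.
Proof.
move=> hx; apply/ffunP=> s; rewrite ffunE; case: ifPn => // ns.
by rewrite (on_out hx).
Qed.

Lemma part_del n x : part n (del x) = del (part n.+1 x).
Proof.
rewrite /del raddf_sum; apply: eq_bigr => v _; apply/ffunP=> s; rewrite !ffunE.
by rewrite cardsU1; case: (v \in s) => //=; rewrite ?if_same //= eqSS; case: ifP; rewrite ?mulr0.
Qed.

Definition bounds K z := exists2 w, on K w & del w = z.

Lemma bounds_hom K n z : hom n z -> bounds K z ->
  exists w, [/\ on K w, hom n.+1 w & del w = z].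
Proof.
move=> hz [w Kw dw]; exists (part n.+1 w); split; first exact: on_part.
  exact: hom_part.
by rewrite -part_del dw part_id.
Qed.

Lemma bounds0 K : bounds K 0.
Proof. by exists 0; rewrite ?raddf0 //; apply: on0. Qed.

Lemma boundsD K x y : bounds K x -> bounds K y -> bounds K (x + y).
Proof.
move=> [w Kw <-] [w' Kw' <-]; exists (w + w'); rewrite ?raddfD //.
exact: onD.
Qed.

Lemma boundsN K x : bounds K x -> bounds K (- x).
Proof. by move=> [w Kw <-]; exists (- w); rewrite ?raddfN //; apply: onN. Qed.

Lemma boundsB K x y : bounds K x -> bounds K y -> bounds K (x - y).
Proof. by move=> bx /boundsN; apply: boundsD. Qed.

Lemma bounds_sum K (I : Type) (e : seq I) (P : pred I) (F : I -> ch) :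
  (forall i, P i -> bounds K (F i)) -> bounds K (\sum_(i <- e | P i) F i).
Proof.
by move=> KF; elim/big_rec: _ => [|i x Pi]; [exact: bounds0 | apply/boundsD/KF].
Qed.

Lemma boundsMz K x (c : int) : bounds K x -> bounds K (x *~ c).
Proof.
by move=> [w Kw <-]; exists (w *~ c); rewrite ?raddfMz //; apply: onMz.
Qed.

Lemma bounds_sub K L x : (forall s, K s -> L s) -> bounds K x -> bounds L x.
Proof. by move=> KL [w Kw <-]; exists w => //; apply: on_sub Kw. Qed.

(** The cone with apex v is a chain of K. *)
Lemma cone_bounds K v z : (forall s, z s != 0 -> K (v |: s)) -> del z = 0 -> bounds K z.
Proof.
move=> Kz dz; exists (wdg v z); first exact: on_wdg.
by rewrite del_wdg dz raddf0 subr0.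
Qed.

Definition avoid K (T : {set V}) s := K s && [disjoint s & T].

(** If the contraction of z by v is the boundary of a chain y of the link of v,
    then adding the boundary of the cone over y removes v from z. No simplex
    contains two vertices of T, so that all of T can be removed at once. *)
Lemma push K (T : {set V}) z : down K ->
  (forall s u v, K s -> u \in T -> v \in T -> u \in s -> v \in s -> u = v) ->
  on K z -> (forall v, v \in T -> bounds (lk K v) (rho v z)) ->
  exists2 w, on K w & on (avoid K T) (z + del w).
Proof.
move=> dK T1 Kz bz.
have [y yP] : {y : V -> ch & forall v, v \in T ->
    on (lk K v) (y v) /\ del (y v) = rho v z}.
  apply: (@boolp.choice _ _ (fun v x => v \in T -> on (lk K v) x /\ del x = rho v z)).
  by move=> v; have [/bz[w]|] := boolP (v \in T); [exists w | exists 0].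
pose w := \sum_(v in T) wdg v (y v).
have Kw : on K w by apply: on_sum => v /yP[? _]; apply: on_wdg_lk.
exists w => // s zs; have Ks : K s.
  by apply: (onD Kz (on_del dK Kw)) zs.
apply/andP; split=> //; rewrite disjoint_subset; apply/subsetP=> v vs.
rewrite inE; apply/negP=> vT; case/negP: zs.
have -> : del w = \sum_(v in T) y v - \sum_(v in T) wdg v (rho v z).
  rewrite raddf_sum -sumrB; apply: eq_bigr => u /yP[_ dy].
  by rewrite /= del_wdg dy.
rewrite 3!ffunE !sum_chE big1 => [|u uT]; last first.
  apply: on_out (proj1 (yP u uT)) _; apply/negP=> /andP[us Kus].
  by case/negP: us; rewrite (T1 _ u v Kus uT vT) // !inE ?eqxx ?vs ?orbT.
rewrite (bigD1 v) //= wdg_rho vs big1 => [|u /andP[uT uv]].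
  by rewrite addr0 sub0r subrr.
rewrite wdg_rho; case: ifP => // us; case/eqP: uv; exact: T1 Ks _ _ _ _.
Qed.

(** The relative homology of the pair (K, L) vanishes, stated for relative cycles
    so as to compose and to give both the surjectivity and the injectivity of
    the map induced by the inclusion of L in K. *)
Definition retr K L := forall z, on K z -> on L (del z) ->
  exists2 w, on K w & on L (z + del w).

Lemma retr_refl K : retr K K.
Proof. by move=> z Kz _; exists 0; rewrite ?raddf0 ?addr0 //; apply: on0. Qed.

Lemma retr_trans K L M : (forall s, L s -> K s) -> (forall s, M s -> L s) ->
  retr K L -> retr L M -> retr K M.
Proof.
move=> LK ML KL LM z Kz Mz.
have [w Kw Lz] := KL z Kz (on_sub ML Mz).
have [|w' Lw' Mz'] := LM _ Lz; first by rewrite raddfD /= del_del addr0.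
exists (w + w'); first by apply: onD => //; apply: on_sub Lw'.
by rewrite raddfD addrA.
Qed.

(** The link of v is a cone with apex q, so that v can be pushed away. *)
Lemma retr_vertex K v q : down K -> v != q ->
  (forall s, lk K v s -> lk K v (q |: s)) -> retr K (avoid K [set v]).
Proof.
move=> dK vq cone z Kz Lz; apply: push => // [s u u' _ /set1P-> /set1P->//|u /set1P->].
apply: (@cone_bounds _ q); first by move=> s /(on_rho (v := v) Kz) /cone.
apply/eqP; rewrite -oppr_eq0 -rho_del; apply/eqP/ffunP=> s; rewrite !ffunE.
case: ifP => // vs; rewrite (on_out Lz) ?mulr0 // /avoid disjoint_sym.
by rewrite disjoints1 !inE eqxx andbF.
Qed.

(** The link of the edge a b is a cone with apex q. Let y be the contraction of
    a relative cycle by both ends of the edge; it is a cycle of that link, and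
    the triple cone over y with apices a, b and q has, up to sign, the part of
    the relative cycle which contains the edge in its boundary. *)
Lemma retr_edge K a b q : down K -> a != b -> q != a -> q != b ->
  (forall s, a \notin s -> b \notin s -> K (a |: (b |: s)) -> K (a |: (b |: (q |: s)))) ->
  retr K (fun s => K s && ~~ ((a \in s) && (b \in s))).
Proof.
move=> dK ab qa qb cone z Kz Lz.
pose y := rho b (rho a z).
have yP s : y s != 0 -> [/\ a \notin s, b \notin s & K (a |: (b |: s))].
  rewrite !ffunE !inE (negPf ab) /=.
  case: ifPn => // bs; rewrite ?eqxx //; case: ifPn => // as_; rewrite ?mulr0 ?eqxx //.
  by rewrite !mulf_eq0 !negb_or => /and3P[_ _ /Kz].
have dy : del y = 0.
  have -> : del y = rho b (rho a (del z)).
    by rewrite /y rho_del !raddfN /= rho_del opprK.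
  apply/ffunP=> s; rewrite !ffunE !inE (negPf ab) /=.
  case: ifPn => // bs; case: ifPn => // as_; rewrite ?mulr0 //.
  rewrite (on_out Lz); first by rewrite !mulr0.
  by rewrite !inE !eqxx orbT andbF.
have yab s : a \in s -> b \in s -> wdg a (wdg b y) s = z s.
  move=> as_ bs; rewrite [LHS]ffunE as_ wdg_rho !inE eq_sym ab bs.
  by have := wdg_rho a z s; rewrite ffunE as_.
move: y yP dy yab => y yP dy yab.
have w0 u s : (u == a) || (u == b) -> u \in s -> wdg q y s = 0.
  move=> uab us; apply/eqP/negPn/negP=> /wdg_neq0[qs /yP[nas nbs _]].
  have qu : u != q by case/orP: uab => /eqP->; rewrite eq_sym.
  by case/orP: uab => /eqP uE; [case/negP: nas | case/negP: nbs]; rewrite -uE !inE qu us.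
pose w := wdg a (wdg b (wdg q y)).
have Kw : on K w.
  apply: on_wdg => s /wdg_neq0[bs /wdg_neq0[qs /yP[nas nbs /cone]]].
  by rewrite [q |: _]setD1K // [b |: _]setD1K //; apply.
exists (- w); first exact: onN.
rewrite raddfN /= => s zs; have Ks : K s by apply: (onB Kz (on_del dK Kw)) zs.
rewrite Ks /=; apply/negP=> /andP[as_ bs]; case/negP: zs.
have -> : del w = wdg b (wdg q y) - wdg a (wdg q y) + wdg a (wdg b y).
  by rewrite /w !del_wdg dy raddf0 subr0 !raddfB /= opprK addrA.
have e1 : wdg b (wdg q y) s = 0.
  by rewrite [LHS]ffunE bs (w0 a) ?mulr0 ?eqxx // !inE ab.
have e2 : wdg a (wdg q y) s = 0.
  by rewrite [LHS]ffunE as_ (w0 b) ?mulr0 ?eqxx ?orbT // !inE eq_sym ab.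
by rewrite !(chDE, chNE) e1 e2 yab // subrr add0r subrr.
Qed.

End Exterior.

(** * Homology classes and ranks *)

Section HomologyClasses.
Variables (C2 C1 C0 : zmodType).
Variables (f : {additive C2 -> C1}) (g : {additive C1 -> C0}).

Definition cls (z : cycles g) : homology f g := (\pi z)%qT.

Lemma cls_is_zmod_morphism : zmod_morphism cls.
Proof. by move=> x y; rewrite /cls raddfB. Qed.
HB.instance Definition _ :=
  GRing.isZmodMorphism.Build (cycles g) (homology f g) cls cls_is_zmod_morphism.

Lemma cls_surj (h : homology f g) : exists z, cls z = h.
Proof. by exists (generic_quotient.repr h); rewrite /cls generic_quotient.reprK. Qed.

Lemma cls_eq0 (z : cycles g) : (cls z = 0) <-> (exists c, f c = cycle_val z).
Proof.
have E : (cls z == 0) = (z \in is_boundary f (g := g)).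
  by rewrite /cls -(raddf0 (\pi_(homology f g)%qT)) -Quotient.idealrBE subr0.
split; first by move/eqP; rewrite E => /asboolP.
by move=> h; apply/eqP; rewrite E; apply/asboolP.
Qed.

Definition cycle_of x (gx : g x = 0) : cycles g := @Cycle C1 C0 g x (introT eqP gx).

Lemma cycle_valP (z : cycles g) : g (cycle_val z) = 0.
Proof. by case: z => x /= /eqP. Qed.

Lemma homology_trivial :
  (forall x, g x = 0 -> exists c, f c = x) -> trivial_zmod (homology f g).
Proof.
by move=> fg h; have [z <-] := cls_surj h; apply/cls_eq0/fg/cycle_valP.
Qed.

Lemma homology_torsion_free :
  (forall x n, (0 < n)%N -> g x = 0 -> (exists c, f c = x *+ n) -> exists c, f c = x) ->
  torsion_free (homology f g).
Proof.
move=> fg h n n0; have [z <-] := cls_surj h; rewrite -raddfMn => /cls_eq0 fz.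
apply/cls_eq0/(fg _ n n0); first exact: cycle_valP.
by move: fz; rewrite -[cycle_val _]/(val _) raddfMn.
Qed.

End HomologyClasses.

Section RankBounds.
Variables (T : finType) (C2 C0 : zmodType).
Variables (f : {additive C2 -> {ffun T -> int}}) (g : {additive {ffun T -> int} -> C0}).

Lemma tfrank_le k :
  (forall x : 'I_k.+1 -> {ffun T -> int}, (forall i, g (x i) = 0) ->
     exists2 c : 'I_k.+1 -> int, exists i, c i != 0 &
       exists w, f w = \sum_i x i *~ c i) ->
  (tfrank (homology f g) <= k)%N.
Proof.
move=> dep; have [[a a_free] _] := homology_has_tfrank f g.
move: (tfrank _) a a_free => n a a_free; rewrite leqNgt; apply/negP=> ltkn.
pose a' (i : 'I_k.+1) := a (widen_ord ltkn i).
have [z za] : exists z : 'I_k.+1 -> cycles g, forall i, cls f (z i) = a' i.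
  have [z za] := boolp.choice (fun i => cls_surj (a' i)).
  by exists z.
have [i|c [i0 ci0] [w fw]] := dep (fun i => cycle_val (z i)); first exact: cycle_valP.
(* The relation among the first k + 1 classes, extended by zero. *)
pose c' (j : 'I_n) := if insub (val j) is Some i then c i else 0.
have /a_free/(_ (widen_ord ltkn i0)) : \sum_j a j *~ c' j = 0.
  transitivity (\sum_i a' i *~ c i).
    rewrite (bigID (fun j : 'I_n => (j < k.+1)%N)) /= [X in _ + X]big1 ?addr0.
      rewrite (big_ord_narrow ltkn) /=; apply: eq_bigr => i _.
      rewrite /a' /c'; congr (_ *~ _).
      case: insubP => [j _ ji|]; last by rewrite /= ltn_ord.
      by congr c; apply: val_inj.
    move=> j /negPf jk; rewrite /c'; case: insubP => [i|]; last by rewrite mulr0z.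
    by rewrite jk.
  under eq_bigr => i _ do rewrite -za -raddfMz.
  rewrite -raddf_sum; apply/cls_eq0; exists w; rewrite fw.
  rewrite -[RHS]/(val _) raddf_sum; apply: eq_bigr => i _.
  by rewrite raddfMz.
rewrite /c'; case: insubP => [j _ ji|]; last by rewrite /= ltn_ord.
have -> : j = i0 by apply: val_inj.
by move/eqP; rewrite (negPf ci0).
Qed.

Lemma tfrank_gt0 x : g x = 0 ->
  (forall c w, f w = x *~ c -> c = 0) -> (0 < tfrank (homology f g))%N.
Proof.
move=> gx x_free; have [_ max] := homology_has_tfrank f g.
rewrite lt0n; apply/negP=> /eqP rk0; case: max; rewrite rk0.
exists (fun=> cls f (cycle_of gx)) => c; rewrite big_ord1 -raddfMz => /cls_eq0[w fw] i.
rewrite ord1; apply: (x_free _ w).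
by move: fw; rewrite -[cycle_val _]/(val _) raddfMz.
Qed.

Lemma tfrank_trivial : trivial_zmod (homology f g) -> tfrank (homology f g) = 0%N.
Proof.
move=> triv; apply/eqP; rewrite -leqn0; apply: tfrank_le => x gx.
exists (fun=> 1); first by exists ord0.
by rewrite big_ord1 mulr1z; apply/(cls_eq0 f (cycle_of (gx ord0))).
Qed.

End RankBounds.

(** * The order complex in the exterior algebra *)

Section OrderComplexChains.
Variables (d : Order.disp_t) (P : finPOrderType d).
Implicit Types (s : {set P}) (v : P).

(** A linear extension of the order, injective into the natural numbers: the
    size of the strict down-set comes first and the rank in the enumeration,
    which is less than #|P| + 1, breaks ties. *)
Definition linext v : nat := (#|[set u : P | (u < v)%O]| * #|P|.+1 + enum_rank v)%N.

Lemma linext_inj : injective linext.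
Proof.
move=> u v; rewrite /linext => E; apply/enum_rank_inj/val_inj.
have := congr1 (modn^~ #|P|.+1) E; rewrite !modnMDl.
by rewrite !modn_small // ltnS ltnW.
Qed.

Lemma linext_lt u v : (u < v)%O -> (linext u < linext v)%N.
Proof.
move=> uv; have : [set w | (w < u)%O] \proper [set w | (w < v)%O].
  apply/properP; split; last by exists u; rewrite !inE ?ltxx.
  by apply/subsetP=> w; rewrite !inE => /lt_trans; apply.
move/proper_card; rewrite /linext; set a := #|[set _ | _]|; set b := #|[set _ | _]| => ab.
apply: (@leq_trans (a.+1 * #|P|.+1)); first by rewrite mulSnr ltn_add2l ltnS ltnW.
by apply: leq_trans (leq_addr _ _); rewrite leq_mul2r ab orbT.
Qed.

Definition ischain s := [forall u in s, forall v in s, (u >=< v)%O].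

Lemma ischainP s : reflect (forall u v, u \in s -> v \in s -> (u >=< v)%O) (ischain s).
Proof.
apply: (iffP forall_inP) => [h u v us vs|h u us].
  by move/forall_inP: (h u us); apply.
by apply/forall_inP=> v vs; apply: h.
Qed.

Lemma down_ischain : down ischain.
Proof.
by move=> s t /subsetP ts /ischainP cs; apply/ischainP=> u v /ts us /ts; apply: cs.
Qed.

Definition sset n (t : simplex P n) : {set P} := [set v in val (val t)].

Lemma in_sset n (t : simplex P n) v : (v \in sset t) = (v \in val (val t)).
Proof. by rewrite inE. Qed.

Lemma simplex_uniq n (t : simplex P n) : uniq (val (val t)).
Proof. by case: t => t /= st; apply: sorted_uniq st; [exact: lt_trans | exact: ltxx]. Qed.

Lemma sset_inj n : injective (@sset n).
Proof.
move=> t u /setP E; apply/val_inj/val_inj.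
apply: (irr_sorted_eq lt_trans ltxx (valP t) (valP u)) => v.
by have := E v; rewrite !in_sset.
Qed.

Lemma card_sset n (t : simplex P n) : #|sset t| = n.
Proof. by rewrite cardsE (card_uniqP (simplex_uniq t)) size_tuple. Qed.

Lemma simplex_lt n (t : simplex P n) (i j : 'I_n) :
  (i < j)%N -> (tnth (val t) i < tnth (val t) j)%O.
Proof.
move=> ij; have x0 := tnth (val t) i; rewrite !(tnth_nth x0).
by rewrite (sorted_ltn_nth lt_trans) ?inE ?size_tuple //; apply: valP t.
Qed.

Lemma sset_chain n (t : simplex P n) : ischain (sset t).
Proof.
apply/ischainP=> u v; rewrite !in_sset => /tnthP[i ->] /tnthP[j ->].
have [/(simplex_lt t)/lt_comparable//|/(simplex_lt t)/lt_comparable|/val_inj->] := ltngtP i j.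
  by rewrite comparable_sym.
exact: comparablexx.
Qed.

Lemma chain_sset n s : ischain s -> #|s| = n -> exists t : simplex P n, sset t = s.
Proof.
move=> /ischainP cs sn; pose e := sort (relpre linext leq) (enum s).
have e_mem : e =i s by move=> v; rewrite mem_sort mem_enum.
have e_sorted : sorted <%O e.
  apply: (@sub_in_sorted _ (mem s) (relpre linext ltn)) => [u v us vs /= uv||].
  - case: (comparable_ltgtP (cs u v us vs)) => // [vu|uv'].
      by have := linext_lt vu; rewrite ltnNge ltnW.
    by rewrite uv' ltnn in uv.
  - by apply/allP=> v; rewrite e_mem.
  rewrite -sorted_map ltn_sorted_uniq_leq (map_inj_uniq linext_inj).
  rewrite sort_uniq enum_uniq sorted_map /=.
  by apply: sort_sorted => u v; apply: leq_total.
have e_size : size e == n by rewrite size_sort -cardE sn.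
exists (exist (fun t : n.-tuple P => sorted <%O t) (Tuple e_size) e_sorted).
by apply/setP=> v; rewrite in_sset e_mem.
Qed.

Lemma sset_face n (i : 'I_n.+1) (t : simplex P n.+1) :
  sset (face i t) = sset t :\ tnth (val t) i.
Proof.
have t_inj := tuple_uniqP _ (simplex_uniq t).
apply/setP=> v; rewrite !inE; apply/mapP/andP.
  move=> [j _ ->]; split; last exact: mem_tnth.
  by rewrite (inj_eq t_inj) eq_sym neq_lift.
move=> [vi /tnthP[k vk]]; move: vi; rewrite vk (inj_eq t_inj) eq_sym => ik.
by have [j -> _] := unlift_some ik; exists j; rewrite ?mem_enum.
Qed.

Lemma sg_sset n (i : 'I_n.+1) (t : simplex P n.+1) :
  sg linext (tnth (val t) i) (sset t) = (-1) ^+ i.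
Proof.
have t_inj := tuple_uniqP _ (simplex_uniq t).
rewrite /sg; congr (_ ^+ _).
transitivity #|[set tnth (val t) j | j : 'I_n.+1 & (j < i)%N]|.
  apply: eq_card => v; rewrite inE in_sset; apply/andP/imsetP.
    move=> [/tnthP[j ->] ji]; exists j => //; rewrite inE ltnNge leq_eqVlt.
    apply/negP=> /orP[/eqP/val_inj ij|/(simplex_lt t)/linext_lt].
      by rewrite ij ltnn in ji.
    by rewrite ltnNge ltnW.
  move=> [j]; rewrite inE => /(simplex_lt t)/linext_lt ji ->.
  by rewrite mem_tnth.
rewrite card_imset // cardsE -sum1_card.
by rewrite -(big_ord_widen _ (fun=> 1%N) (ltnW (ltn_ord i))) sum1_card card_ord.
Qed.

Local Notation chP := (ch P).

(** The basis of simplices is sent to the basis of sets. The vertices of a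
    simplex are listed in increasing order, hence increasingly for linext, and
    the signs of the two boundaries agree. *)
Definition emb n (x : chain P n) : chP :=
  [ffun s : {set P} => \sum_(t : simplex P n | sset t == s) x t].

Lemma emb_is_zmod_morphism n : zmod_morphism (@emb n).
Proof.
move=> x y; apply/ffunP=> s; rewrite !ffunE -sumrB.
by apply: eq_bigr => t _; rewrite !ffunE.
Qed.
HB.instance Definition _ n :=
  GRing.isZmodMorphism.Build (chain P n) chP (@emb n) (@emb_is_zmod_morphism n).

Lemma emb_sset n (x : chain P n) t : emb x (sset t) = x t.
Proof. by rewrite ffunE (big_pred1 t) // => u; rewrite (inj_eq (@sset_inj n)). Qed.

Lemma emb_supp n (x : chain P n) s : emb x s != 0 -> exists t : simplex P n, s = sset t.
Proof.
have [/existsP[t /eqP <-]|/existsPn no] := boolP [exists t : simplex P n, sset t == s].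
  by exists t.
by rewrite ffunE big_pred0 ?eqxx // => t; apply/negbTE/no.
Qed.

Lemma on_emb n (x : chain P n) : on ischain (emb x).
Proof. by move=> s /emb_supp[t ->]; apply: sset_chain. Qed.

Lemma hom_emb n (x : chain P n) : hom n (emb x).
Proof. by move=> s /emb_supp[t ->]; apply/eqP/card_sset. Qed.

Lemma emb_inj n : injective (@emb n).
Proof. by move=> x y xy; apply/ffunP=> t; rewrite -!emb_sset xy. Qed.

Lemma emb_surj n (y : chP) : on ischain y -> hom n y -> exists x : chain P n, emb x = y.
Proof.
move=> cy hy; exists [ffun t => y (sset t)]; apply/ffunP=> s.
have [y0|y0] := eqVneq (y s) 0.
  rewrite y0; apply/eqP/negPn/negP=> es; case/negP: (es).
  by have [t st] := emb_supp es; rewrite st emb_sset ffunE -st y0.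
have [t <-] := chain_sset (cy _ y0) (eqP (hy _ y0)).
by rewrite emb_sset ffunE.
Qed.

Lemma emb_bdry n (x : chain P n.+1) : del linext (emb x) = emb (bdry x).
Proof.
apply/ffunP=> s; have [/existsP[t0 /eqP <-]|/existsPn no] :=
    boolP [exists t : simplex P n, sset t == s]; last first.
  have zero (y : chP) : on ischain y -> hom n y -> y s = 0.
    move=> cy hy; apply/eqP/negPn/negP=> ys.
    have [t st] := chain_sset (cy _ ys) (eqP (hy _ ys)).
    by case/negP: (no t); rewrite st.
  rewrite !zero //; first exact: on_emb; first exact: hom_emb.
    by apply: on_del; [exact: down_ischain | exact: on_emb].
  by apply: hom_del; exact: hom_emb.
rewrite emb_sset [RHS]ffunE /del sum_chE.
transitivity (\sum_v \sum_(t : simplex P n.+1 | (v \notin sset t0) && (sset t == v |: sset t0))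
   sg linext v (sset t0) * x t).
  apply: eq_bigr => v _; rewrite !ffunE; case: ifPn => vt.
    by rewrite big_pred0.
  by rewrite mulr_sumr.
rewrite (exchange_big_dep predT) //=; apply: eq_bigr => t _.
pose Q v := (v \notin sset t0) && (sset t == v |: sset t0).
have QE v : v \in sset t -> Q v = (sset t0 == sset t :\ v).
  move=> vt; apply/andP/eqP => [[v0 /eqP->]|->]; first by rewrite setU1K.
  by rewrite !inE eqxx setD1K.
rewrite (bigID (mem (val (val t)))) /= [X in _ + X]big1 ?addr0; last first.
  move=> v /andP[/andP[_ /eqP st] vt]; case/negP: vt.
  by rewrite -in_sset st !inE eqxx.
under eq_bigl => v do rewrite andbC.
rewrite big_mkcondr -(big_uniq _ (simplex_uniq t)) big_tuple -big_mkcond /=.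
apply: eq_big => i; first by rewrite -/(Q _) QE ?in_sset ?mem_tnth // -sset_face (inj_eq (@sset_inj n)) eq_sym.
rewrite -/(Q _) QE ?in_sset ?mem_tnth // => /eqP->.
by rewrite sgDv sg_sset.
Qed.

Section Transfer.
Variable n : nat.
Implicit Types x : chain P n.+1.

Lemma bdry_eq0 x : bdry x = 0 -> del linext (emb x) = 0.
Proof. by rewrite emb_bdry => ->; rewrite raddf0. Qed.

(** A chain which bounds an embedded one may be taken homogeneous, and then it is
    embedded itself. *)
Lemma bounds_emb x : bounds linext ischain (emb x) <-> exists w, bdry w = x.
Proof.
split=> [/(bounds_hom (@hom_emb _ x))[w [cw hw dw]]|[w <-]]; last first.
  by exists (emb w); rewrite ?emb_bdry //; apply: on_emb.
have [w' ew] := emb_surj cw hw; exists w'; apply: emb_inj.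
by rewrite -emb_bdry ew.
Qed.

End Transfer.

End OrderComplexChains.

(** * Rank bounds, connectedness and clique complexes *)

Section General.
Variables (V : finType) (r : V -> nat).
Hypothesis r_inj : injective r.
Implicit Types (u v a b : V) (s t : {set V}) (x y z w : ch V) (K L M : {set V} -> bool).
Local Notation bounds := (bounds r).
Local Notation del := (del r).
Local Notation wdg := (wdg r).
Local Notation rho := (rho r).
Local Notation sg := (sg r).

Definition cyc K n z := [/\ on K z, hom n z & del z = 0].

Lemma cycMB K n x y c c' : cyc K n x -> cyc K n y -> cyc K n (x *~ c - y *~ c').
Proof.
move=> [Kx hx dx] [Ky hy dy]; split; try by apply: onB; apply: onMz.
by rewrite raddfB /= !raddfMz /= dx dy oppr0 !mul0rz addr0.
Qed.

(** Modulo boundaries, the elements of Z have rank at most k. It is stated by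
    dependence, so that no group of classes has to be formed. *)
Definition dep_le K (Z : ch V -> Prop) k :=
  forall x : 'I_k.+1 -> ch V, (forall i, Z (x i)) ->
  exists2 c : 'I_k.+1 -> int, exists i, c i != 0 & bounds K (\sum_i x i *~ c i).

Lemma dep_le0 K (Z : ch V -> Prop) : (forall z, Z z -> bounds K z) -> dep_le K Z 0.
Proof.
move=> bZ x Zx; exists (fun=> 1); first by exists ord0.
by rewrite big_ord1 mulr1z; apply/bZ/Zx.
Qed.

Lemma dep_le_homologous K (Z Z' : ch V -> Prop) k :
  (forall z, Z z -> exists2 z', Z' z' & bounds K (z - z')) ->
  dep_le K Z' k -> dep_le K Z k.
Proof.
move=> ZZ' dep x Zx.
have [i|x' x'P] := @boolp.choice _ _ (fun i x' => Z' x' /\ bounds K (x i - x')).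
  by have [x' Zx' bx'] := ZZ' _ (Zx i); exists x'.
have [i|c c0 bc] := dep x'; first by case: (x'P i).
exists c => //; rewrite -[\sum_i _](subrK (\sum_i x' i *~ c i)).
apply: boundsD => //; rewrite -sumrB; apply: bounds_sum => i _.
by rewrite -mulrzBl; apply: boundsMz; case: (x'P i).
Qed.

(** Evaluation at s is a linear functional. If some x i0 has a nonzero value
    there, then the other elements can be corrected by multiples of x i0 so as
    to vanish at s, and a relation between the k + 1 corrected ones gives one
    between the k + 2 given ones. *)
Lemma dep_le_eval1 K (Z : ch V -> Prop) s k :
  (forall x y c c', Z x -> Z y -> Z (x *~ c - y *~ c')) ->
  dep_le K (fun z => Z z /\ z s = 0) k -> dep_le K Z k.+1.
Proof.
move=> Zlin dep x Zx.
have [i0 [e [e0 eP]]] : exists i0 e, e != 0 /\ forall j, x j s * e = x i0 s * x j s.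
  have [/existsP[i0 xi0]|/existsPn x0] := boolP [exists i, x i s != 0].
    by exists i0, (x i0 s); split=> // j; rewrite mulrC.
  exists ord0, 1; split=> // j; suff -> : x j s = 0 by rewrite mulr0 mul0r.
  by apply/eqP; rewrite -[_ == _]negbK x0.
have [i|c [j0 cj0] bc] := dep (fun j => x (lift i0 j) *~ e - x i0 *~ (x (lift i0 j) s)).
  split; first by apply: Zlin.
  by rewrite chDE chNE !ffunMzE !mulrzz eP subrr.
pose m := - \sum_j x (lift i0 j) s * c j.
exists (fun i => if unlift i0 i is Some j then e * c j else m).
  by exists (lift i0 j0); rewrite liftK mulf_neq0.
rewrite (bigD1_ord i0) //= unlift_none.
rewrite [X in bounds _ X](_ : _ = \sum_j (x (lift i0 j) *~ e - x i0 *~ x (lift i0 j) s) *~ c j) //.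
under [RHS]eq_bigr => j _ do rewrite mulrzBl -!mulrzA.
rewrite sumrB addrC; congr (_ + _); first by apply: eq_bigr => j _; rewrite liftK.
rewrite /m mulrNz; congr (- _).
by rewrite mulrz_sumr; apply: eq_bigr => j _; rewrite mulrzA.
Qed.

Lemma dep_le_eval K (Z : ch V -> Prop) (e : seq {set V}) k :
  (forall x y c c', Z x -> Z y -> Z (x *~ c - y *~ c')) ->
  dep_le K (fun z => Z z /\ forall s, s \in e -> z s = 0) k -> dep_le K Z (size e + k).
Proof.
elim: e Z => [|s e IHe] Z Zlin dep.
  apply: dep_le_homologous dep => z Zz; exists z; first by split.
  by rewrite subrr; apply: bounds0.
apply: (@dep_le_eval1 _ _ s) => //; apply: IHe.
  move=> x y c c' [Zx x0] [Zy y0]; split; first exact: Zlin.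
  by rewrite chDE chNE !ffunMzE x0 y0 !mul0rz subrr.
apply: dep_le_homologous dep => z [[Zz z0] ze]; exists z; last first.
  by rewrite subrr; apply: bounds0.
by split=> // t; rewrite inE => /predU1P[->|/ze].
Qed.

(** The unit of the exterior algebra, that is, the empty simplex. *)
Definition one : ch V := [ffun s : {set V} => (s == set0)%:R].

Lemma hom_one : hom 0 one.
Proof. by move=> s; rewrite ffunE /= cards_eq0; case: (s == set0). Qed.

Lemma del_one : del one = 0.
Proof. exact/hom0_del/hom_one. Qed.

Lemma oneE s : one s = (s == set0)%:R.
Proof. by rewrite ffunE. Qed.

Lemma del_wdg1 v : del (wdg v one) = one.
Proof. by rewrite del_wdg // del_one raddf0 subr0. Qed.

Lemma wdg1E v s : wdg v one s = (s == [set v])%:R.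
Proof.
rewrite ffunE oneE; have [->|sv] := eqVneq s [set v].
  rewrite inE eqxx setDv eqxx mulr1 /sg.
  suff -> : [set u in [set v] | (r u < r v)%N] = set0 by rewrite cards0.
  by apply/setP=> u; rewrite !inE; have [->|//] := eqVneq u v; rewrite ltnn.
case: ifP => // vs; case: eqP => [s0|]; last by rewrite mulr0.
by case/eqP: sv; rewrite -(setD1K vs) s0 setU0.
Qed.

Lemma wdg2E u v s : u != v -> wdg u (wdg v one) s != 0 -> s = u |: [set v].
Proof.
move=> uv /wdg_neq0[us]; rewrite wdg1E; have [E _|//] := eqVneq (s :\ u) [set v].
by rewrite -E setD1K.
Qed.

Lemma del_wdg2 u v : del (wdg u (wdg v one)) = wdg v one - wdg u one.
Proof. by rewrite del_wdg // del_wdg1. Qed.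

(** Connectedness by a path, in homological form. *)
Definition conn K u v := bounds K (wdg u one - wdg v one).

Lemma conn_refl K v : conn K v v.
Proof. by rewrite /conn subrr; apply: bounds0. Qed.

Lemma conn_sym K u v : conn K u v -> conn K v u.
Proof. by move/boundsN; rewrite opprB. Qed.

Lemma conn_trans K v u v' : conn K u v -> conn K v v' -> conn K u v'.
Proof. by move=> uv /(boundsD uv); rewrite addrA subrK. Qed.

Lemma conn_edge K u v : u != v -> K (u |: [set v]) -> conn K u v.
Proof.
move=> uv Kuv; apply: conn_sym; exists (wdg u (wdg v one)); last exact: del_wdg2.
by move=> s /(wdg2E uv)->.
Qed.

Lemma hom1E z : hom 1 z -> z = \sum_v wdg v one *~ z [set v].
Proof.
move=> hz; apply/ffunP=> s; rewrite sum_chE.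
under eq_bigr => v _ do rewrite ffunMzE wdg1E.
have [zs|zs] := eqVneq (z s) 0.
  rewrite zs big1 // => v _; have [sv|_] := eqVneq s [set v]; last by rewrite mul0rz.
  by rewrite -sv zs mulr0z.
have /cards1P[v sv] := hz _ zs.
rewrite (bigD1 v) //= sv eqxx intz big1 ?addr0 // => u uv.
by rewrite (inj_eq set1_inj) eq_sym (negPf uv) mul0rz.
Qed.

Lemma del_set0 z : del z set0 = \sum_v z [set v].
Proof.
rewrite sum_chE; apply: eq_bigr => v _; rewrite ffunE inE setU0 /sg.
suff -> : [set u in set0 | (r u < r v)%N] = set0 by rewrite cards0 mul1r.
by apply/setP=> u; rewrite !inE.
Qed.

(** A cycle of degree 0 has augmentation zero, and is therefore a combination of
    differences between a vertex and v0. *)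
Lemma conn_bounds K z v0 : (forall v, K [set v] -> conn K v v0) ->
  cyc K 1 z -> bounds K z.
Proof.
move=> conn0 [Kz hz dz]; have sz : \sum_v z [set v] = 0 by rewrite -del_set0 dz ffunE.
have -> : z = \sum_v (wdg v one - wdg v0 one) *~ z [set v].
  under eq_bigr => v _ do rewrite mulrzBl.
  by rewrite sumrB -mulrz_sumr sz mulr0z subr0 -hom1E.
apply: bounds_sum => v _; have [->|zv] := eqVneq (z [set v]) 0.
  by rewrite mulr0z; apply: bounds0.
by apply: boundsMz; apply/conn0/Kz.
Qed.

Lemma push_cyc K (T : {set V}) n z : down K ->
  (forall s u v, K s -> u \in T -> v \in T -> u \in s -> v \in s -> u = v) ->
  cyc K n.+1 z -> (forall v, v \in T -> cyc (lk K v) n (rho v z) -> bounds (lk K v) (rho v z)) ->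
  exists2 w, on K w & cyc (avoid K T) n.+1 (z + del w).
Proof.
move=> dK T1 [Kz hz dz] bz; have [|w Kw Lz] := push r_inj dK T1 Kz.
  move=> v vT; apply: bz => //; split; first exact: on_rho.
    exact: hom_rho.
  by apply/eqP; rewrite -oppr_eq0 -rho_del // dz raddf0.
exists (part n.+2 w); first exact: on_part.
have E : z + del (part n.+2 w) = part n.+1 (z + del w).
  by rewrite raddfD /= [part _ z]part_id // part_del.
split; [by rewrite E; apply: on_part | by rewrite E; apply: hom_part|].
by rewrite raddfD /= dz del_del // addr0.
Qed.

(** The vertices which extend s to a simplex of the support are in X, and all of
    them but the head of X are excluded: the head is alone, and free_face
    applies. With X an enumeration, its tail indexes values of z which are
    enough to determine it. *)
Lemma last_coface z s (X : seq V) : del z = 0 ->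
  (forall u, u \notin s -> z (u |: s) != 0 -> u \in X) ->
  (forall u, u \notin s -> u \in behead X -> z (u |: s) = 0) ->
  forall u, u \notin s -> z (u |: s) = 0.
Proof.
move=> dz zX z0 u us; apply/eqP/negPn/negP=> zu.
have uX := zX u us zu; case: X => [|v X] //= in zX z0 uX.
case/negP: zu; apply/eqP; move: uX; rewrite inE => /predU1P[uv|]; last exact: z0.
apply: free_face dz us _ => w ws wu; apply/eqP/negPn/negP=> zw.
have := zX w ws zw; rewrite inE -uv (negPf wu) /= => wX.
by case/negP: zw; rewrite z0.
Qed.

Section Cliques.
Variable adj : rel V.

Definition clique (S : pred V) s :=
  [forall u in s, S u && [forall v in s, (u != v) ==> adj u v]].

Lemma cliqueP (S : pred V) s :
  reflect (forall u, u \in s -> S u /\ forall v, v \in s -> u != v -> adj u v) (clique S s).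
Proof.
apply: (iffP forall_inP) => [h u us|h u us].
  by have /andP[Su /forall_inP adj_u] := h u us; split=> // v /adj_u/implyP.
have [Su adj_u] := h u us; rewrite Su /=; apply/forall_inP=> v vs.
by apply/implyP; apply: adj_u.
Qed.

Lemma down_clique (S : pred V) : down (clique S).
Proof.
move=> s t /subsetP ts /cliqueP cs; apply/cliqueP=> u /ts us.
by have [Su adj_u] := cs u us; split=> // v /ts; apply: adj_u.
Qed.

Lemma clique_sub (S S' : pred V) s : (forall v, S v -> S' v) -> clique S s -> clique S' s.
Proof. by move=> SS' /cliqueP cs; apply/cliqueP=> u /cs[/SS' ?]. Qed.

Lemma avoid_clique (S : pred V) (T : {set V}) s :
  avoid (clique S) T s = clique (fun v => S v && (v \notin T)) s.
Proof.
apply/andP/cliqueP => [[/cliqueP cs sT] u us|cs].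
  have [Su adj_u] := cs u us; split=> //.
  by rewrite Su; apply: contraTN sT => uT; apply/pred0Pn; exists u; rewrite /= us.
split; last by apply/pred0P=> u /=; apply/andP=> -[/cs[/andP[_ /negPf->]]].
by apply/cliqueP=> u /cs[/andP[]].
Qed.

Hypothesis adj_sym : symmetric adj.

Lemma cliqueU (S : pred V) v s : clique S (v |: s) =
  [&& S v, clique S s & [forall u in s, (u != v) ==> adj v u]].
Proof.
apply/cliqueP/and3P=> [cs|[Sv /cliqueP cs /forall_inP adj_v] u].
  have [Sv adj_v] := cs v (setU11 _ _); split=> //.
    apply/cliqueP=> u us; have [Su adj_u] := cs u (setU1r _ us); split=> // w ws.
    by apply: adj_u; apply: setU1r.
  apply/forall_inP=> u us; apply/implyP; rewrite eq_sym => /adj_v; apply.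
  exact: setU1r.
rewrite in_setU1 => /predU1P[->|us]; split=> //.
- move=> w; rewrite in_setU1 => /predU1P[->|/adj_v/implyP]; rewrite ?eqxx //.
  by rewrite eq_sym.
- by have [] := cs u us.
move=> w; rewrite in_setU1 => /predU1P[->|ws].
  by rewrite adj_sym; apply/implyP/adj_v.
by have [_ ] := cs u us; apply.
Qed.

Lemma clique_adj (S : pred V) v s u : clique S (v |: s) -> u \in s -> u != v -> adj v u.
Proof. by rewrite cliqueU => /and3P[_ _ /forall_inP h] /h/implyP. Qed.

(** A vertex of largest measure m among those outside S is dominated by its
    partner p v, that is, its link is a cone with apex p v; removing it and
    repeating the argument leaves S. *)
Lemma dismantle (S : {set V}) (p : V -> V) (m : V -> nat) :
  (forall v, v \notin S -> [/\ p v \in S, adj (p v) v &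
     forall u, adj u v -> (u \in S) || (m u <= m v)%N -> u != p v -> adj u (p v)]) ->
  retr r (clique predT) (clique (mem S)).
Proof.
move=> pP; suff retrT n (T : {set V}) : #|T| = (n + #|S|)%N -> S \subset T ->
    retr r (clique (mem T)) (clique (mem S)).
  have := retrT (#|V| - #|S|)%N setT; rewrite cardsT subnK ?max_card // => /(_ erefl (subsetT _)).
  have -> // : clique (mem [set: V]) = clique predT.
  apply/funext=> s; apply/idP/idP; apply: clique_sub => v // _.
  exact: in_setT.
elim: n T => [|n IHn] T nT ST.
  have -> : T = S by apply/eqP; rewrite eq_sym eqEcard ST nT /=.
  exact: retr_refl.
have [v0 /setDP[vT vS]] : exists v, v \in T :\: S.
  by apply/set0Pn; rewrite -card_gt0 cardsDS // nT addSn subSn ?leq_addl // addnK.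
have v0D : v0 \in T :\: S by apply/setDP.
case: (arg_maxnP m v0D) => v /setDP[{}vT {}vS] v_max.
have [pS pv pdom] := pP v vS.
have vp : v != p v by apply: contraNneq vS => ->.
apply: (@retr_trans _ _ _ _ (clique (mem (T :\ v)))).
- exact: r_inj.
- by move=> s; apply: clique_sub => u /=; rewrite inE => /andP[].
- by move=> s; apply: clique_sub => u /= uS; rewrite !inE (subsetP ST) // andbT; apply: contraNneq vS => <-.
- have -> : clique (mem (T :\ v)) = avoid (clique (mem T)) [set v].
    by apply/funext=> s; rewrite avoid_clique; apply/idP/idP; apply: clique_sub => u /=; rewrite !inE andbC.
  apply: (retr_vertex r_inj _ vp); [exact: down_clique|move=> s /andP[vs cvs]].
  apply/andP; split; first by rewrite !inE negb_or vp.
  rewrite setUCA cliqueU; apply/and3P; split=> //; first exact: (subsetP ST).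
  apply/forall_inP=> u; rewrite in_setU1 => /predU1P[->|us]; first by rewrite pv implybT.
  apply/implyP=> up; rewrite adj_sym; apply: pdom => //.
    by rewrite adj_sym; apply: clique_adj cvs _ _ => //; apply: contraNneq vs => <-.
  have [uS //|uS /=] := boolP (u \in S); apply: v_max; apply/setDP; split=> //.
  by have [] := cliqueP _ _ cvs u (setU1r _ us).
apply: IHn; first by move: nT; rewrite (cardsD1 v) vT => -[].
by apply/subsetP=> u uS; rewrite !inE (subsetP ST) // andbT; apply: contraNneq vS => <-.
Qed.

End Cliques.

(** For a missing edge a b the apex q a b is joined, already in adj0, to both ends
    and to their common neighbours. So the link of the edge is a cone with that
    apex, whatever other missing edges have been removed before. *)
Lemma remove_edges (adj adj0 : rel V) (q : V -> V -> V) :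
  symmetric adj -> symmetric adj0 -> irreflexive adj -> subrel adj0 adj ->
  (forall a b, adj a b -> ~~ adj0 a b -> [/\ adj0 (q a b) a, adj0 (q a b) b &
     forall u, adj u a -> adj u b -> u != q a b -> adj0 u (q a b)]) ->
  retr r (clique adj predT) (clique adj0 predT).
Proof.
move=> sym sym0 irr sub qP.
have [n] := ubnP #|[set e : V * V | adj e.1 e.2 && ~~ adj0 e.1 e.2]|.
elim: n adj sym irr sub qP => // n IHn adj sym irr sub qP; rewrite ltnS => le_n.
have [E0|] := eqVneq [set e : V * V | adj e.1 e.2 && ~~ adj0 e.1 e.2] set0.
  have -> : clique adj predT = clique adj0 predT; last exact: retr_refl.
  apply/funext=> s; apply/cliqueP/cliqueP => cs u us; split=> // v vs uv;
      have [_ /(_ v vs uv)] := cs u us; last exact: sub.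
  move=> auv; apply/negPn/negP=> auv0.
  by have /setP/(_ (u, v)) := E0; rewrite !inE auv auv0.
case/set0Pn=> -[a b]; rewrite inE /= => /andP[aab aab0].
pose adj1 u v := adj u v && ~~ ((u == a) && (v == b) || (u == b) && (v == a)).
have sym1 : symmetric adj1 by move=> u v; rewrite /adj1 sym orbC ![(v == _) && _]andbC.
have ab : a != b by apply: contraTneq aab => ->; rewrite irr.
have [qa qb qdom] := qP a b aab aab0.
have adj01 : subrel adj0 adj1.
  move=> u v uv; rewrite /adj1 sub //=; apply/negP=> /orP[]/andP[/eqP uE /eqP vE].
    by case/negP: aab0; rewrite -uE -vE.
  by case/negP: aab0; rewrite sym0 -uE -vE.
have adj1_sub u v : adj1 u v -> adj u v by case/andP.
apply: (@retr_trans _ _ _ _ (clique adj1 predT)).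
- exact: r_inj.
- move=> s /cliqueP cs; apply/cliqueP=> u us; split=> // v vs uv; apply: adj1_sub.
  by have [_] := cs u us; apply.
- move=> s /cliqueP cs; apply/cliqueP=> u us; split=> // v vs uv; apply: adj01.
  by have [_] := cs u us; apply.
- have -> : clique adj1 predT = fun s => clique adj predT s && ~~ ((a \in s) && (b \in s)).
    apply/funext=> s; apply/cliqueP/andP => [cs|[/cliqueP cs nab] u us].
      split; last by apply/andP=> -[as_ bs]; have [_ /(_ b bs ab)] := cs a as_; rewrite /adj1 !eqxx andbF.
      by apply/cliqueP=> u us; split=> // v vs uv; apply: adj1_sub; have [_] := cs u us; apply.
    split=> // v vs uv; have [_ /(_ v vs uv) auv] := cs u us; rewrite /adj1 auv /=.
    by apply: contra nab => /orP[]/andP[/eqP<- /eqP<-]; rewrite us vs.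
  apply: (retr_edge r_inj (q := q a b)) => //; first exact: down_clique.
  + by apply: contraTneq (sub _ _ qa) => ->; rewrite irr.
  + by apply: contraTneq (sub _ _ qb) => ->; rewrite irr.
  move=> s as_ bs cs; rewrite (_ : a |: (b |: (q a b |: s)) = q a b |: (a |: (b |: s))); last first.
    by rewrite ![_ |: (q a b |: _)]setUCA.
  rewrite cliqueU //= cs /=; apply/forall_inP=> u; rewrite !in_setU1.
  case/or3P=> [/eqP->|/eqP->|us]; rewrite ?(sub _ _ qa) ?(sub _ _ qb) ?implybT //.
  apply/implyP=> uq; apply: sub; rewrite sym0; apply: qdom => //.
    rewrite sym; apply: (clique_adj sym cs); first by rewrite !inE us orbT.
    by apply: contraNneq as_ => <-.
  rewrite sym; move: cs; rewrite cliqueU // => /and3P[_ cs _]; apply: (clique_adj sym cs us).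
  by apply: contraNneq bs => <-.
apply: IHn => //.
- by move=> u; rewrite /adj1 irr.
- move=> u v /adj1_sub auv auv0; have [? ? dom] := qP u v auv auv0; split=> // w /adj1_sub wu /adj1_sub wv.
  exact: dom.
apply: leq_trans le_n; apply: proper_card; apply/properP; split.
  by apply/subsetP=> -[u v]; rewrite !inE /= => /andP[/adj1_sub-> ->].
by exists (a, b); rewrite !inE /= ?aab //= /adj1 !eqxx /= andbF.
Qed.

End General.

(** * Comparison of subcomplexes with the same homology *)

(** Here K contains L and M, and both have the homology of K. Cycles of L are
    moved to M through K, and what bounds in K bounds in L and in M. *)
Section Comparison.
Variables (V : finType) (r : V -> nat).
Hypothesis r_inj : injective r.
Variables (K L M : pred {set V}).
Hypotheses (LK : forall s, L s -> K s) (MK : forall s, M s -> K s).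
Hypotheses (KL : retr r K L) (KM : retr r K M).
Local Notation ch := (ch V).
Local Notation del := (del r).

Lemma retr_bounds z : on L z -> bounds r K z -> bounds r L z.
Proof.
move=> Lz [w Kw dw]; have [|w' Kw' Lw'] := KL Kw; first by rewrite dw.
by exists (w + del w') => //; rewrite raddfD /= (del_del r_inj) addr0.
Qed.

Lemma retr_cyc n z : cyc r L n z -> exists2 z', cyc r M n z' & bounds r K (z - z').
Proof.
move=> [Lz hz dz]; have [|w Kw Mw] := KM (on_sub LK Lz); first by rewrite dz; apply: on0.
have E : z + del (part n.+1 w) = part n (z + del w).
  by rewrite raddfD /= [part _ z]part_id // part_del.
exists (z + del (part n.+1 w)).
  split; [by rewrite E; apply: on_part | by rewrite E; apply: hom_part|].
  by rewrite raddfD /= dz (del_del r_inj) addr0.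
rewrite opprD addrA subrr add0r; apply: boundsN.
by exists (part n.+1 w) => //; apply: on_part.
Qed.

Lemma retr_trivial n : (forall z, cyc r M n z -> bounds r M z) -> forall z, cyc r L n z -> bounds r L z.
Proof.
move=> bM z cz; have [z' /bM bz' bzz'] := retr_cyc cz; apply: retr_bounds; first by case: cz.
by rewrite -(subrK z' z); apply: boundsD => //; apply: bounds_sub bz'.
Qed.

Lemma retr_dep n k : dep_le r M (cyc r M n) k -> dep_le r L (cyc r L n) k.
Proof.
move=> dep x Lx.
have depK : dep_le r K (cyc r L n) k.
  apply: (dep_le_homologous (Z' := cyc r M n)) => [z /retr_cyc //|y My].
  by have [c c0 bc] := dep y My; exists c => //; apply: bounds_sub bc.
have [c c0 bc] := depK x Lx.
exists c => //; apply: retr_bounds bc.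
have on_sum : forall e : seq 'I_k.+1, on L (\sum_(i <- e) x i *~ c i).
  elim=> [|i e IHe]; first by rewrite big_nil; apply: on0.
  by rewrite big_cons; apply: onD => //; apply: onMz; case: (Lx i).
exact: on_sum.
Qed.

Hypothesis dim : forall s, M s -> (#|s| < 5)%N.

(** There are no simplices of the next dimension. *)
Lemma top_bounds z : hom 4%N z -> bounds r M z -> z = 0.
Proof.
move=> hz /(bounds_hom hz)[w [Mw hw <-]]; rewrite [w](_ : _ = 0) ?raddf0 //.
apply/ffunP=> s; rewrite ffunE; apply/eqP/negPn/negP=> ws.
by have := dim (Mw _ ws); rewrite (eqP (hw _ ws)).
Qed.

Lemma cyc_high n z : (4 < n)%N -> cyc r M n z -> bounds r M z.
Proof.
move=> n4 [Mz hz _]; rewrite [z](_ : _ = 0); first exact: bounds0.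
apply/ffunP=> s; rewrite ffunE; apply/eqP/negPn/negP=> zs.
by have := dim (Mz _ zs); rewrite (eqP (hz _ zs)); lia.
Qed.

End Comparison.

Section Top.
Variables (V : finType) (r : V -> nat).
Hypothesis r_inj : injective r.
Variables (K L M : pred {set V}).
Hypotheses (LK : forall s, L s -> K s) (MK : forall s, M s -> K s).
Hypotheses (KL : retr r K L) (KM : retr r K M).
Hypothesis dim : forall s, M s -> (#|s| < 5)%N.

(** A multiple of the cycle of M homologous to z bounds in M, so it is zero, and
    integral chains have no torsion. *)
Lemma top_torsion_free z (c : int) : c != 0 -> cyc r L 4%N z -> bounds r L (z *~ c) -> bounds r L z.
Proof.
move=> c0 cz bz; have [z' [Mz' hz' dz'] bzz'] := retr_cyc r_inj LK KM cz.
have z0 : z' *~ c = 0.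
  apply: (top_bounds dim); first exact: onMz.
  apply: (retr_bounds r_inj KM); first exact: onMz.
  rewrite (_ : z' *~ c = z *~ c - (z - z') *~ c); last by rewrite mulrzBl opprB addrC subrK.
  by apply: boundsB; [apply: bounds_sub bz | apply: boundsMz].
have z'0 : z' = 0.
  apply/ffunP=> s; have := congr1 (fun x : ch V => x s) z0; rewrite ffunMzE !ffunE => /eqP.
  by rewrite mulrzz mulf_eq0 (negPf c0) orbF => /eqP.
apply: (retr_bounds r_inj KL); first by case: cz.
by rewrite z'0 subr0 in bzz'.
Qed.

Lemma top_nonzero : (exists2 z, cyc r M 4%N z & z != 0) ->
  exists2 z, cyc r L 4%N z & forall c : int, bounds r L (z *~ c) -> c = 0.
Proof.
move=> [z' cz' z'0]; have [z cz bzz'] := retr_cyc r_inj MK KL cz'; exists z => // c bz.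
have [Mz' hz' _] := cz'.
have z0 : z' *~ c = 0.
  apply: (top_bounds dim); first exact: onMz.
  apply: (retr_bounds r_inj KM); first exact: onMz.
  rewrite (_ : z' *~ c = (z' - z) *~ c + z *~ c); last by rewrite mulrzBl subrK.
  by apply: boundsD; [apply: boundsMz | apply: bounds_sub bz].
apply/eqP; apply: contraNT z'0 => c0; apply/eqP/ffunP=> s.
have := congr1 (fun x : ch V => x s) z0; rewrite ffunMzE !ffunE => /eqP.
by rewrite mulrzz mulf_eq0 (negPf c0) orbF => /eqP.
Qed.
End Top.

(** * Homology of an order complex *)

Section OrderComplexHomology.
Variables (d : Order.disp_t) (P : finPOrderType d).
Local Notation r := (@linext d P).
Local Notation K := (@ischain d P).
Local Notation bounds := (bounds r K).
Local Notation cyc := (cyc r K).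
Local Notation del := (del r).

Lemma cyc_emb m (x : chain P m.+1) : bdry x = 0 -> cyc m.+1 (emb x).
Proof. by move=> dx; split; [apply: on_emb | apply: hom_emb | apply: bdry_eq0]. Qed.

Lemma rhomology_trivial m : (forall z, cyc m.+1 z -> bounds z) -> trivial_zmod (rhomology P m).
Proof.
by move=> bz; apply: homology_trivial => x /cyc_emb/bz/(bounds_emb x).
Qed.

Lemma rhomology_torsion_free m :
  (forall z c, c != 0 -> cyc m.+1 z -> bounds (z *~ c) -> bounds z) -> torsion_free (rhomology P m).
Proof.
move=> bz; apply: homology_torsion_free => x n n0 dx /(bounds_emb (x *+ n)).
by rewrite raddfMn => b; apply/(bounds_emb x)/(bz _ n%:Z) => //; [lia | apply: cyc_emb].
Qed.

Lemma rhomology_rank m k : dep_le r K (cyc m.+1) k -> (tfrank (rhomology P m) <= k)%N.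
Proof.
move=> dep; apply: tfrank_le => x dx; have [|c c0 bc] := dep (fun i => emb (x i)).
  by move=> i; apply: cyc_emb; apply: dx.
exists c => //; apply/bounds_emb; rewrite raddf_sum.
by under eq_bigr => i _ do rewrite raddfMz.
Qed.

Lemma rhomology_gt0 m z : cyc m.+1 z -> (forall c : int, bounds (z *~ c) -> c = 0) ->
  (0 < tfrank (rhomology P m))%N.
Proof.
move=> [Kz hz dz] z_free; have [x xz] := emb_surj Kz hz.
apply: (@tfrank_gt0 _ _ _ _ _ x).
  by apply: (@emb_inj _ P m); rewrite -emb_bdry xz dz raddf0.
move=> c w fw; apply: z_free; rewrite -xz -raddfMz; apply/bounds_emb.
by exists w.
Qed.

(** Chains of degree 0 have an augmentation. By hypothesis its kernel consists of
    boundaries, so that two chains are dependent modulo boundaries, and a single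
    point has augmentation 1. *)
Lemma ohomology0_rank (v0 : P) : trivial_zmod (rhomology P 0) -> tfrank (ohomology P 0) = 1%N.
Proof.
move=> triv; pose eps (x : chain P 1) := del (emb x) set0.
have eps_comb x y a b : eps (x *~ a + y *~ b) = eps x * a + eps y * b.
  by rewrite /eps !raddfD /= !raddfMz /= chDE !ffunMzE !mulrzz.
have eps0 x : eps x = 0 -> exists w : chain P 2, bdry w = x.
  move=> ex; have dx : bdry x = 0.
    apply: (@emb_inj _ P 0); rewrite -emb_bdry raddf0; apply/ffunP=> s; rewrite [RHS]ffunE.
    have [->//|s0] := eqVneq s set0; apply: (on_out (K := fun s => #|s| == 0)); last by rewrite cards_eq0.
    by apply: hom_del; apply: hom_emb.
  by apply/(cls_eq0 _ (cycle_of dx)).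
have [x0 x0E] : exists x0 : chain P 1, emb x0 = wdg r v0 (one P).
  apply: emb_surj => s; rewrite wdg1E; have [->|_] := eqVneq s [set v0]; rewrite ?eqxx // => _.
    by apply/ischainP=> u v /set1P-> /set1P->; apply: comparablexx.
  by rewrite cards1.
have ex0 : eps x0 = 1 by rewrite /eps x0E (del_wdg1 (@linext_inj _ P)) oneE eqxx.
apply/eqP; rewrite eqn_leq; apply/andP; split.
  apply: tfrank_le => x _; pose y := x (lift ord0 ord0).
  pose c (i : 'I_2) := if eps (x ord0) == 0 then (i == ord0)%:R else if i == ord0 then eps y else - eps (x ord0).
  exists c.
    have [e0|e0] := eqVneq (eps (x ord0)) 0; first by exists ord0; rewrite /c e0 eqxx.
    by exists (lift ord0 ord0); rewrite /c (negPf e0) /= oppr_eq0.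
  apply: eps0; rewrite !big_ord_recl big_ord0 addr0 eps_comb -/y /c.
  by case: eqP => [->|_] /=; [rewrite mul0r mulr0 addr0 | rewrite mulrN mulrC subrr].
apply: (@tfrank_gt0 _ _ _ _ _ x0) => // c w fw.
have : del (del (emb w)) set0 = 0 by rewrite (del_del (@linext_inj _ P)) ffunE.
by rewrite emb_bdry fw raddfMz raddfMz ffunMzE -/(eps x0) ex0 mulrzz mul1r.
Qed.

Lemma euler_char_rank : P -> (4 <= #|P|)%N -> trivial_zmod (rhomology P 0) -> trivial_zmod (rhomology P 1) ->
  (forall m, (3 < m)%N -> trivial_zmod (rhomology P m)) ->
  euler_char P = 1 + (tfrank (rhomology P 2))%:Z - (tfrank (rhomology P 3))%:Z.
Proof.
move=> v0 P4 t0 t1 t4; rewrite /euler_char.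
pose F m : int := (-1) ^+ m * (tfrank (ohomology P m))%:Z.
rewrite -(big_mkord xpredT F) (big_cat_nat (n := 4)) //= [X in _ + X]big_nat_cond [X in _ + X]big1 ?addr0.
  rewrite !big_nat_recr // big_geq //= /F (ohomology0_rank v0 t0) /=.
  by rewrite (tfrank_trivial t1); ring.
move=> m /andP[/andP[m4 _] _]; rewrite /F; case: m m4 => // m m4.
by rewrite (tfrank_trivial (t4 m.+1 m4)) mulr0.
Qed.

End OrderComplexHomology.

(** * The complex of six kinds of vertices *)

(** The vertices are coloured by kd: 0 for the elements g, 1 and 2 for the cosets
    t and u with two and three elements, 3 and 4 for the cosets a and b of the
    stabilisers of points and lines of the Fano plane, 5 for the cosets c of the
    stabilisers of points of the projective line, and 6 for all others. In names,
    the letters G, T, U, A, B, C stand for the kinds 0 to 5. *)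
Section Flags.
Variables (V : finType) (r : V -> nat).
Hypothesis r_inj : injective r.
Variables (adj : rel V) (kd : V -> nat).
Hypothesis adj_sym : symmetric adj.
Hypothesis adj_irr : irreflexive adj.
Implicit Types (u v a b c g h t : V) (s : {set V}) (x y z w : ch V) (ks : seq nat).

(** The pairs of kinds, in increasing order, between which there are edges. *)
Definition okpair (i j : nat) :=
  ((i, j) \in [:: (0, 1); (0, 2); (0, 3); (0, 4); (0, 5); (1, 3); (1, 4);
                  (2, 3); (2, 4); (2, 5); (3, 4)])%N.
Hypothesis adj_ok : forall u v, adj u v -> (kd u < 6)%N -> (kd v < 6)%N ->
  okpair (kd u) (kd v) || okpair (kd v) (kd u).

Definition nb v (i : nat) := [set u | adj v u & kd u == i].
Definition enb v i := enum (nb v i).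

Lemma in_enb v i u : (u \in enb v i) = adj v u && (kd u == i).
Proof. by rewrite mem_enum inE. Qed.

Definition K ks := clique adj (fun v => kd v \in ks).
Definition all_ks : seq nat := [:: 0; 1; 2; 3; 4; 5]%N.

Lemma down_K ks : down (K ks).
Proof. exact: down_clique. Qed.

Lemma K_sub ks ks' s : {subset ks <= ks'} -> K ks s -> K ks' s.
Proof. by move=> sub; apply: clique_sub => v; apply: sub. Qed.

Lemma K_kd ks s v : K ks s -> v \in s -> kd v \in ks.
Proof. by move=> /cliqueP cs /cs[]. Qed.

Lemma K_adj ks s u v : K ks s -> u \in s -> v \in s -> u != v -> adj u v.
Proof. by move=> /cliqueP cs /cs[_]; apply. Qed.

Definition nk (i : nat) s : nat := #|[set v in s | kd v == i]|.

Lemma nk_gt0 i s : (0 < nk i s)%N -> exists2 v, v \in s & kd v = i.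
Proof. by move=> /card_gt0P[v]; rewrite inE => /andP[vs /eqP]; exists v. Qed.

Lemma nk_notin ks s (i : nat) : K ks s -> i \notin ks -> nk i s = 0%N.
Proof.
move=> Ks; apply: contraNeq; rewrite -lt0n => /nk_gt0[v vs <-].
exact: K_kd Ks vs.
Qed.

Lemma kinds_le1 s (I : seq nat) : K all_ks s ->
  all (fun i => all (fun j => ~~ okpair i j) I) I ->
  (#|[set v in s | kd v \in I]| <= 1)%N.
Proof.
move=> Ks bad; apply/card_le1_eqP => u v; rewrite !inE => /andP[us ui] /andP[vs vi].
apply/eqP; rewrite eq_sym; apply: contraT => uv.
have lt t : t \in s -> (kd t < 6)%N by move=> /(K_kd Ks); rewrite !inE; lia.
have := adj_ok (K_adj Ks us vs uv) (lt u us) (lt v vs).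
by case/orP; apply/contraLR => _; [apply: (allP (allP bad _ ui)) | apply: (allP (allP bad _ vi))].
Qed.

Lemma nkD s (i j : nat) : i != j -> (nk i s + nk j s)%N = #|[set v in s | kd v \in [:: i; j]]|.
Proof.
move=> ij; rewrite /nk -cardsUI.
have -> : [set v in s | kd v == i] :&: [set v in s | kd v == j] = set0.
  apply/setP=> v; rewrite !inE; have [->|] := eqVneq (kd v) i; rewrite ?andbF //.
  by rewrite (negPf ij) !andbF.
by rewrite cards0 addn0; apply: eq_card => v; rewrite !inE andb_orr.
Qed.

Lemma nk_facts s : K all_ks s ->
  [/\ (nk 0 s <= 1)%N, (nk 3 s + nk 5 s <= 1)%N, (nk 4 s + nk 5 s <= 1)%N,
      (nk 1 s + nk 2 s <= 1)%N & (nk 1 s + nk 5 s <= 1)%N] /\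
  #|s| = (nk 0 s + nk 1 s + nk 2 s + nk 3 s + nk 4 s + nk 5 s)%N.
Proof.
move=> Ks; split.
  split; rewrite ?nkD //; try exact: kinds_le1.
  apply: leq_trans (@kinds_le1 s [:: 0%N] Ks _) => //.
  by apply: subset_leq_card; apply/subsetP=> v; rewrite !inE.
transitivity (\sum_(i < 6) nk i s)%N; last by rewrite !big_ord_recr big_ord0 /= add0n.
have nkE i : nk i s = (\sum_(v in s) (kd v == i))%N.
  rewrite /nk -sum1_card big_mkcond [RHS]big_mkcond; apply: eq_bigr => v _.
  by rewrite inE; case: (v \in s) => //=; case: (kd v == i).
under eq_bigr => i _ do rewrite nkE.
rewrite exchange_big -sum1_card; apply: eq_bigr => v vs /=.
have lt : (kd v < 6)%N by have := K_kd Ks vs; rewrite !inE; lia.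
rewrite (bigD1 (Ordinal lt)) //= eqxx big1 // => i iv.
by case: eqP => // vi; case/eqP: iv; apply: val_inj.
Qed.

Definition subkinds ks := all (mem all_ks) ks.

Lemma subkinds_lt ks (i : nat) : subkinds ks -> i \in ks -> (i < 6)%N.
Proof. by move=> /allP sub /sub; rewrite -[mem _ _]/(i \in all_ks) !inE; lia. Qed.

Lemma K_all ks s : subkinds ks -> K ks s -> K all_ks s.
Proof. by move/allP=> sub; apply: K_sub. Qed.

Lemma subset_card_eq (s t : {set V}) n : t \subset s -> #|s| = n -> #|t| = n -> s = t.
Proof. by move=> ts sn tn; apply/eqP; rewrite eq_sym eqEcard ts sn tn /=. Qed.

Lemma neq_kd u v (i j : nat) : kd u = i -> kd v = j -> i != j -> u != v.
Proof. by move=> <- <-; apply: contraNneq => ->. Qed.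

Lemma no_simplex5 s : K all_ks s -> (#|s| < 5)%N.
Proof. move=> Ks; have [[n0 n35 n45 n12 n15] ->] := nk_facts Ks; lia. Qed.

Lemma simplex_gab s : K [:: 0; 3; 4; 5]%N s -> #|s| = 3 ->
  exists g a b, [/\ s = a |: (b |: [set g]), kd g = 0%N, kd a = 3%N & kd b = 4%N].
Proof.
move=> Ks; have Ka := K_all (erefl : subkinds [:: 0; 3; 4; 5]%N) Ks.
have [[n0 n35 n45 n12 n15] sE] := nk_facts Ka => s3.
have n1 := nk_notin Ks (erefl : 1%N \notin [:: 0; 3; 4; 5]%N).
have n2 := nk_notin Ks (erefl : 2%N \notin [:: 0; 3; 4; 5]%N).
have [|g gs g0] := @nk_gt0 0 s; first by lia.
have [|a as_ a3] := @nk_gt0 3 s; first by lia.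
have [|b bs b4] := @nk_gt0 4 s; first by lia.
exists g, a, b; split=> //; apply: subset_card_eq s3 _.
  by apply/subsetP=> v; rewrite !inE => /or3P[]/eqP->.
by rewrite !cardsU1 cards1 !inE (negPf (neq_kd a3 g0 isT)) (negPf (neq_kd b4 g0 isT)) (negPf (neq_kd a3 b4 isT)).
Qed.

Lemma simplex4 s : K all_ks s -> #|s| = 4 ->
  exists g t a b, [/\ s = g |: (t |: (a |: [set b])), kd g = 0%N, (kd t == 1%N) || (kd t == 2%N),
    kd a = 3%N & kd b = 4%N].
Proof.
move=> Ks; have [[n0 n35 n45 n12 n15] sE] := nk_facts Ks => s4.
have [|g gs g0] := @nk_gt0 0 s; first by lia.
have [|a as_ a3] := @nk_gt0 3 s; first by lia.
have [|b bs b4] := @nk_gt0 4 s; first by lia.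
have [t ts t12] : exists2 t, t \in s & (kd t == 1%N) || (kd t == 2%N).
  have [/nk_gt0[t ts t1]|n1] := ltnP 0 (nk 1 s); first by exists t; rewrite ?t1.
  by have [|t ts t2] := @nk_gt0 2 s; [lia | exists t; rewrite ?t2].
exists g, t, a, b; split=> //; apply: subset_card_eq s4 _.
  by apply/subsetP=> v; rewrite !inE => /or4P[]/eqP->.
rewrite !cardsU1 cards1 !inE (negPf (neq_kd g0 a3 isT)) (negPf (neq_kd g0 b4 isT)) (negPf (neq_kd a3 b4 isT)) //.
have nt v (i : nat) : kd v = i -> i \notin [:: 1; 2]%N -> (t == v) = false.
  move=> <-; have [<-|//] := eqVneq t v.
  by rewrite !inE t12.
by rewrite (nt a 3%N) // (nt b 4%N) // eq_sym (nt g 0%N).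
Qed.

Definition okk i j := okpair i j || okpair j i.

Lemma coface_adj ks z s u v : on (K ks) z -> u \notin s -> z (u |: s) != 0 -> v \in s -> adj v u.
Proof.
move=> Kz us /Kz Ks vs; rewrite adj_sym; apply: (clique_adj adj_sym Ks) => //.
by apply: contraNneq us => <-.
Qed.

Lemma coface_kd ks z s u (vs : seq V) (j : nat) :
  on (K ks) z -> subkinds ks -> u \notin s -> z (u |: s) != 0 -> {subset vs <= s} ->
  all (fun k => all (fun v => okk (kd v) k) vs ==> (k == j)) ks -> kd u = j.
Proof.
move=> Kz sub us zu vss; have Ks := Kz _ zu.
have uks : kd u \in ks := K_kd Ks (setU11 _ _).
move/allP/(_ _ uks)/implyP => forced; apply/eqP/forced/allP=> v vvs.
have vs_ := vss v vvs; have lt t : kd t \in ks -> (kd t < 6)%N.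
  exact: subkinds_lt.
apply: adj_ok; first exact: coface_adj Kz us zu vs_.
  by apply: lt; apply: (K_kd Ks); apply: setU1r.
exact: lt.
Qed.

Lemma coface_enb ks z s u v (vs : seq V) (j : nat) :
  on (K ks) z -> subkinds ks -> v \in s -> {subset vs <= s} ->
  all (fun k => all (fun v => okk (kd v) k) vs ==> (k == j)) ks ->
  u \notin s -> z (u |: s) != 0 -> u \in enb v j.
Proof.
move=> Kz sub vs_ vss forced us zu; rewrite in_enb (coface_adj Kz us zu vs_) /=.
by rewrite (coface_kd Kz sub us zu vss forced).
Qed.

Lemma set3_perm u v t : u |: (v |: [set t]) = t |: (v |: [set u]).
Proof. by rewrite setUCA (setUC [set u]) setUCA. Qed.

(** The faces g a and g b have only cofaces of the form g a b, since no c is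
    joined to an a or b. First the values with any b, then those with any a,
    follow from last_coface. *)
Lemma gab_zero z : cyc r (K [:: 0; 3; 4; 5]%N) 3 z ->
  (forall g a b, kd g = 0%N -> a \in behead (enb g 3) -> b \in behead (enb g 4) ->
     z (a |: (b |: [set g])) = 0) -> z = 0.
Proof.
move=> [Kz hz dz] z0; have sub : subkinds [:: 0; 3; 4; 5]%N by [].
have step1 g a b : kd g = 0%N -> a \in behead (enb g 3) -> b \notin a |: [set g] ->
    z (b |: (a |: [set g])) = 0.
  move=> g0 aB; have : a \in enb g 3 by apply: mem_behead.
  rewrite in_enb => /andP[_ /eqP a3].
  apply: (@last_coface _ r _ _ (enb g 4) dz) => [u|u _ uB].
    apply: (@coface_enb _ _ _ _ _ [:: a; g] _ Kz sub); rewrite ?inE ?eqxx ?orbT //.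
      by move=> v; rewrite !inE.
    by rewrite /= g0 a3.
  by rewrite setUCA; apply: z0.
have step2 g a b : kd g = 0%N -> b \in enb g 4 -> a \notin b |: [set g] ->
    z (a |: (b |: [set g])) = 0.
  move=> g0; rewrite in_enb => /andP[gb /eqP b4].
  apply: (@last_coface _ r _ _ (enb g 3) dz) => [u|u ug uB].
    apply: (@coface_enb _ _ _ _ _ [:: b; g] _ Kz sub); rewrite ?inE ?eqxx ?orbT //.
      by move=> v; rewrite !inE.
    by rewrite /= g0 b4.
  rewrite setUCA; apply: step1 => //; rewrite !inE negb_or.
  rewrite !inE negb_or in ug; case/andP: ug => ub _; rewrite eq_sym ub.
  by apply: (neq_kd b4 g0).
apply/ffunP=> s; rewrite ffunE; apply/eqP/negPn/negP=> zs.
have [g [a [b [sE g0 a3 b4]]]] := simplex_gab (Kz _ zs) (eqP (hz _ zs)).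
move: zs (Kz _ zs); rewrite {}sE => zs Ks; case/negP: zs; apply/eqP/step2 => //.
  have gb : g != b by apply: neq_kd g0 b4 _.
  by rewrite in_enb b4 eqxx andbT (K_adj Ks) // !inE eqxx ?orbT.
by rewrite !inE negb_or (neq_kd a3 b4) // (neq_kd a3 g0).
Qed.

(** The same elimination in one more degree: first b is freed on the face g t a,
    then g on t a b. The faces g u a have a single coface, so that z vanishes
    at every simplex containing some u. *)
Lemma zero4 z : cyc r (K all_ks) 4 z ->
  (forall u, kd u = 2%N -> #|nb u 4| = 1%N) ->
  (forall t g a b, kd t = 1%N -> g \in behead (enb t 0) -> a \in enb t 3 ->
     b \in behead (enb t 4) -> z (b |: (a |: (g |: [set t]))) = 0) -> z = 0.
Proof.
move=> [Kz hz dz] nb24 z0; have sub : subkinds all_ks by [].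
have stepb t g a : (kd t == 1%N) || (kd t == 2%N) -> kd g = 0%N -> kd a = 3%N ->
    (forall b, b \in behead (enb t 4) -> z (b |: (a |: (g |: [set t]))) = 0) ->
    forall b, b \notin a |: (g |: [set t]) -> z (b |: (a |: (g |: [set t]))) = 0.
  move=> t12 g0 a3 z0'; apply: (@last_coface _ r _ _ (enb t 4) dz) => [u|u _ /z0'//].
  apply: (@coface_enb _ _ _ _ _ [:: a; g; t] _ Kz sub); rewrite ?inE ?eqxx ?orbT //.
    by move=> v; rewrite !inE.
  by rewrite /= g0 a3; case/orP: t12 => /eqP->.
have step1 t g a b : kd t = 1%N -> kd a = 3%N -> kd b = 4%N -> a \in enb t 3 ->
    g \notin b |: (a |: [set t]) -> z (g |: (b |: (a |: [set t]))) = 0.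
  move=> t1 a3 b4 aE; apply: (@last_coface _ r _ _ (enb t 0) dz) => [u|u un uB].
    apply: (@coface_enb _ _ _ _ _ [:: b; a; t] _ Kz sub); rewrite ?inE ?eqxx ?orbT //.
      by move=> v; rewrite !inE.
    by rewrite /= t1 a3 b4.
  have := mem_behead uB; rewrite in_enb => /andP[_ /eqP u0].
  rewrite setUCA [u |: (a |: _)]setUCA; apply: stepb => //; first by rewrite t1.
    by move=> b' b'B; apply: z0.
  by rewrite !inE !negb_or (neq_kd b4 a3) // (neq_kd b4 u0) // (neq_kd b4 t1).
apply/ffunP=> s; rewrite ffunE; apply/eqP/negPn/negP=> zs.
have [g [t [a [b [sE g0 t12 a3 b4]]]]] := simplex4 (Kz _ zs) (eqP (hz _ zs)).
move: zs (Kz _ zs).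
have {}sE : s = g |: (b |: (a |: [set t])).
  by rewrite sE; congr (_ |: _); rewrite set3_perm.
rewrite {}sE => zs Ks; case/negP: zs; apply/eqP.
have kt v i : kd v = i -> i \notin [:: 1; 2]%N -> v != t.
  by move=> <-; rewrite !inE; apply: contraNneq => ->.
have tv v : v != t -> (t == v) = false by rewrite eq_sym => /negPf.
have [t1|t2] := eqVneq (kd t) 1%N.
  apply: step1 => //.
    rewrite in_enb a3 eqxx andbT (K_adj Ks) ?inE ?eqxx ?orbT //.
    by rewrite tv // (kt a 3%N).
  by rewrite !inE !negb_or (neq_kd g0 b4) // (neq_kd g0 a3) // (kt g 0%N).
have {}t2 : kd t = 2%N by move: t12; rewrite (negPf t2) => /eqP.
rewrite setUCA [g |: (a |: _)]setUCA; apply: stepb => //.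
- move=> b' b'B; have := size_behead (enb t 4); rewrite -cardE nb24 //=.
  by case: (behead _) b'B.
- by rewrite !inE !negb_or (neq_kd b4 a3) // (neq_kd b4 g0) // (kt b 4%N).
Qed.

Local Notation bounds := (bounds r).

(** Two vertices of the same kind are not adjacent, so that push applies to all of them. *)
Lemma push_kind ks (i : nat) n z : subkinds ks -> cyc r (K ks) n.+1 z ->
  (forall v, kd v = i -> cyc r (lk (K ks) v) n (rho r v z) -> bounds (lk (K ks) v) (rho r v z)) ->
  exists2 w, on (K ks) w & cyc r (K (filter (predC1 i) ks)) n.+1 (z + del r w).
Proof.
move=> sub cz bz.
have [||w Kw cw] := @push_cyc _ _ r_inj (K ks) [set v | kd v == i] n z (@down_K ks) _ cz.
- move=> s u v Ks; rewrite !inE => /eqP ui /eqP vi us vs; apply/eqP; apply: contraT => uv.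
  have lt t : t \in s -> (kd t < 6)%N by move=> /(K_kd (K_all sub Ks)); rewrite !inE; lia.
  have := adj_ok (K_adj Ks us vs uv) (lt u us) (lt v vs); rewrite ui vi orbb.
  by have := lt u us; rewrite ui; case: {+}i => [|[|[|[|[|[|]]]]]].
- by move=> v; rewrite inE => /eqP; apply: bz.
exists w => //; case: cw => [cw ? ?]; split=> //; apply: on_sub cw => s.
rewrite avoid_clique; apply: clique_sub => v /=.
by rewrite inE mem_filter /= andbC.
Qed.

Hypothesis tri0 : forall t g v, (kd t == 1%N) || (kd t == 2%N) -> kd g = 0%N ->
  kd v \in [:: 3; 4; 5]%N -> adj t g -> adj t v -> adj g v.
Hypothesis tri34 : forall t a b, (kd t < 3)%N -> kd a = 3%N -> kd b = 4%N ->
  adj t a -> adj t b -> adj a b.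

Lemma lk_adj ks v s u : lk (K ks) v s -> u \in s -> adj v u.
Proof.
case/andP=> vs Ks us; apply: (clique_adj adj_sym Ks) => //.
by apply: contraNneq vs => <-.
Qed.

Lemma lk_kd ks v s u : lk (K ks) v s -> u \in s -> kd u \in ks.
Proof. by case/andP=> _ Ks us; apply: (K_kd Ks); apply: setU1r. Qed.

(** In the link of u the unique a is joined to every vertex except those of kind 5,
    so that the link without them is a cone. *)
Lemma cone_U ks u a s : subkinds ks -> 3%N \in ks -> kd u = 2%N -> #|nb u 3| = 1%N ->
  a \in nb u 3 -> lk (K ks) u s -> (forall v, v \in s -> kd v != 5%N) -> lk (K ks) u (a |: s).
Proof.
move=> sub k3 u2 /eqP/cards1P[a' nbE] aE us no5.
have [aa' /eqP a3 ua] : [/\ a = a', kd a == 3%N & adj u a].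
  by move: (aE); rewrite nbE inE => /eqP; move: aE; rewrite inE => /andP[].
case/andP: (us) => uns Ks; have ks2 : kd u \in ks by apply: K_kd Ks (setU11 _ _).
apply/andP; split; first by rewrite !inE negb_or uns (neq_kd u2 a3).
rewrite setUCA /K cliqueU // a3 k3 -/(K ks) Ks /=; apply/forall_inP=> v.
rewrite in_setU1 => /predU1P[->|vs]; first by rewrite adj_sym ua implybT.
apply/implyP=> va; have uv := lk_adj us vs; have vk := lk_kd us vs.
have vlt := subkinds_lt sub vk.
have := adj_ok uv; rewrite u2 => /(_ isT vlt).
move: vlt (no5 v vs); case E : (kd v) => [|[|[|[|[|[|]]]]]] // _ _ _.
- by rewrite adj_sym; apply: (@tri0 u) => //; rewrite ?u2 ?a3.
- by case/eqP: va; apply/eqP; rewrite aa' -in_set1 -nbE inE uv E.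
by apply: (@tri34 u) => //; rewrite u2.
Qed.

(** The contraction of z by u lies in the part of the link without vertices c:
    by last_coface and the vanishing conditions, z is zero at all g c u. *)
Lemma push_U z : cyc r (K all_ks) 3 z ->
  (forall u, kd u = 2%N -> #|nb u 3| = 1%N) ->
  (forall u g c, kd u = 2%N -> g \in behead (enb u 0) -> c \in enb u 5 ->
     z (g |: (c |: [set u])) = 0) ->
  exists2 w, on (K all_ks) w & cyc r (K [:: 0; 1; 3; 4; 5]%N) 3 (z + del r w).
Proof.
move=> cz nb23 z0; apply: (@push_kind all_ks 2) => // u u2 [Ly hy dy].
have /eqP/cards1P[a nbE] := nb23 u u2; have aE : a \in nb u 3 by rewrite nbE set11.
apply: (@cone_bounds _ _ r_inj _ a) dy => s ys; apply: (cone_U _ _ u2 (nb23 _ u2) aE) => //.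
  exact: Ly.
move=> c cs; apply/eqP=> c5; case/negP: (ys); apply/eqP.
have Ls : lk (K all_ks) u s by apply/Ly.
have /cards1P[g gE] : #|s :\ c| == 1%N.
  by have := hy _ ys; rewrite /= (cardsD1 c) cs.
have sE : s = g |: [set c] by rewrite setUC -(setD1K cs) gE.
rewrite ffunE; case: ifPn => // us; rewrite sE set3_perm setUCA.
case: cz => Kz hz dz; have uc : adj u c := lk_adj Ls cs.
have -> : z (g |: (c |: [set u])) = 0; last by rewrite mulr0.
apply: (@last_coface _ r _ _ (enb u 0) dz) => [v|v _ vB|].
- apply: (@coface_enb _ _ _ _ _ [:: c; u] _ Kz); rewrite ?inE ?eqxx ?orbT //.
    by move=> w; rewrite !inE.
  by rewrite /= c5 u2.
- by apply: z0 => //; rewrite in_enb uc c5.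
rewrite !inE negb_or; apply/andP; split.
  by apply/negP=> /eqP gc; have := setD11 c s; rewrite gE gc set11.
by apply: contraNneq us => <-; rewrite sE setU11.
Qed.

Lemma K_seq ks (l : seq V) (s : {set V}) :
  all (fun v => kd v \in ks) l -> pairwise adj l -> s \subset l -> K ks s.
Proof.
move=> lks ladj /subsetP sl; apply: (@down_K ks [set v in l]).
  by apply/subsetP=> v /sl; rewrite inE.
move: lks ladj {sl}; elim: l => [_ _|v l IHl /= /andP[vk lk_] /andP[/allP vl ladj]].
  by apply/cliqueP=> v; rewrite !inE.
have -> : [set u in v :: l] = v |: [set u in l].
  by apply/setP=> u; rewrite !inE.
rewrite /K cliqueU // vk -/(K ks) IHl //=; apply/forall_inP=> u; rewrite inE => /vl->.
by rewrite implybT.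
Qed.

Lemma lk_seq ks v (l : seq V) (s : {set V}) :
  all (fun v => kd v \in ks) (v :: l) -> pairwise adj (v :: l) -> s \subset l ->
  lk (K ks) v s.
Proof.
move=> lks ladj sl; apply/andP; split.
  apply/negP=> /(subsetP sl) vl; case/andP: ladj => /allP/(_ v vl).
  by rewrite adj_irr.
apply: K_seq lks ladj _; apply/subsetP=> u; rewrite !inE => /orP[->//|/(subsetP sl)->].
by rewrite orbT.
Qed.

Lemma lk2_seq ks v h (l : seq V) (s : {set V}) :
  all (fun v => kd v \in ks) (v :: h :: l) -> pairwise adj (v :: h :: l) -> s \subset l ->
  lk (lk (K ks) v) h s.
Proof.
move=> lks ladj sl; apply/andP; split.
  by case/andP: lks => _ lks; case/andP: ladj => _ /(lk_seq lks)/(_ sl)/andP[].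
apply: lk_seq lks ladj _; apply/subsetP=> u; rewrite !inE => /orP[->//|/(subsetP sl)->].
by rewrite orbT.
Qed.

Lemma sub2 u v : u |: [set v] \subset [:: u; v].
Proof. by apply/subsetP=> t; rewrite !inE. Qed.

(** Every vertex is joined to a0, or to b0 which is itself joined to a0. *)
Lemma conn_star (L : {set V} -> bool) a0 b0 : a0 != b0 -> L (b0 |: [set a0]) ->
  (forall v, L [set v] -> [|| v == a0, L (v |: [set a0]) | (v != b0) && L (v |: [set b0])]) ->
  forall v, L [set v] -> conn r L v a0.
Proof.
move=> ab Lab Lv v /Lv/or3P[/eqP->|La|/andP[vb Lb]].
- exact: conn_refl.
- by have [->|va] := eqVneq v a0; [apply: conn_refl | apply: conn_edge].
by apply: conn_trans (conn_edge r_inj vb Lb) (conn_edge r_inj _ Lab); rewrite eq_sym.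
Qed.

Lemma adj_t0 t g v : kd t = 1%N -> kd g = 0%N -> kd v \in [:: 3; 4]%N ->
  adj t g -> adj t v -> adj g v.
Proof.
move=> t1 g0 v34; apply: tri0 => //; first by rewrite t1.
by move: v34; rewrite !inE => /orP[]->; rewrite ?orbT.
Qed.

Lemma kd_nb_T ks t v : subkinds ks -> kd t = 1%N -> kd v \in ks -> adj t v ->
  [\/ kd v = 0, kd v = 3 | kd v = 4]%N.
Proof.
move=> sub t1 vk tv; have vlt := subkinds_lt sub vk.
have := adj_ok tv; rewrite t1 => /(_ isT vlt).
by move: vlt; case: (kd v) => [|[|[|[|[|[|]]]]]] // _ _; [constructor 1 | constructor 2 | constructor 3].
Qed.

(** * Links of the two-element cosets *)

(** The link of t is the join of the two elements g, the three cosets a and the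
    three cosets b which contain it. A join of three discrete sets is connected
    and simply connected. *)
Section LinkT.
Variables (ks : seq nat) (t a0 b0 : V).
Hypotheses (sub : subkinds ks) (ksP : all (mem ks) [:: 0; 1; 3; 4]%N) (t1 : kd t = 1%N).
Hypotheses (a03 : kd a0 = 3%N) (b04 : kd b0 = 4%N) (ta0 : adj t a0) (tb0 : adj t b0).

Let kin (i : nat) : i \in [:: 0; 1; 3; 4]%N -> i \in ks := allP ksP i.
Let tab a b : kd a = 3%N -> kd b = 4%N -> adj t a -> adj t b -> adj a b.
Proof. by move=> a3 b4; apply: tri34; rewrite ?t1. Qed.

Lemma bounds_lk_T1 y : cyc r (lk (K ks) t) 1 y -> bounds (lk (K ks) t) y.
Proof.
apply: (@conn_bounds _ r _ _ a0); apply: (@conn_star _ _ b0).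
- exact: neq_kd a03 b04 _.
- apply: lk_seq (sub2 _ _); rewrite /= ?t1 ?a03 ?b04 ?kin ?ta0 ?tb0 //=.
  by rewrite adj_sym tab.
move=> v Lv; have tv := lk_adj Lv (set11 v); have vk := lk_kd Lv (set11 v).
have [v0|v3|v4] := kd_nb_T sub t1 vk tv.
- apply/or3P/Or32/lk_seq/sub2; rewrite /= ?t1 ?a03 ?v0 ?kin ?ta0 ?tv //=.
  by rewrite (@adj_t0 t) ?a03.
- rewrite (neq_kd v3 b04) //=; apply/or3P/Or33/lk_seq/sub2; rewrite /= ?t1 ?v3 ?b04 ?kin ?tb0 ?tv //=.
  by rewrite tab.
apply/or3P/Or32/lk_seq/sub2; rewrite /= ?t1 ?a03 ?v4 ?kin ?ta0 ?tv //=.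
by rewrite adj_sym tab.
Qed.

(** Of the two elements g and h of t, first h is pushed away, since its link in
    the link of t is a connected graph; what remains is a cone with apex g. *)
Lemma bounds_lk_T2 y : #|nb t 0| = 2 -> cyc r (lk (K ks) t) 2 y -> bounds (lk (K ks) t) y.
Proof.
move=> /eqP/cards2P[g [h [gh nbE]]] cy.
have [[/andP[tg /eqP g0] /andP[th /eqP h0]] gnE] : ((adj t g && (kd g == 0%N)) /\ (adj t h && (kd h == 0%N))) /\
    forall v, adj t v -> kd v = 0%N -> v = g \/ v = h.
  split; first by have /setP nbP := nbE; split; [have := nbP g | have := nbP h]; rewrite !inE eqxx ?orbT.
  move=> v tv v0; have : v \in nb t 0 by rewrite inE tv v0.
  by rewrite nbE !inE => /orP[]/eqP; [left | right].
have dL : down (lk (K ks) t) by apply/down_lk/down_K.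
have [||w Lw cw] := push_cyc r_inj (T := [set h]) dL _ cy.
- by move=> s u v _ /set1P-> /set1P->.
- move=> u /set1P-> {u}; apply: (@conn_bounds _ r _ _ a0); apply: (@conn_star _ _ b0).
  + exact: neq_kd a03 b04 _.
  + apply: lk2_seq (sub2 _ _); first by rewrite /= t1 h0 a03 b04 !kin.
    have ha0 : adj h a0 by apply: (@adj_t0 t); rewrite ?a03.
    have hb0 : adj h b0 by apply: (@adj_t0 t); rewrite ?b04.
    by rewrite /= th ta0 tb0 ha0 hb0 adj_sym tab.
  move=> v /andP[hv Lv]; rewrite in_set1 in hv.
  have tv : adj t v by apply: lk_adj Lv _; rewrite !inE eqxx orbT.
  have vk : kd v \in ks by apply: lk_kd Lv _; rewrite !inE eqxx orbT.
  have {}hv : adj h v.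
    by case/andP: Lv => _ Ks; apply: (K_adj Ks); rewrite ?inE ?eqxx ?orbT.
  have [v0|v3|v4] := kd_nb_T sub t1 vk tv.
  + by have := adj_ok hv; rewrite h0 v0 => /(_ isT isT).
  + rewrite (neq_kd v3 b04) //=; apply/or3P/Or33/lk2_seq/sub2.
      by rewrite /= t1 h0 v3 b04 !kin.
    by rewrite /= th tv tb0 hv (@adj_t0 t) ?b04 //= tab.
  apply/or3P/Or32/lk2_seq/sub2; first by rewrite /= t1 h0 v4 a03 !kin.
  by rewrite /= th tv ta0 hv (@adj_t0 t) ?a03 //= adj_sym tab.
have -> : y = (y + del r w) - del r w by rewrite addrK.
apply: boundsB; last by exists w.
case: cw => Ly hy dy; apply: (@cone_bounds _ _ r_inj _ g) dy => s /Ly/andP[Ls sh].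
have ht : h \notin s by rewrite disjoint_sym disjoints1 in sh.
case/andP: (Ls) => ts Kts; have gt : g != t by apply: neq_kd g0 t1 _.
apply/andP; split; first by rewrite !inE negb_or eq_sym gt.
rewrite setUCA /K cliqueU // g0 kin // -/(K ks) Kts /=; apply/forall_inP=> v.
rewrite in_setU1 => /predU1P[->|vs]; first by rewrite adj_sym tg implybT.
apply/implyP=> vg; have tv := lk_adj Ls vs.
have [v0|v3|v4] := kd_nb_T sub t1 (lk_kd Ls vs) tv.
- by have [vE|vE] := gnE v tv v0; [rewrite vE eqxx in vg | rewrite vE (negPf ht) in vs].
- by apply: (@adj_t0 t); rewrite ?v3.
by apply: (@adj_t0 t); rewrite ?v4.
Qed.

End LinkT.

Hypothesis c10 : forall t, kd t = 1%N -> #|nb t 0| = 2%N.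
Hypothesis c13 : forall t, kd t = 1%N -> #|nb t 3| = 3%N.
Hypothesis c14 : forall t, kd t = 1%N -> #|nb t 4| = 3%N.

Lemma nb_witness t i n : #|nb t i| = n.+1 -> exists2 v, adj t v & kd v = i.
Proof.
move=> nE; have /card_gt0P[v] : (0 < #|nb t i|)%N by rewrite nE.
by rewrite inE => /andP[tv /eqP]; exists v.
Qed.

Lemma push_T ks n z : subkinds ks -> all (mem ks) [:: 0; 1; 3; 4]%N -> (n < 2)%N ->
  cyc r (K ks) n.+2 z ->
  exists2 w, on (K ks) w & cyc r (K (filter (predC1 1%N) ks)) n.+2 (z + del r w).
Proof.
move=> sub ksP n2 cz; apply: push_kind => // t t1.
have [a0 ta0 a03] := nb_witness (c13 t1); have [b0 tb0 b04] := nb_witness (c14 t1).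
case: n n2 cz => [|[|//]] _ _ cy; first exact: (bounds_lk_T1 sub ksP t1 a03 b04).
exact: (bounds_lk_T2 sub ksP t1 a03 b04 ta0 tb0 (c10 t1)).
Qed.

Hypothesis c03 : forall g, kd g = 0%N -> #|nb g 3| = 7%N.
Hypothesis c04 : forall g, kd g = 0%N -> #|nb g 4| = 7%N.
Hypothesis c20 : forall u, kd u = 2%N -> #|nb u 0| = 3%N.
Hypothesis c23 : forall u, kd u = 2%N -> #|nb u 3| = 1%N.
Hypothesis c24 : forall u, kd u = 2%N -> #|nb u 4| = 1%N.
Hypothesis c25 : forall u, kd u = 2%N -> #|nb u 5| = 2%N.
Hypothesis n0 : #|[set v | kd v == 0%N]| = 168%N.
Hypothesis n1 : #|[set v | kd v == 1%N]| = 1764%N.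
Hypothesis n2 : #|[set v | kd v == 2%N]| = 1568%N.

Lemma size_enb v i : size (enb v i) = #|nb v i|.
Proof. by rewrite -cardE. Qed.

Lemma size_flatten_const (T : Type) (U : eqType) (F : U -> seq T) (e : seq U) m :
  (forall u : U, u \in e -> size (F u) = m) -> size (flatten (map F e)) = (size e * m)%N.
Proof.
elim: e => //= u e IHe sz; rewrite size_cat sz ?mem_head // IHe ?mulSn // => t te.
by apply: sz; rewrite inE te orbT.
Qed.

(** * Upper bounds for the ranks *)

Definition kind i := enum [set v | kd v == i].

Lemma in_kind i v : (v \in kind i) = (kd v == i).
Proof. by rewrite mem_enum inE. Qed.

(** One value of g is left out for each u: it is recovered by last_coface. The same
    device gives the tails of the enumerations in the two lists below. *)
Definition faces_U : seq {set V} :=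
  flatten [seq [seq g |: (c |: [set u]) | g <- behead (enb u 0), c <- enb u 5] | u <- kind 2].

Definition faces_G : seq {set V} :=
  flatten [seq [seq a |: (b |: [set g]) | a <- behead (enb g 3), b <- behead (enb g 4)] | g <- kind 0].

Definition faces_T : seq {set V} :=
  flatten [seq [seq b |: (p.2 |: (p.1 |: [set t])) |
    p <- [seq (g, a) | g <- behead (enb t 0), a <- enb t 3], b <- behead (enb t 4)] | t <- kind 1].

Lemma size_faces_U : size faces_U = (1568 * 4)%N.
Proof.
rewrite (size_flatten_const (m := 4)) => [|u].
  by rewrite /kind -cardE n2.
by rewrite in_kind => /eqP u2; rewrite size_allpairs size_behead !size_enb c20 ?c25.
Qed.

Lemma size_faces_G : size faces_G = (168 * 36)%N.
Proof.
rewrite (size_flatten_const (m := 36)) => [|u].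
  by rewrite /kind -cardE n0.
by rewrite in_kind => /eqP u2; rewrite size_allpairs !size_behead !size_enb c03 ?c04.
Qed.

Lemma cyc_homologous (L : {set V} -> bool) z w : on L w -> bounds L (z - (z + del r w)).
Proof. by move=> Lw; rewrite opprD addrA subrr sub0r; apply: boundsN; exists w. Qed.

Lemma size_faces_T : size faces_T = (1764 * 6)%N.
Proof.
rewrite (size_flatten_const (m := 6)) => [|u].
  by rewrite /kind -cardE n1.
by rewrite in_kind => /eqP u2; rewrite !size_allpairs !size_behead !size_enb c10 ?c13 ?c14.
Qed.

(** Six evaluations for each t determine a 3-cycle, by zero4. *)
Theorem H3_bound : dep_le r (K all_ks) (cyc r (K all_ks) 4%N) (1764 * 6)%N.
Proof.
rewrite -size_faces_T -[size _]addn0; apply: dep_le_eval.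
  by move=> x y c c'; apply: cycMB.
apply: dep_le0 => z [cz z0]; rewrite (zero4 cz c24); first exact: bounds0.
move=> t g a b t1 gB aE bB; apply: z0; apply/flatten_mapP; exists t; first by rewrite in_kind t1.
by apply/allpairsP; exists ((g, a), b); split=> //; apply/allpairsP; exists (g, a).
Qed.

(** The first 4 * 1568 evaluations make it possible to avoid the vertices u, and
    then the vertices t; the remaining ones determine the cycle, by gab_zero. *)
Theorem H2_bound : dep_le r (K all_ks) (cyc r (K all_ks) 3%N) (1568 * 4 + 168 * 36)%N.
Proof.
rewrite -size_faces_U; apply: dep_le_eval.
  by move=> x y c c'; apply: cycMB.
apply: (@dep_le_homologous _ _ _ _ (cyc r (K [:: 0; 3; 4; 5]%N) 3)).
  move=> z [cz z0]; have [|w Kw cw] := push_U cz c23.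
    move=> u g c u2 gB cE; apply: z0; apply/flatten_mapP; exists u; first by rewrite in_kind u2.
    by apply/allpairsP; exists (g, c).
  have [|||w' Kw' cw'] := @push_T _ 1 _ _ _ _ cw; try by [].
  exists (z + del r w + del r w') => //.
  rewrite -addrA -raddfD /=; apply: cyc_homologous; apply: onD => //.
  by apply: on_sub Kw' => s; apply: K_all.
rewrite -size_faces_G -[size _]addn0; apply: dep_le_eval; first by move=> x y c c'; apply: cycMB.
apply: dep_le0 => z [cz z0]; rewrite (gab_zero cz); first exact: bounds0.
move=> g a b g0 aB bB; apply: z0; apply/flatten_mapP; exists g; first by rewrite in_kind g0.
by apply/allpairsP; exists (a, b).
Qed.

Local Notation wdg := (wdg r).
Local Notation one := (one V).

(** * A nonzero cycle of degree three *)

(** The suspension of x with poles u and v. *)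
Definition dif u v x : ch V := wdg u x - wdg v x.

Lemma del_dif u v x : del r (dif u v x) = - dif u v (del r x).
Proof. by rewrite /dif raddfB /= !del_wdg // !opprB addrC addrA subrK. Qed.

Lemma dif_neq0 u v x s : dif u v x s != 0 ->
  exists2 w, (w == u) || (w == v) & w \in s /\ x (s :\ w) != 0.
Proof.
rewrite chDE chNE; have [u0|/wdg_neq0[us xu]] := eqVneq (wdg u x s) 0.
  by rewrite u0 sub0r oppr_eq0 => /wdg_neq0[vs xv]; exists v; rewrite ?eqxx ?orbT.
by exists u; rewrite ?eqxx.
Qed.

(** An octahedron in the link of t: the join of the two elements of t, of the pair
    of a and the first coset of kind 3, and of the pair of b and the first coset
    of kind 4. When t has no neighbours of some kind, t serves as a default. *)
Definition sph t a b : ch V :=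
  dif (nth t (enb t 0) 0) (nth t (enb t 0) 1)
    (dif a (head t (enb t 3)) (dif b (head t (enb t 4)) one)).

Lemma del_sph t a b : del r (sph t a b) = 0.
Proof.
have raddf_dif u v : dif u v 0 = 0 by rewrite /dif !raddf0 addr0.
by rewrite /sph !del_dif del_one !(raddf_dif, oppr0).
Qed.

Lemma head_enb t i n : #|nb t i| = n.+1 -> head t (enb t i) \in enb t i.
Proof. by rewrite -size_enb; case: (enb t i) => //= v l _; rewrite mem_head. Qed.

Lemma sph_supp t a b s : kd t = 1%N -> a \in enb t 3 -> b \in enb t 4 -> sph t a b s != 0 ->
  exists g a' b', [/\ g \in enb t 0, a' \in enb t 3, b' \in enb t 4 & s = g |: (a' |: [set b'])].
Proof.
move=> t1 aE bE /dif_neq0[g gE [gs /dif_neq0[a' a'E [a's /dif_neq0[b' b'E [b's]]]]]].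
rewrite oneE pnatr_eq0 eqb0 negbK => /eqP s0.
exists g, a', b'; split.
- by case/orP: gE => /eqP->; apply: mem_nth; rewrite size_enb c10.
- by case/orP: a'E => /eqP->; rewrite ?(head_enb (c13 t1)).
- by case/orP: b'E => /eqP->; rewrite ?(head_enb (c14 t1)).
by rewrite -[[set b']]setU0 -s0 !setD1K.
Qed.

Lemma on_sph t a b : kd t = 1%N -> a \in enb t 3 -> b \in enb t 4 ->
  [/\ on (lk (K all_ks) t) (sph t a b), on (K [:: 0; 3; 4; 5]%N) (sph t a b) & hom 3 (sph t a b)].
Proof.
move=> t1 aE bE.
have P s : sph t a b s != 0 -> [/\ lk (K all_ks) t s, K [:: 0; 3; 4; 5]%N s & #|s| == 3].
  move/(sph_supp t1 aE bE) => [g [a' [b' []]]]; rewrite !in_enb.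
  move=> /andP[tg /eqP g0] /andP[ta /eqP a3] /andP[tb /eqP b4] ->.
  have ga : adj g a' by apply: (@adj_t0 t); rewrite ?a3.
  have gb : adj g b' by apply: (@adj_t0 t); rewrite ?b4.
  have ab : adj a' b' by apply: (@tri34 t); rewrite ?t1.
  have sub : g |: (a' |: [set b']) \subset [:: g; a'; b'].
    by apply/subsetP=> v; rewrite !inE.
  split.
  - apply: lk_seq sub; first by rewrite /= t1 g0 a3 b4.
    by rewrite /= tg ta tb ga gb ab.
  - apply: K_seq sub; first by rewrite /= g0 a3 b4.
    by rewrite /= ga gb ab.
  rewrite !cardsU1 cards1 !inE (negPf (neq_kd g0 a3 isT)) (negPf (neq_kd g0 b4 isT)).
  by rewrite (negPf (neq_kd a3 b4 isT)).
by split=> s /P[].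
Qed.

Lemma behead_neq_head (l : seq V) t v : uniq l -> v \in behead l -> v != head t l.
Proof. by case: l => //= u l /andP[ul _] vl; apply: contraNneq ul => <-. Qed.

(** The simplex g a1 b1, with g fixed and a1, b1 different from the first vertices
    of their kinds, belongs to exactly one of the octahedra in the link of t.
    This makes them independent. *)
Lemma sphE t a b a1 b1 : kd t = 1%N ->
  a \in behead (enb t 3) -> b \in behead (enb t 4) ->
  a1 \in behead (enb t 3) -> b1 \in behead (enb t 4) ->
  (sph t a b (nth t (enb t 0) 0 |: (a1 |: [set b1])) != 0) = (a1 == a) && (b1 == b).
Proof.
move=> t1 aB bB a1B b1B; have sz : size (enb t 0) = 2 by rewrite size_enb c10.
have kdP v i : v \in enb t i -> kd v = i by rewrite in_enb => /andP[_ /eqP].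
have gE : nth t (enb t 0) 0 \in enb t 0 by rewrite mem_nth ?sz.
have hE : nth t (enb t 0) 1 \in enb t 0 by rewrite mem_nth ?sz.
have gh : nth t (enb t 0) 0 != nth t (enb t 0) 1 by rewrite nth_uniq ?sz ?enum_uniq.
rewrite /sph; move: (nth _ _ 0) (nth _ _ 1) gE hE gh => g h /kdP g0 /kdP h0 gh.
have a13 := kdP _ _ (mem_behead a1B); have b14 := kdP _ _ (mem_behead b1B).
have a3 := kdP _ _ (mem_behead aB).
have aa0 := behead_neq_head t (enum_uniq _) a1B.
have bb0 := behead_neq_head t (enum_uniq _) b1B.
have a03 := kdP _ _ (head_enb (c13 t1)).
rewrite -/(enb t 3) in aa0; rewrite -/(enb t 4) in bb0.
move: (head t (enb t 3)) (head t (enb t 4)) aa0 bb0 a03 => a0 b0 aa0 bb0 a03.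
have sgn0 v s (c : int) : (sg r v s * c == 0) = (c == 0).
  by rewrite mulf_eq0 /sg signr_eq0.
rewrite chDE chNE wdgU; last by rewrite !inE negb_or (neq_kd g0 a13) // (neq_kd g0 b14).
rewrite [wdg h _ _]wdgF ?subr0; last first.
  by rewrite !inE !negb_or eq_sym gh (neq_kd h0 a13) // (neq_kd h0 b14).
rewrite sgn0 chDE chNE [wdg a0 _ _]wdgF ?subr0; last first.
  by rewrite !inE negb_or eq_sym aa0 (neq_kd a03 b14).
have [->|aa1] := eqVneq a1 a; last first.
  by rewrite wdgF ?eqxx // !inE negb_or eq_sym aa1 (neq_kd a3 b14).
rewrite wdgU ?inE ?(neq_kd a3 b14) // sgn0 chDE chNE !wdg1E !(inj_eq set1_inj).
by rewrite (negPf bb0) subr0 pnatr_eq0 eqb0 negbK.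
Qed.

Definition sph_index : seq (V * (V * V)) :=
  [seq (t, p) | t <- kind 1, p <- [seq (a, b) | a <- behead (enb t 3), b <- behead (enb t 4)]].

Lemma size_sph_index : size sph_index = (1764 * 4)%N.
Proof.
rewrite (size_flatten_const (m := 4)) => [|t].
  by rewrite /kind -cardE n1.
by rewrite in_kind => /eqP t1; rewrite size_map size_allpairs !size_behead !size_enb c13 ?c14.
Qed.

Lemma uniq_sph_index : uniq sph_index.
Proof.
apply: allpairs_uniq_dep; first exact: enum_uniq.
  move=> t _; apply: allpairs_uniq; rewrite -?drop1 ?drop_uniq ?enum_uniq //.
  by move=> [? ?] [? ?].
by move=> [? ?] [? ?] _ _ /= [-> ->].
Qed.

Lemma in_sph_index p : p \in sph_index ->
  [/\ kd p.1 = 1%N, p.2.1 \in behead (enb p.1 3) & p.2.2 \in behead (enb p.1 4)].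
Proof.
case/allpairsPdep=> t [q [tE qE ->]] /=; move: tE; rewrite in_kind => /eqP t1.
by case/allpairsP: qE => -[a b] [? ? ->].
Qed.

Theorem H3_nonzero : exists2 z, cyc r (K all_ks) 4%N z & z != 0.
Proof.
pose X p := sph p.1 p.2.1 p.2.2.
have XP p : p \in sph_index -> [/\ on (lk (K all_ks) p.1) (X p), on (K [:: 0; 3; 4; 5]%N) (X p) & hom 3 (X p)].
  by case/in_sph_index => t1 /mem_behead aE /mem_behead bE; apply: on_sph.
have ltn : (size faces_G < size sph_index)%N by rewrite size_faces_G size_sph_index.
pose e i := tnth (in_tuple sph_index) i; pose fc j := tnth (in_tuple faces_G) j.
have eI i : e i \in sph_index by apply: mem_tnth.
have [c [i0 ci0] cM] := int_dependence (\matrix_(i, j) X (e i) (fc j)) ltn.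
(* The combination vanishes on the list faces_G, which determines a cycle of
   simplices g a b. *)
have Y0 : \sum_i X (e i) *~ c i = 0.
  apply: gab_zero; first split.
  - by apply: on_sum => i _; apply: onMz; case: (XP _ (eI i)).
  - by apply: on_sum => i _; apply: onMz; case: (XP _ (eI i)).
  - by rewrite raddf_sum big1 // => i _; rewrite raddfMz /= del_sph mul0rz.
  move=> g a b g0 aB bB; have : a |: (b |: [set g]) \in faces_G.
    apply/flatten_mapP; exists g; first by rewrite in_kind g0.
    by apply/allpairsP; exists (a, b).
  move=> /seq_tnthP[j jE]; rewrite sum_chE -[RHS](cM j); apply: eq_bigr => i _.
  by rewrite ffunMzE mulrzz mulrC mxE /fc -jE.
exists (\sum_i wdg (e i).1 (X (e i)) *~ c i); first split.
- apply: on_sum => i _; apply: onMz; apply: on_wdg_lk.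
  by case: (XP _ (eI i)).
- apply: on_sum => i _; apply: onMz; have [Lx _ hx] := XP _ (eI i).
  by apply: hom_wdg hx => s /Lx/andP[].
- rewrite raddf_sum -[RHS]Y0; apply: eq_bigr => i _.
  by rewrite raddfMz /= del_wdg // del_sph raddf0 subr0.
(* The simplex s belongs to the sphere with index i0 and to no other sphere in
   the link of t, so that the value at t |: s involves c i0 alone. *)
have [t1 aB bB] := in_sph_index (eI i0).
have tE i : (e i).1 \in kind 1 by rewrite in_kind; case: (in_sph_index (eI i)) => ->.
set t := (e i0).1 in t1 aB bB *; set a := (e i0).2.1 in aB *; set b := (e i0).2.2 in bB *.
pose g := nth t (enb t 0) 0; pose s := g |: (a |: [set b]).
have kdP v i : v \in enb t i -> kd v = i by rewrite in_enb => /andP[_ /eqP].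
have g0 : kd g = 0%N by apply: kdP; rewrite mem_nth // size_enb c10.
have a3 := kdP _ _ (mem_behead aB); have b4 := kdP _ _ (mem_behead bB).
have ns v : kd v = 1%N -> v \notin s.
  by move=> v1; rewrite !inE !negb_or (neq_kd v1 g0) // (neq_kd v1 a3) // (neq_kd v1 b4).
apply/negP=> /eqP/ffunP/(_ (t |: s)); rewrite ffunE sum_chE (bigD1 i0) //= big1 ?addr0.
  apply/eqP; rewrite ffunMzE mulrzz mulf_neq0 // wdgU ?ns //.
  by rewrite mulf_neq0 ?sphE ?eqxx // /sg signr_eq0.
move=> i ii0; rewrite ffunMzE mulrzz; have := tE i; rewrite in_kind => /eqP ti1.
have [tt|tt] := eqVneq (e i).1 t; last first.
  by rewrite wdgF ?mul0r // in_setU1 negb_or tt ns.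
rewrite tt wdgU ?ns //; suff -> : X (e i) s = 0 by rewrite mulr0 mul0r.
have [_ aB' bB'] := in_sph_index (eI i); rewrite tt in aB' bB'.
apply/eqP/negPn; rewrite /X tt sphE //; apply/negP=> /andP[/eqP aE /eqP bE].
case/eqP: ii0; apply/(tuple_uniqP (in_tuple sph_index) uniq_sph_index).
rewrite -/(e i) -/(e i0); move: tt aE bE; rewrite /t /a /b.
by case: (e i) (e i0) => [? [? ?]] [? [? ?]] /= -> -> ->.
Qed.

Hypothesis cC : forall c, kd c = 5%N -> exists2 g0, g0 \in nb c 0 &
  forall g, g \in nb c 0 -> exists g' u u', [/\ g' \in nb c 0, u \in nb c 2, u' \in nb c 2 &
    [/\ adj u g, adj u g', adj u' g' & adj u' g0]].

(** * Degrees zero and one *)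

Lemma kd_nb_C ks c v : subkinds ks -> kd c = 5%N -> kd v \in ks -> adj c v ->
  (kd v == 0%N) || (kd v == 2%N).
Proof.
move=> sub c5 vk cv; have vlt := subkinds_lt sub vk.
have := adj_ok cv; rewrite c5 => /(_ isT vlt).
by move: vlt; case: (kd v) => [|[|[|[|[|[|]]]]]].
Qed.

(** The link of c is the graph whose edges join the elements of c to the cosets u
    in c, and it is connected: by the hypothesis on c, any two elements are
    joined by a path through two cosets u. *)
Lemma push_C z : cyc r (K all_ks) 2 z ->
  exists2 w, on (K all_ks) w & cyc r (K [:: 0; 1; 2; 3; 4]%N) 2 (z + del r w).
Proof.
move=> cz; apply: (@push_kind all_ks 5) => // c c5.
have [g0] := cC c5; rewrite inE => /andP[cg0 /eqP g00] gP.
have edge g u : adj c g -> kd g = 0%N -> u \in nb c 2 -> adj u g ->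
    conn r (lk (K all_ks) c) u g.
  rewrite inE => cg g_0 /andP[cu /eqP u2] ug.
  apply: (conn_edge r_inj); first exact: neq_kd u2 g_0 _.
  by apply: lk_seq (sub2 _ _); rewrite /= ?c5 ?u2 ?g_0 // cu cg ug.
have conn0 g : g \in nb c 0 -> conn r (lk (K all_ks) c) g g0.
  move=> gC; have [g' [u [u' [g'C uC u'C [ug ug' u'g' u'g0]]]]] := gP g gC.
  move: gC g'C; rewrite !inE => /andP[cg /eqP g_0] /andP[cg' /eqP g'0].
  apply: conn_trans (conn_sym (edge _ _ cg g_0 uC ug)) _.
  apply: conn_trans (edge _ _ cg' g'0 uC ug') _.
  apply: conn_trans (conn_sym (edge _ _ cg' g'0 u'C u'g')) _.
  exact: edge.
apply: (@conn_bounds _ r _ _ g0) => v Lv.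
have cv := lk_adj Lv (set11 v); have vk := lk_kd Lv (set11 v).
have [/eqP v0|/eqP v2] := orP (kd_nb_C (erefl : subkinds all_ks) c5 vk cv).
  by apply: conn0; rewrite inE cv v0.
have [g vg g_0] := nb_witness (c20 v2).
have cg : adj c g by rewrite adj_sym; apply: (@tri0 v) => //; rewrite ?v2 ?c5 // adj_sym.
apply: conn_trans (edge g v cg g_0 _ vg) (conn0 g _); rewrite inE ?cv ?v2 //.
by rewrite cg g_0.
Qed.

Lemma push_U1 z : cyc r (K [:: 0; 1; 2; 3; 4]%N) 2 z ->
  exists2 w, on (K [:: 0; 1; 2; 3; 4]%N) w & cyc r (K [:: 0; 1; 3; 4]%N) 2 (z + del r w).
Proof.
move=> cz; apply: (@push_kind [:: 0; 1; 2; 3; 4]%N 2) => // u u2 [Ly hy dy].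
have /eqP/cards1P[a nbE] := c23 u2; have aE : a \in nb u 3 by rewrite nbE set11.
apply: (@cone_bounds _ _ r_inj _ a) dy => s ys; apply: (cone_U _ _ u2 (c23 u2) aE) => //.
  exact: Ly.
by move=> v vs; apply: contraTneq (lk_kd (Ly _ ys) vs) => ->.
Qed.

Lemma push_G z : cyc r (K [:: 0; 3; 4]%N) 2 z ->
  exists2 w, on (K [:: 0; 3; 4]%N) w & cyc r (K [:: 3; 4]%N) 2 (z + del r w).
Proof.
move=> cz; apply: (@push_kind [:: 0; 3; 4]%N 0) => // g g0.
have [a0 ga0 a03] := nb_witness (c03 g0); have [b0 gb0 b04] := nb_witness (c04 g0).
have gab a b : kd a = 3%N -> kd b = 4%N -> adj g a -> adj g b -> adj a b.
  by move=> a3 b4; apply: tri34; rewrite ?g0.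
apply: (@conn_bounds _ r _ _ a0); apply: (@conn_star _ _ b0).
- exact: neq_kd a03 b04 _.
- apply: lk_seq (sub2 _ _); rewrite /= ?g0 ?a03 ?b04 ?ga0 ?gb0 //=.
  by rewrite adj_sym gab.
move=> v Lv; have gv := lk_adj Lv (set11 v); have := lk_kd Lv (set11 v).
rewrite !inE => /or3P[]/eqP vk.
- by have := adj_ok gv; rewrite g0 vk => /(_ isT isT).
- rewrite (neq_kd vk b04) //=; apply/or3P/Or33/lk_seq/sub2; rewrite /= ?g0 ?vk ?b04 ?gb0 ?gv //=.
  by rewrite gab.
apply/or3P/Or32/lk_seq/sub2; rewrite /= ?g0 ?a03 ?vk ?ga0 ?gv //=.
by rewrite adj_sym gab.
Qed.

(** The ways of filling a 4-cycle a b a' b' of the bipartite graph: by a cone over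
    an element g, by cutting it in two along a path through another a or b, or
    because it is degenerate. *)
Inductive filled : V -> V -> V -> V -> Prop :=
| FillG g a a' b b' of kd g = 0%N & adj g a & adj g a' & adj g b & adj g b' : filled a a' b b'
| FillA a0 a a' b b' of kd a0 = 3%N & adj a0 b & adj a0 b' & filled a a0 b b' & filled a0 a' b b' : filled a a' b b'
| FillB b0 a a' b b' of kd b0 = 4%N & adj a b0 & adj a' b0 & filled a a' b b0 & filled a a' b0 b' : filled a a' b b'
| FillrA a b b' : filled a a b b'
| FillrB a a' b : filled a a' b b.

Local Notation edge a b := (wdg a (wdg b one)).

Lemma filled_bounds a a' b b' : kd a = 3%N -> kd a' = 3%N -> kd b = 4%N -> kd b' = 4%N ->
  filled a a' b b' ->
  bounds (K all_ks) (edge a b - edge a' b - (edge a b' - edge a' b')).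
Proof.
move=> + + + + fl; elim: fl => {a a' b b'}.
- move=> g a a' b b' g0 ga ga' gb gb' a3 a'3 b4 b'4.
  pose L s := K all_ks (g |: s).
  have onL c d : kd c = 3%N -> kd d = 4%N -> adj g c -> adj g d -> on L (edge c d).
    move=> c3 d4 gc gd s cds; rewrite (wdg2E (neq_kd c3 d4 isT) cds).
    apply: (@K_seq _ [:: g; c; d]); first by rewrite /= g0 c3 d4.
      by rewrite /= gc gd (@tri34 g) ?g0.
    by apply/subsetP=> v; rewrite !inE.
  apply: (@cone_bounds _ _ r_inj _ g).
    by apply: onB; apply: onB; apply: onL.
  rewrite !raddfB /= !del_wdg2 //.
  by apply/ffunP=> s; rewrite !(chDE, chNE) [RHS]ffunE; ring.
- move=> a0 a a' b b' a03 _ _ _ IH1 _ IH2 a3 a'3 b4 b'4.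
  have := boundsD (IH1 a3 a03 b4 b'4) (IH2 a03 a'3 b4 b'4).
  by congr bounds; apply/ffunP=> s; rewrite !(chDE, chNE); ring.
- move=> b0 a a' b b' b04 _ _ _ IH1 _ IH2 a3 a'3 b4 b'4.
  have := boundsD (IH1 a3 a'3 b4 b04) (IH2 a3 a'3 b04 b'4).
  by congr bounds; apply/ffunP=> s; rewrite !(chDE, chNE); ring.
- by move=> a b b' *; rewrite !subrr; apply: bounds0.
by move=> a a' b *; rewrite subrr; apply: bounds0.
Qed.

Hypothesis cfill : forall a a' b b', kd a = 3%N -> kd a' = 3%N -> kd b = 4%N -> kd b' = 4%N ->
  adj a b -> adj a b' -> adj a' b -> adj a' b' -> filled a a' b b'.
Hypothesis cnb3 : forall a1 a2 a3, kd a1 = 3%N -> kd a2 = 3%N -> kd a3 = 3%N ->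
  exists2 b, kd b = 4%N & [/\ adj a1 b, adj a2 b & adj a3 b].
Hypothesis cnb43 : forall b, kd b = 4%N -> exists2 a, kd a = 3%N & adj a b.
Hypothesis cnb50 : forall c, kd c = 5%N -> exists2 g, kd g = 0%N & adj c g.

(** Modulo boundaries the edge a b is a difference of a chain which depends on b and
    one which depends on a. The chain p a is a path from a0 to a through a
    chosen common neighbour; three 4-cycles, with a common neighbour b2 of a0, a
    and a', compare two such paths. *)
Lemma edges_bound a0 : kd a0 = 3%N -> exists p q : V -> ch V, forall a b,
  kd a = 3%N -> kd b = 4%N -> adj a b -> bounds (K all_ks) (edge a b - (q b - p a)).
Proof.
move=> a03.
have sq a a' b b' : kd a = 3%N -> kd a' = 3%N -> kd b = 4%N -> kd b' = 4%N ->
    adj a b -> adj a b' -> adj a' b -> adj a' b' ->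
    bounds (K all_ks) (edge a b - edge a' b - (edge a b' - edge a' b')).
  by move=> *; apply: filled_bounds => //; apply: cfill.
have [a|bs bsP] := @boolp.choice _ _ (fun a b => kd a = 3%N -> [/\ kd b = 4%N, adj a0 b & adj a b]).
  have [/eqP a3|a3] := boolP (kd a == 3%N); last by exists a => /eqP; rewrite (negPf a3).
  by have [b b4 [h0 h1 _]] := cnb3 a03 a3 a3; exists b.
have [b|ab abP] := @boolp.choice _ _ (fun b a => kd b = 4%N -> kd a = 3%N /\ adj a b).
  have [/eqP b4|b4] := boolP (kd b == 4%N); last by exists b => /eqP; rewrite (negPf b4).
  by have [a a3 h] := cnb43 b4; exists a.
pose p a := edge a0 (bs a) - edge a (bs a).
exists p, (fun b => edge (ab b) b + p (ab b)) => a b a3 b4 adjab.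
have [a'3 adja'b] := abP b b4; move: (ab b) a'3 adja'b => a' a'3 adja'b.
have [ba4 a0ba aba] := bsP a a3; have [ba'4 a0ba' a'ba'] := bsP a' a'3.
(* Each of the three 4-cycles below has b2 as a vertex. *)
have [b2 b24 [a0b2 ab2 a'b2]] := cnb3 a03 a3 a'3.
have S1 := sq a a' b b2 a3 a'3 b4 b24 adjab ab2 adja'b a'b2.
have S2 := sq a a0 (bs a) b2 a3 a03 ba4 b24 aba ab2 a0ba a0b2.
have S3 := sq a' a0 (bs a') b2 a'3 a03 ba'4 b24 a'ba' a'b2 a0ba' a0b2.
have := boundsD (boundsB S1 S2) S3; congr bounds.
by rewrite /p; apply/ffunP=> s; rewrite !(chDE, chNE); ring.
Qed.

(** By edges_bound, a cycle is homologous to a combination whose coefficients at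
    each a and at each b are its sums over the edges at that vertex, which are
    values of its boundary. *)
Lemma bounds_graph z : cyc r (K [:: 3; 4]%N) 2 z -> bounds (K all_ks) z.
Proof.
move=> [Kz hz dz].
have nk2 s : z s != 0 -> nk 3 s = 1%N /\ nk 4 s = 1%N.
  move=> zs; have Ks := Kz s zs; have Ka := K_all (erefl : subkinds [:: 3; 4]%N) Ks.
  have [[m0 m35 m45 m12 m15] sE] := nk_facts Ka.
  have := eqP (hz s zs); rewrite sE.
  have -> := nk_notin Ks (erefl : 0%N \notin [:: 3; 4]%N).
  have -> := nk_notin Ks (erefl : 1%N \notin [:: 3; 4]%N).
  have -> := nk_notin Ks (erefl : 2%N \notin [:: 3; 4]%N).
  by have -> := nk_notin Ks (erefl : 5%N \notin [:: 3; 4]%N); lia.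
pose y a b := rho r a z [set b].
have y_neq0 a b : y a b != 0 -> a != b /\ z (a |: [set b]) != 0.
  rewrite /y ffunE inE; have [->|ab] := eqVneq a b; first by rewrite eqxx.
  by rewrite mulf_eq0 negb_or => /andP[_].
have y_K a b : y a b != 0 -> [/\ adj a b, kd a \in [:: 3; 4]%N & kd b \in [:: 3; 4]%N].
  move=> /y_neq0[ab /Kz Ks]; split; last 2 first.
  - by apply: (K_kd Ks); rewrite !inE eqxx.
  - by apply: (K_kd Ks); rewrite !inE eqxx orbT.
  by apply: (K_adj Ks); rewrite ?inE ?eqxx ?orbT.
have y34 a b : kd a = 3%N -> y a b != 0 -> kd b = 4%N.
  move=> a3 /y_K[aab _]; rewrite !inE => /orP[]/eqP b3 //.
  by have := adj_ok aab; rewrite a3 b3 => /(_ isT isT).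
have y43 a b : kd b = 4%N -> y a b != 0 -> kd a = 3%N.
  move=> b4 /y_K[aab]; rewrite !inE => /orP[]/eqP a3 // _.
  by have := adj_ok aab; rewrite a3 b4 => /(_ isT isT).
have zE : z = \sum_(a | kd a == 3%N) \sum_(b | kd b == 4%N) edge a b *~ y a b.
  transitivity (\sum_(a | kd a == 3%N) wdg a (rho r a z)).
    apply/ffunP=> s; rewrite sum_chE; under eq_bigr => a _ do rewrite wdg_rho.
    have [->|zs] := eqVneq (z s) 0; first by rewrite big1 // => a _; rewrite if_same.
    have [/eqP/cards1P[a aE] _] := nk2 s zs.
    have aP v : (v \in s) && (kd v == 3%N) = (v == a) by rewrite -in_set1 -aE inE.
    by rewrite -big_mkcondr (big_pred1 a) // => v; rewrite andbC aP.
  apply: eq_bigr => a /eqP a3; rewrite {1}(@hom1E _ r (rho r a z)); last exact: hom_rho.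
  rewrite raddf_sum [LHS](bigID (fun b => kd b == 4%N)) /= [X in _ + X]big1 ?addr0.
    by apply: eq_bigr => b _; rewrite raddfMz.
  move=> b b4; rewrite raddfMz /= -/(y a b); have [->|/(y34 _ _ a3)/eqP] := eqVneq (y a b) 0.
    by rewrite mulr0z.
  by rewrite (negPf b4).
have sum_b a : kd a = 3%N -> \sum_(b | kd b == 4%N) y a b = 0.
  move=> a3; transitivity (del r (rho r a z) set0).
    rewrite del_set0 [RHS](bigID (fun b => kd b == 4%N)) /= [X in _ + X]big1 ?addr0 // => b b4.
    by apply/eqP; apply: contraNT b4 => /(y34 _ _ a3) ->.
  by apply/eqP; rewrite -oppr_eq0 -chNE -rho_del // dz raddf0 ffunE.
have sum_a b : kd b = 4%N -> \sum_(a | kd a == 3%N) y a b = 0.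
  move=> b4; transitivity (del r z [set b]); last by rewrite dz ffunE.
  rewrite sum_chE [RHS](bigID (fun a => kd a == 3%N)) /= [X in _ + X]big1 ?addr0 // => a a3.
  by apply/eqP; apply: contraNT a3 => /(y43 _ _ b4) ->.
have [z0|[s zs]] : z = 0 \/ exists s, z s != 0.
  have [/existsP|/existsPn z0] := boolP [exists s, z s != 0]; first by right.
  by left; apply/ffunP=> s; rewrite ffunE; apply/eqP; rewrite -[_ == _]negbK z0.
  by rewrite z0; apply: bounds0.
have [a0 _ a03] : exists2 v, v \in s & kd v = 3%N by apply: nk_gt0; have [->] := nk2 s zs.
have [p [q pqP]] := edges_bound a03.
have -> : z = \sum_(a | kd a == 3%N) \sum_(b | kd b == 4%N) (edge a b - (q b - p a)) *~ y a b.
  apply/eqP; rewrite -subr_eq0 {1}zE -sumrB; apply/eqP.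
  transitivity (\sum_(a | kd a == 3%N) \sum_(b | kd b == 4%N) (q b *~ y a b - p a *~ y a b)).
    apply: eq_bigr => a _; rewrite -sumrB; apply: eq_bigr => b _.
    by rewrite -mulrzBl -mulrzBl opprB addrCA subrr addr0.
  under eq_bigr => a _ do rewrite sumrB.
  rewrite sumrB exchange_big /= [X in X - _]big1 ?[X in _ - X]big1 ?subr0 //.
    by move=> a /eqP a3; rewrite -mulrz_sumr sum_b.
  by move=> b /eqP b4; rewrite -mulrz_sumr sum_a.
apply: bounds_sum => a /eqP a3; apply: bounds_sum => b /eqP b4.
have [->|yab] := eqVneq (y a b) 0; first by rewrite mulr0z; apply: bounds0.
by apply/boundsMz/pqP => //; case: (y_K a b yab).
Qed.

Theorem H1_trivial z : cyc r (K all_ks) 2%N z -> bounds (K all_ks) z.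
Proof.
move=> cz; have sub ks w : subkinds ks -> on (K ks) w -> bounds (K all_ks) (del r w).
  by move=> sub Kw; exists w => //; apply: on_sub Kw => s; apply: K_all.
have [w1 K1 c1] := push_C cz; have [w2 K2 c2] := push_U1 c1.
have [|||w3 K3 c3] := @push_T _ 0 _ _ _ _ c2; try by [].
have [w4 K4 c4] := push_G c3.
have := boundsB (boundsB (boundsB (boundsB (bounds_graph c4) (sub _ w4 _ K4)) (sub _ w3 _ K3)) (sub _ w2 _ K2)) (sub _ w1 _ K1).
by rewrite !addrK; apply.
Qed.

Theorem H0_trivial z : cyc r (K all_ks) 1%N z -> bounds (K all_ks) z.
Proof.
have edge u v : adj u v -> kd u \in all_ks -> kd v \in all_ks -> conn r (K all_ks) u v.
  move=> uv uk vk; apply: (conn_edge r_inj); first by apply: contraTneq uv => ->; rewrite adj_irr.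
  by apply: (@K_seq _ [:: u; v]) (sub2 _ _); rewrite /= ?uk ?vk ?uv.
have [g g0] : exists g, kd g = 0%N.
  have /card_gt0P[g] : (0 < #|[set v | kd v == 0%N]|)%N by rewrite n0.
  by rewrite inE => /eqP; exists g.
have [a0 _ a03] := nb_witness (c03 g0).
have conn3 a : kd a = 3%N -> conn r (K all_ks) a a0.
  move=> a3; have [b b4 [ab _ a0b]] := cnb3 a3 a3 a03.
  apply: conn_trans (edge a b ab _ _) _; rewrite ?a3 ?b4 //.
  by apply: edge; rewrite ?b4 ?a03 // adj_sym.
have via v a : adj v a -> kd v \in all_ks -> kd a = 3%N -> conn r (K all_ks) v a0.
  by move=> va vk a3; apply: conn_trans (edge v a va vk _) (conn3 a a3); rewrite a3.
have conn0 v : kd v = 0%N -> conn r (K all_ks) v a0.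
  by move=> v0; have [a va a3] := nb_witness (c03 v0); apply: (via v a); rewrite ?v0.
apply: (@conn_bounds _ r _ _ a0) => v Kv.
have := K_kd Kv (set11 v); rewrite !inE => vk.
case/or4P: vk => [/eqP/conn0//|/eqP v1|/eqP v2|/or3P[/eqP/conn3//|/eqP v4|/eqP v5]].
- by have [a va a3] := nb_witness (c13 v1); apply: (via v a); rewrite ?v1.
- by have [a va a3] := nb_witness (c23 v2); apply: (via v a); rewrite ?v2.
- by have [a a3 av] := cnb43 v4; apply: (via v a); rewrite ?v4 // adj_sym.
have [g' g'0 vg'] := cnb50 v5.
by apply: conn_trans (edge v g' vg' _ _) (conn0 g' g'0); rewrite ?v5 ?g'0.
Qed.

End Flags.

(** * The projective line over the field with seven elements *)

Section ProjectiveLine.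
Local Notation F7 := 'F_7.
Local Notation e0 := (ord0 : 'I_2).
Local Notation e1 := (lift ord0 (ord0 : 'I_1) : 'I_2).

(** The point with homogeneous coordinates x and y: a finite point x / y is
    numbered by its residue and the point at infinity has number 7. *)
Definition pt (x y : F7) : nat := if y == 0 then 7%N else nat_of_ord (x / y).
Definition px (n : nat) : F7 := if (n < 7)%N then n%:R else 1.
Definition py (n : nat) : F7 := if (n < 7)%N then 1 else 0.

Definition act (M : 'M[F7]_2) (n : nat) : nat :=
  pt (M e0 e0 * px n + M e0 e1 * py n) (M e1 e0 * px n + M e1 e1 * py n).

Lemma F7_lt (x : F7) : (x < 7)%N.
Proof. exact: ltn_ord. Qed.

Lemma pt_lt x y : (pt x y < 8)%N.
Proof. by rewrite /pt; case: eqP => // _; apply: ltn_trans (F7_lt _) _. Qed.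

Lemma pt_scale l x y : l != 0 -> pt (l * x) (l * y) = pt x y.
Proof.
move=> l0; rewrite /pt mulf_eq0 (negPf l0) orFb; case: eqP => // /eqP y0.
by congr (nat_of_ord _); rewrite invfM mulrACA divff // mul1r.
Qed.

(** A nonzero vector is a multiple of the chosen representative of its point. *)
Lemma ptK x y : (x != 0) || (y != 0) ->
  exists2 l, l != 0 & x = l * px (pt x y) /\ y = l * py (pt x y).
Proof.
rewrite /pt; have [->|y0] := eqVneq y 0; rewrite ?orbF => x0.
  by exists x; rewrite // /px /py ltnn mulr1 mulr0.
exists y => //; rewrite /px /py F7_lt mulr1; split=> //.
(* The type 'F_7 is convertible to 'Z_7, that is, to 'I_5.+2. *)
by rewrite (@natr_Zp 5 (x / y)) mulrC divfK.
Qed.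

Section TwoByTwo.
Variable R : comNzRingType.
Implicit Types M N : 'M[R]_2.

Lemma mulmx2 M N i j : (M *m N) i j = M i e0 * N e0 j + M i e1 * N e1 j.
Proof. by rewrite mxE !big_ord_recl big_ord0 addr0. Qed.

Lemma det2 M : \det M = M e0 e0 * M e1 e1 - M e0 e1 * M e1 e0.
Proof.
rewrite (expand_det_row _ e0) !big_ord_recl big_ord0 addr0 /cofactor !det_mx11 !mxE /=.
rewrite expr0 expr1 mul1r mulN1r mulrN; congr (_ * M _ _ - _ * M _ _); exact: val_inj.
Qed.

End TwoByTwo.

Lemma cramer_ring (R : comNzRingType) (a b c d x y : R) :
  (a * d - b * c) * x = d * (a * x + b * y) - b * (c * x + d * y) /\
  (a * d - b * c) * y = a * (c * x + d * y) - c * (a * x + b * y).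
Proof. by split; ring. Qed.

Lemma matrix_ring (R : comNzRingType) (m n a b c d x y l x' y' : R) :
  a * x + b * y = l * x' -> c * x + d * y = l * y' ->
  (m * a + n * c) * x + (m * b + n * d) * y = l * (m * x' + n * y').
Proof.
move=> E E'; transitivity (m * (a * x + b * y) + n * (c * x + d * y)); first by ring.
by rewrite E E'; ring.
Qed.

Lemma act_mul (M N : 'M[F7]_2) n : \det N != 0 -> act (M *m N) n = act M (act N n).
Proof.
move=> dN; rewrite /act.
set x := N e0 e0 * px n + N e0 e1 * py n; set y := N e1 e0 * px n + N e1 e1 * py n.
have [|l l0 [xE yE]] := @ptK x y.
  rewrite -negb_and; apply/negP=> /andP[/eqP x0 /eqP y0].
  have : \det N * px n = 0 /\ \det N * py n = 0.
    have [E E'] := cramer_ring (N e0 e0) (N e0 e1) (N e1 e0) (N e1 e1) (px n) (py n).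
    by rewrite det2 E E' -/x -/y x0 y0 !mulr0 subrr.
  case=> /eqP + /eqP; rewrite !mulf_eq0 (negPf dN) !orFb /px /py.
  by case: ifP => // _ _; rewrite oner_eq0.
by rewrite !mulmx2 !(matrix_ring _ _ xE yE) pt_scale.
Qed.

Local Notation quad := (nat * nat * nat * nat)%type.
(** The same action with entries in nat, for evaluation: nth reads the inverses of
    the residues modulo 7 off a list. *)
Definition invn (n : nat) : nat := nth 0 [:: 0; 1; 4; 5; 2; 3; 6]%N n.
Definition ptn (x y : nat) : nat :=
  (if y %% 7 == 0 then 7 else (x * invn (y %% 7)) %% 7)%N.
Definition pxn (n : nat) : nat := if (n < 7)%N then n else 1.
Definition pyn (n : nat) : nat := if (n < 7)%N then 1 else 0.
Definition actq (q : quad) (n : nat) : nat :=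
  let: (a, b, c, d) := q in ptn (a * pxn n + b * pyn n)%N (c * pxn n + d * pyn n)%N.

Definition ent (M : 'M[F7]_2) : quad := (nat_of_ord (M e0 e0), nat_of_ord (M e0 e1),
  nat_of_ord (M e1 e0), nat_of_ord (M e1 e1)).

Lemma natF (n : nat) : nat_of_ord (n%:R : F7) = (n %% 7)%N.
Proof. exact: val_Fp_nat. Qed.

Lemma natr_val (x : F7) : (nat_of_ord x)%:R = x.
Proof. exact: (@natr_Zp 5 x). Qed.

Lemma invnE (x : F7) : x^-1 = (invn x)%:R.
Proof.
have [->|x0] := eqVneq x 0; first by rewrite invr0.
apply: (mulfI x0); rewrite divff // -[x in x * _]natr_val -natrM; apply: val_inj.
rewrite /= [RHS]natF; move: x0 (F7_lt x); rewrite -[x == 0]/(nat_of_ord x == 0%N).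
by case: (nat_of_ord x) => [|[|[|[|[|[|[|?]]]]]]].
Qed.

Lemma ptnE (x y : nat) : pt x%:R y%:R = ptn x y.
Proof.
rewrite /pt /ptn -[_ == 0]/(nat_of_ord (y%:R : F7) == 0%N) natF; case: eqP => // _.
by rewrite invnE natF -natrM natF.
Qed.

Lemma pxnE n : px n = (pxn n)%:R.
Proof. by rewrite /px /pxn; case: ifP. Qed.

Lemma pynE n : py n = (pyn n)%:R.
Proof. by rewrite /py /pyn; case: ifP. Qed.

Lemma actqE M n : act M n = actq (ent M) n.
Proof.
by rewrite /act /actq /ent -ptnE !natrD !natrM !natr_val -pxnE -pynE.
Qed.

Lemma modn_eq1 (n : nat) : ((n%:R : F7) == 1) = (n %% 7 == 1)%N.
Proof. by rewrite -val_eqE /= natF. Qed.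

(** The factor 6 stands for -1 modulo 7. *)
Definition det1q (q : quad) : bool :=
  let: (a, b, c, d) := q in ((a * d + 6 * (b * c)) %% 7 == 1)%N.

Lemma det1qE M : (\det M == 1) = det1q (ent M).
Proof.
rewrite det2 /det1q /ent -modn_eq1 natrD !natrM !natr_val; congr (_ + _ == _).
have -> : 6%:R = - 1 :> F7 by apply: val_inj.
by rewrite mulN1r.
Qed.

Definition pairs (S T : Type) (s : seq S) (t : seq T) := [seq (x, y) | x <- s, y <- t].

Lemma mem_pairs (S T : eqType) (s : seq S) (t : seq T) x y :
  ((x, y) \in pairs s t) = (x \in s) && (y \in t).
Proof.
apply/allpairsP/andP => [[[a b] [/= ? ? [-> ->]]]|[xs yt]] //.
by exists (x, y).
Qed.

Definition quads : seq quad := pairs (pairs (pairs (iota 0 7) (iota 0 7)) (iota 0 7)) (iota 0 7).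

Lemma ent_quads M : ent M \in quads.
Proof. by rewrite !mem_pairs !mem_iota !F7_lt. Qed.

Definition mq (q : quad) : 'M[F7]_2 :=
  let: (a, b, c, d) := q in
  \matrix_(i, j) (if i == 0 then if j == 0 then a else b else if j == 0 then c else d)%:R.

Lemma mqK q : q \in quads -> ent (mq q) = q.
Proof.
move: q => [[[a b] c] d]; rewrite !mem_pairs !mem_iota /= => /andP[/andP[/andP[ha hb] hc] hd].
by rewrite /ent !mxE /= !natF !modn_small.
Qed.

Definition code M : seq nat := [seq act M n | n <- iota 0 8].
Definition codeq q : seq nat := [seq actq q n | n <- iota 0 8].

Lemma codeE M : code M = codeq (ent M).
Proof. by apply: eq_map => n; apply: actqE. Qed.

Definition pcomp (c c' : seq nat) : seq nat := [seq nth 0%N c i | i <- c'].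

Lemma act_lt M n : (act M n < 8)%N.
Proof. exact: pt_lt. Qed.

Lemma nth_code M n : (n < 8)%N -> nth 0%N (code M) n = act M n.
Proof. by move=> n8; rewrite (nth_map 0%N) ?size_iota // nth_iota. Qed.

Lemma code_mul M N : \det N != 0 -> code (M *m N) = pcomp (code M) (code N).
Proof.
move=> dN; rewrite /pcomp /code -map_comp; apply/eq_in_map => n _ /=.
by rewrite act_mul // -/(code M) nth_code // act_lt.
Qed.

(** The permutations of the projective line induced by matrices of determinant one. *)
Definition tabC : seq (seq nat) :=
  Eval vm_compute in undup [seq codeq q | q <- quads & det1q q].

Lemma tabCE : tabC = undup [seq codeq q | q <- quads & det1q q].
Proof. by vm_compute. Qed.

Lemma trivial_quads : all (fun q => det1q q && (codeq q == iota 0 8) ==>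
  (q \in [:: (1, 0, 0, 1); (6, 0, 0, 6)]%N)) quads.
Proof. by vm_compute. Qed.

Local Notation gT := (coset_of 'Z(SL 2 F7)).
Local Notation G := (PSL 2 F7).
Local Notation Z := ('Z(SL 2 F7))%g.

Lemma SL_norm u : u \in SL 2 F7 -> u \in 'N(Z)%g.
Proof. by apply/subsetP/normal_norm/center_normal. Qed.

Lemma SL_det u : u \in SL 2 F7 -> \det (GLval u) = 1.
Proof. by rewrite inE => /eqP. Qed.

(** The choice of a representative of the coset is harmless, by code_center. *)
Definition cod (x : gT) : seq nat := code (GLval (repr x)).

Definition slq (M : 'M[F7]_2) : {'GL_2[F7]} := insubd (1%g : {'GL_2[F7]}) M.

Lemma slqK M : \det M = 1 -> GLval (slq M) = M.
Proof.
by move=> d1; rewrite -[LHS]/(val _) insubdK // -topredE /= unitmxE d1 unitr1.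
Qed.

Lemma slq_SL M : \det M = 1 -> slq M \in SL 2 F7.
Proof. by move=> d1; rewrite inE slqK // d1. Qed.

Lemma scalar_center u (a : F7) : u \in SL 2 F7 -> GLval u = a%:M -> u \in Z.
Proof.
move=> uS ua; apply/centerP; split=> // v _; apply: val_inj.
by rewrite /= -[LHS]/(GLval u *m GLval v) -[RHS]/(GLval v *m GLval u) ua scalar_mxC.
Qed.

Lemma code1 : code 1%:M = iota 0 8.
Proof. by rewrite codeE /ent !mxE. Qed.

(** A central matrix commutes with the two elementary transvections, so that it is
    scalar, and it fixes every point of the projective line. *)
Lemma code_center u : u \in Z -> code (GLval u) = iota 0 8.
Proof.
case/centerP=> uS uC.
pose T : 'M[F7]_2 := mq (1, 1, 0, 1)%N; pose T' : 'M[F7]_2 := mq (1, 0, 1, 1)%N.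
have com M : \det M = 1 -> GLval u *m M = M *m GLval u.
  by move=> d1; have := uC _ (slq_SL d1) => /(congr1 GLval); rewrite !GL_MxE !slqK.
have dT : \det T = 1 by apply/eqP; rewrite det1qE mqK.
have dT' : \det T' = 1 by apply/eqP; rewrite det1qE mqK.
have /matrixP ET := com _ dT; have /matrixP ET' := com _ dT'.
set U := GLval u in ET ET' *.
have c0 : U e1 e0 = 0.
  by have := ET e0 e0; rewrite !mulmx2 !mxE /= !(mulr1, mulr0, mul1r, mul0r, addr0) => /eqP; rewrite -subr_eq0 opprD addrA subrr sub0r oppr_eq0 => /eqP.
have b0 : U e0 e1 = 0.
  by have := ET' e0 e0; rewrite !mulmx2 !mxE /= !(mulr1, mulr0, mul1r, mul0r, addr0) => /eqP; rewrite addrC -subr_eq0 addrK => /eqP.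
have ad : U e0 e0 = U e1 e1.
  by have := ET e0 e1; rewrite !mulmx2 !mxE /= !(mulr1, mulr0, mul1r, mul0r, addr0) b0 addr0 add0r.
have a0 : U e0 e0 != 0.
  apply/negP=> /eqP a0; have := SL_det uS; rewrite det2 -/U a0 b0 !mul0r subr0 => /eqP.
  by rewrite eq_sym oner_eq0.
rewrite -code1; apply: eq_map => n; rewrite /act b0 c0 -ad !mul0r !add0r !addr0 pt_scale //.
by rewrite !mxE /= !(mulr1, mulr0, mul1r, mul0r, addr0, add0r).
Qed.

Lemma comp_iota c : all (fun n => n < 8)%N c -> pcomp (iota 0 8) c = c.
Proof.
move=> /allP c8; rewrite -[RHS]map_id; apply/eq_in_map => n /c8 n8.
by rewrite nth_iota.
Qed.

Lemma code_lt M : all (fun n => n < 8)%N (code M).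
Proof. by rewrite all_map; apply/allP=> n _ /=; apply: act_lt. Qed.

Lemma cod_coset u : u \in SL 2 F7 -> cod (coset Z u) = code (GLval u).
Proof.
move=> uS; rewrite /cod; have := mem_repr_coset (coset Z u).
rewrite val_coset ?SL_norm // => /rcosetP[z zZ ->].
rewrite GL_MxE code_mul ?SL_det ?oner_eq0 // code_center // comp_iota //.
exact: code_lt.
Qed.

Lemma GP x : x \in G -> exists2 u, u \in SL 2 F7 & x = coset Z u.
Proof. by move=> /morphimP[u _ uS ->]; exists u. Qed.

Lemma coset_G u : u \in SL 2 F7 -> coset Z u \in G.
Proof. by move=> uS; apply: mem_quotient. Qed.

Lemma cod_mul x y : x \in G -> y \in G -> cod (x * y)%g = pcomp (cod x) (cod y).
Proof.
move=> /GP[u uS ->] /GP[v vS ->]; rewrite -morphM ?SL_norm //.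
by rewrite !cod_coset ?groupM // GL_MxE code_mul // SL_det ?oner_eq0.
Qed.

Lemma cod1 : cod 1%g = iota 0 8.
Proof. by rewrite -(morph1 (coset_morphism Z)) cod_coset ?group1 // code1. Qed.

Lemma cod_tab x : x \in G -> cod x \in tabC.
Proof.
move=> /GP[u uS ->]; rewrite cod_coset // tabCE mem_undup; apply/mapP.
exists (ent (GLval u)); last by rewrite codeE.
by rewrite mem_filter ent_quads andbT -det1qE SL_det.
Qed.

Lemma tab_cod c : c \in tabC -> exists2 x, x \in G & cod x = c.
Proof.
rewrite tabCE mem_undup => /mapP[q + ->]; rewrite mem_filter => /andP[dq qq].
have d1 : \det (mq q) = 1 by apply/eqP; rewrite det1qE mqK.
have qS := slq_SL d1; exists (coset Z (slq (mq q))); first exact: coset_G.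
by rewrite cod_coset // slqK // codeE mqK.
Qed.

(** The matrices of determinant one which induce the identity are 1 and 6, by
    enumeration, and these are scalar. *)
Lemma cod_eq1 x : x \in G -> cod x = iota 0 8 -> x = 1%g.
Proof.
move=> /GP[u uS ->]; rewrite cod_coset // => cu; apply: coset_id.
have := allP trivial_quads _ (ent_quads (GLval u)).
rewrite -det1qE SL_det // eqxx -codeE cu eqxx /= => uq.
have [a uE] : exists a : F7, GLval u = a%:M.
  have ent_mx (q : quad) : ent (GLval u) = q -> GLval u = mq q.
    move=> <-; apply/matrixP=> i j; rewrite mxE.
    by case: i j => [[|[|//]] ?] [[|[|//]] ?] /=; rewrite natr_val; congr (GLval u _ _); apply: val_inj.
  move: uq; rewrite !inE => /orP[]/eqP/ent_mx->; [exists 1 | exists 6%:R];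
    by apply/matrixP=> -[[|[|//]] ?] [[|[|//]] ?]; rewrite !mxE /=.
exact: scalar_center uE.
Qed.

Lemma cod_inj x y : x \in G -> y \in G -> cod x = cod y -> x = y.
Proof.
move=> xG yG xy; apply/eqP; rewrite eq_sym eq_mulVg1; apply/eqP/cod_eq1.
  by rewrite groupM ?groupV.
by rewrite cod_mul ?groupV // xy -cod_mul ?groupV // mulVg cod1.
Qed.

End ProjectiveLine.

Local Open Scope nat_scope.
(** * The Fano plane *)

(** The residues 1, 2, 4 and the non-residues 3, 5, 6 are difference sets modulo 7.
    The set of a translate of one of them and infinity is one half of the eight
    points; each family of seven partitions into two halves is permuted by
    PSL(2,7). These are the two actions on seven objects, points and lines. *)
Definition blk (D : seq nat) i x := (x == 7) || (x \in [seq (i + e) %% 7 | e <- D]).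
Definition eqv D i x y := blk D i x == blk D i y.
(** The permutation c takes the i-th partition to the j-th one. *)
Definition mv D (c : seq nat) i j :=
  all (fun x => eqv D i 7 x == eqv D j (nth 0 c 7) (nth 0 c x)) (iota 0 8).
Definition ind D (c : seq nat) i := find (mv D c i) (iota 0 7).
Definition indl D (c : seq nat) := [seq ind D c i | i <- iota 0 7].

Definition DA := [:: 1; 2; 4].
Definition DB := [:: 3; 5; 6].

Lemma ind_ok : all (fun D => all (fun c => all (fun i => has (mv D c i) (iota 0 7)) (iota 0 7)) tabC) [:: DA; DB].
Proof. by vm_compute. Qed.

Lemma eqv_inj : all (fun D => all (fun j => all (fun k =>
  all (fun x => all (fun y => eqv D j x y == eqv D k x y) (iota 0 8)) (iota 0 8) ==> (j == k))
  (iota 0 7)) (iota 0 7)) [:: DA; DB].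
Proof. by vm_compute. Qed.

Lemma tabC_perm : all (fun c => perm_eq c (iota 0 8)) tabC.
Proof. by vm_compute. Qed.

Notation perms := (seq nat * seq nat * seq nat)%type.
Definition trip (c : seq nat) : perms := (indl DA c, indl DB c, c).
Definition tab : seq perms := Eval vm_compute in map trip tabC.
Lemma tabE : tab = map trip tabC.
Proof. by vm_compute. Qed.
Lemma size_tab : size tab = 168.
Proof. by vm_compute. Qed.

Definition cmpl (c c' : seq nat) : seq nat := [seq nth 0 c i | i <- c'].
Definition tcomp (t t' : perms) : perms :=
  (cmpl t.1.1 t'.1.1, cmpl t.1.2 t'.1.2, cmpl t.2 t'.2).
Definition gA (t : perms) i := nth 0 t.1.1 i.
Definition gB (t : perms) i := nth 0 t.1.2 i.
Definition gC (t : perms) i := nth 0 t.2 i.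
Definition fixA t := [seq i <- iota 0 7 | gA t i == i].
Definition fixB t := [seq i <- iota 0 7 | gB t i == i].
Definition fixC t := [seq i <- iota 0 8 | gC t i == i].
Definition t1 : perms := (iota 0 7, iota 0 7, iota 0 8).
(** Point i is on line k when k - i is a residue modulo 7; the addition of 7 keeps
    the truncated subtraction exact. *)
Definition inc i k := (k + 7 - i) %% 7 \in [:: 1; 2; 4].
(** An element which fixes no point of the plane has order 7. *)
Definition kd7 t := fixA t == [::].

Lemma tab_wf : all (fun t : perms => [&& size t.1.1 == 7, size t.1.2 == 7, size t.2 == 8,
  all (fun i => i < 7) t.1.1, all (fun i => i < 7) t.1.2 & all (fun i => i < 8) t.2]) tab.
Proof. by vm_compute. Qed.

Lemma tab_uniq : uniq tab.
Proof. by vm_compute. Qed.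

Lemma tab_inc : all (fun t => all (fun i => all (fun k => inc i k == inc (gA t i) (gB t k))
  (iota 0 7)) (iota 0 7)) tab.
Proof. by vm_compute. Qed.

(** Booleans are read as indices: line 0 is not incident with point 0, and line 1
    is. So the incident pairs form one orbit and the other pairs another one. *)
Lemma tab_flag : all (fun j => all (fun l =>
  has (fun t => (gA t 0 == j) && (gB t (inc j l) == l)) tab) (iota 0 7)) (iota 0 7).
Proof. by vm_compute. Qed.

Definition ipat i1 i2 k1 k2 := (inc i1 k1, inc i1 k2, inc i2 k1, inc i2 k2).
Definition quadruples := [seq q <- pairs (pairs (pairs (iota 0 7) (iota 0 7)) (iota 0 7)) (iota 0 7) |
  let: (i1, i2, k1, k2) := q in (i1 != i2) && (k1 != k2)].
Definition qpat (q : nat * nat * nat * nat) := let: (i1, i2, k1, k2) := q in ipat i1 i2 k1 k2.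
(** One quadruple of two points and two lines for each pattern of incidences which
    occurs. *)
Definition qreps : seq (nat * nat * nat * nat) :=
  Eval vm_compute in [seq nth (0,0,0,0) quadruples (index p (map qpat quadruples)) | p <- undup (map qpat quadruples)].

Lemma tab_quadruple : all (fun q => has (fun q0 => (qpat q0 == qpat q) &&
   let: (i1, i2, k1, k2) := q0 in
   has (fun t => (gA t i1, gA t i2, gB t k1, gB t k2) == q) tab) qreps) quadruples.
Proof. by vm_compute. Qed.

Lemma qreps_pat : uniq (map qpat qreps).
Proof. by vm_compute. Qed.

Definition mask i1 i2 i3 := [seq (inc i1 k, inc i2 k, inc i3 k) | k <- iota 0 7].
Definition bools3 := pairs (pairs [:: true; false] [:: true; false]) [:: true; false].
(** The set of incidence patterns that lines have with three given points, as a
    list of eight booleans. *)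
Definition nmask i1 i2 i3 := [seq p \in mask i1 i2 i3 | p <- bools3].
Definition nmasks : seq (seq bool) := Eval vm_compute in undup
  [seq nmask p.1.1 p.1.2 p.2 | p <- pairs (pairs (iota 0 7) (iota 0 7)) (iota 0 7)].

Lemma nmasks_all : all (fun p => nmask p.1.1 p.1.2 p.2 \in nmasks) (pairs (pairs (iota 0 7) (iota 0 7)) (iota 0 7)).
Proof. by vm_compute. Qed.

Lemma nmasks_meet : all (fun m => all (fun m' => has (fun n => nth false m n && nth false m' n) (iota 0 8)) nmasks) nmasks.
Proof. by vm_compute. Qed.

Lemma pat_exists : all (fun k1 => all (fun k2 => has (fun i => inc i k1 && inc i k2) (iota 0 7) &&
   has (fun i => ~~ inc i k1 && ~~ inc i k2) (iota 0 7)) (iota 0 7)) (iota 0 7).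
Proof. by vm_compute. Qed.

Lemma pat_exists' : all (fun i1 => all (fun i2 => has (fun k => inc i1 k && inc i2 k) (iota 0 7) &&
   has (fun k => ~~ inc i1 k && ~~ inc i2 k) (iota 0 7)) (iota 0 7)) (iota 0 7).
Proof. by vm_compute. Qed.

Lemma tab_order2 : all (fun t => (t != t1) && (tcomp t t == t1) ==>
  [&& size (fixA t) == 3, size (fixB t) == 3 & size (fixC t) == 0]) tab.
Proof. by vm_compute. Qed.

Lemma tab_order3 : all (fun t => (t != t1) && (tcomp t (tcomp t t) == t1) ==>
  [&& size (fixA t) == 1, size (fixB t) == 1 & size (fixC t) == 2]) tab.
Proof. by vm_compute. Qed.

Definition ord2 t := (t != t1) && (tcomp t t == t1).
Definition ord3 t := (t != t1) && (tcomp t (tcomp t t) == t1).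

Lemma count_ord2 : count ord2 tab = 21.
Proof. by vm_compute. Qed.

Lemma count_ord3 : count ord3 tab = 56.
Proof. by vm_compute. Qed.

Lemma tab_kinds : all (fun t => [|| t == t1, ord2 t, ord3 t, kd7 t |
  [&& size (fixA t) == 1, size (fixB t) == 1 & size (fixC t) == 0]]) tab.
Proof. by vm_compute. Qed.

Lemma tab_fixB : all (fun t => (size (fixA t) == 1) ==> (size (fixB t) == 1)) tab.
Proof. by vm_compute. Qed.

Lemma count_A : all (fun i => all (fun j => count (fun t => gA t i == j) tab == 24) (iota 0 7)) (iota 0 7).
Proof. by vm_compute. Qed.
Lemma count_B : all (fun i => all (fun j => count (fun t => gB t i == j) tab == 24) (iota 0 7)) (iota 0 7).
Proof. by vm_compute. Qed.
Lemma count_C : all (fun i => all (fun j => count (fun t => gC t i == j) tab == 21) (iota 0 8)) (iota 0 8).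
Proof. by vm_compute. Qed.

Lemma stab_A_A : all (fun i => all (fun k => (i == k) || has (fun t => (gA t i == i) && (gA t k != k)) tab) (iota 0 7)) (iota 0 7).
Proof. by vm_compute. Qed.
Lemma stab_B_B : all (fun i => all (fun k => (i == k) || has (fun t => (gB t i == i) && (gB t k != k)) tab) (iota 0 7)) (iota 0 7).
Proof. by vm_compute. Qed.
Lemma stab_C_C : all (fun i => all (fun k => (i == k) || has (fun t => (gC t i == i) && (gC t k != k)) tab) (iota 0 8)) (iota 0 8).
Proof. by vm_compute. Qed.
Lemma stab_A_B : all (fun i => all (fun k => has (fun t => (gA t i == i) && (gB t k != k)) tab) (iota 0 7)) (iota 0 7).
Proof. by vm_compute. Qed.

Lemma kd7_fixC : all (fun t => kd7 t ==> (size (fixC t) == 1) && (fixB t == [::])) tab.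
Proof. by vm_compute. Qed.

Definition tpow t n := iter n (tcomp t) t1.

(** The powers of an element of order 7 are transitive on the points of the
    projective line which it moves. *)
Lemma kd7_trans : all (fun t => kd7 t ==> all (fun c => all (fun c' =>
  [|| gC t c == c, gC t c' == c' | has (fun n => gC (tpow t n) c == c') (iota 0 7)])
  (iota 0 8)) (iota 0 8)) tab.
Proof. by vm_compute. Qed.

Lemma kd7_pow : all (fun t => kd7 t ==> all (fun t' => kd7 t' && (fixC t == fixC t') ==>
  has (fun n => tpow t n == t') (iota 0 7)) tab) tab.
Proof. by vm_compute. Qed.

(** Every element is a product of two elements of order 7. *)
Lemma kd7_prod : all (fun t => has (fun h => kd7 h && kd7 (tcomp (tpow h 6) t)) tab) tab.
Proof. by vm_compute. Qed.

(** If t has one fixed point and one fixed line and t' moves both, some short word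
    in t and t' has order 7. *)
Lemma pair_check : all (fun t => (size (fixA t) == 1) ==> all (fun t' =>
  [|| kd7 t', has (fun i => gA t' i == i) (fixA t), has (fun i => gB t' i == i) (fixB t),
      kd7 (tcomp t t'), kd7 (tcomp (tcomp t t) t') |
      kd7 (tcomp (tcomp t t') (tcomp (tcomp t t) (tcomp t' t')))]) tab) tab.
Proof. by vm_compute. Qed.

(** If t and t' have order 3 and generate different subgroups, then the product of
    t or of its square with t' is not of order 1 or 3. *)
Lemma order3_check : all (fun t => ord3 t ==> all (fun t' => ord3 t' ==>
  [|| t' == t, t' == tcomp t t, ~~ ((tcomp t t' == t1) || ord3 (tcomp t t')) |
      ~~ ((tcomp (tcomp t t) t' == t1) || ord3 (tcomp (tcomp t t) t'))]) tab) tab.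
Proof. by vm_compute. Qed.

Definition tab2 := [seq t <- tab | ord2 t].
Definition klein_ok t t' (f : seq nat) (g : perms -> nat -> nat) :=
  (size f == 1) && all (fun t'' => all (fun i => g t'' i == i) f)
    [seq t'' <- tab2 | ord2 (tcomp t t'') && ord2 (tcomp t' t'')].

(** Two commuting involutions have a unique common fixed point which is also fixed
    by every involution with the right products, or the same holds for lines. *)
Lemma involutions_check : all (fun t => all (fun t' =>
    let fA := [seq i <- fixA t | gA t' i == i] in let fB := [seq i <- fixB t | gB t' i == i] in
    klein_ok t t' fA gA || klein_ok t t' fB gB)
  [seq t' <- tab2 | ord2 (tcomp t t')]) tab2.
Proof. by vm_compute. Qed.

(** The inverse of w is its square: every element of the stabiliser of c is a product
    of two elements of order 3 of the stabiliser. *)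
Lemma borel_check : all (fun c => all (fun t => (gC t c == c) ==>
  has (fun w => [&& gC w c == c, ord3 w & ord3 (tcomp (tcomp w w) t)]) tab) tab) (iota 0 8).
Proof. by vm_compute. Qed.

Local Open Scope group_scope.

(** * Elements as triples of permutations *)

Section Embedding.
Local Notation gT := (coset_of 'Z(SL 2 'F_7)).
Local Notation G := (PSL 2 'F_7).

Lemma allP_iota (P : pred nat) n i : all P (iota 0 n) -> (i < n)%N -> P i.
Proof. by move=> /allP h i_n; apply: h; rewrite mem_iota. Qed.

Lemma hasP_iota (P : pred nat) n : has P (iota 0 n) -> exists2 i, (i < n)%N & P i.
Proof. by case/hasP=> i; rewrite mem_iota; exists i. Qed.

Section Partition.
Variable D : seq nat.
Hypothesis DD : D \in [:: DA; DB].

Lemma mvP c i j : mv D c i j ->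
  forall x y, (x < 8)%N -> (y < 8)%N -> eqv D i x y = eqv D j (nth 0%N c x) (nth 0%N c y).
Proof.
move=> m x y x8 y8; have := eqP (allP_iota m x8); have := eqP (allP_iota m y8).
by rewrite /eqv; do 6!case: (blk _ _ _).
Qed.

Lemma ind_mv c i : c \in tabC -> (i < 7)%N -> mv D c i (ind D c i) /\ (ind D c i < 7)%N.
Proof.
move=> cT i7; have h := allP_iota (allP (allP ind_ok D DD) c cT) i7; split.
  have := nth_find 0%N h; rewrite nth_iota ?add0n //.
  by have := h; rewrite has_find size_iota.
by have := h; rewrite has_find size_iota.
Qed.

Lemma nth_tabC c x : c \in tabC -> (x < 8)%N -> (nth 0%N c x < 8)%N.
Proof.
move=> cT x8; have p := allP tabC_perm c cT.
have : nth 0%N c x \in c by rewrite mem_nth // (perm_size p) size_iota.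
by rewrite (perm_mem p) mem_iota.
Qed.

(** Partitions are determined by their equivalence relations, so that the index of
    the image is functorial. *)
Lemma ind_comp c c' i : c \in tabC -> c' \in tabC -> pcomp c c' \in tabC -> (i < 7)%N ->
  ind D (pcomp c c') i = ind D c (ind D c' i).
Proof.
move=> cT c'T ccT i7.
have [m1 j7] := ind_mv c'T i7; have [m2 k7] := ind_mv cT j7; have [m3 l7] := ind_mv ccT i7.
apply/eqP; apply: (implyP (allP_iota (allP_iota (allP eqv_inj D DD) l7) k7)).
have sz : size c' = 8 by rewrite (perm_size (allP tabC_perm c' c'T)).
have szcc : size (pcomp c c') = 8 by rewrite size_map.
have surj x : (x < 8)%N -> exists2 y, (y < 8)%N & nth 0%N (pcomp c c') y = x.
  move=> x8; have : x \in pcomp c c' by rewrite (perm_mem (allP tabC_perm _ ccT)) mem_iota.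
  by move/(nthP 0%N) => [y]; rewrite szcc; exists y.
apply/allP=> x; rewrite mem_iota => /andP[_ /surj[x' x'8 <-]].
apply/allP=> y; rewrite mem_iota => /andP[_ /surj[y' y'8 <-]].
rewrite -(mvP m3) // (mvP m1) // (mvP m2) ?nth_tabC //.
by rewrite !(nth_map 0%N) ?sz.
Qed.

End Partition.

Definition tr (x : gT) : perms := trip (cod x).

Lemma tr_tab x : x \in G -> tr x \in tab.
Proof. by move=> xG; rewrite tabE (map_f trip (cod_tab xG)). Qed.

Lemma tab_tr t : t \in tab -> exists2 x, x \in G & tr x = t.
Proof. by rewrite tabE => /mapP[c /tab_cod[x xG <-] ->]; exists x. Qed.

Lemma trip_inj : injective trip.
Proof. by move=> c c' /(congr1 snd). Qed.

Lemma tr_inj : {in G &, injective tr}.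
Proof. by move=> x y xG yG /trip_inj; apply: cod_inj. Qed.

Lemma gA_ind x i : (i < 7)%N -> gA (tr x) i = ind DA (cod x) i.
Proof. by move=> i7; rewrite /gA /= (nth_map 0%N) ?size_iota // nth_iota. Qed.

Lemma gB_ind x i : (i < 7)%N -> gB (tr x) i = ind DB (cod x) i.
Proof. by move=> i7; rewrite /gB /= (nth_map 0%N) ?size_iota // nth_iota. Qed.

Lemma tr_mul x y : x \in G -> y \in G -> tr (x * y) = tcomp (tr x) (tr y).
Proof.
move=> xG yG; have xyT : pcomp (cod x) (cod y) \in tabC.
  by rewrite -cod_mul // cod_tab // groupM.
rewrite /tr cod_mul //; congr (_, _, _).
  rewrite /cmpl -map_comp; apply/eq_in_map => i; rewrite mem_iota => /andP[_ i7].
  change (ind DA (pcomp (cod x) (cod y)) i = gA (tr x) (ind DA (cod y) i)); rewrite gA_ind ?ind_comp ?cod_tab //.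
  by case: (@ind_mv DA _ (cod y) i) => //; apply: cod_tab.
rewrite /cmpl -map_comp; apply/eq_in_map => i; rewrite mem_iota => /andP[_ i7].
change (ind DB (pcomp (cod x) (cod y)) i = gB (tr x) (ind DB (cod y) i)); rewrite gB_ind ?ind_comp ?cod_tab //.
by case: (@ind_mv DB _ (cod y) i) => //; apply: cod_tab.
Qed.

Lemma tr1 : tr 1 = t1.
Proof. by rewrite /tr cod1; vm_compute. Qed.

End Embedding.

(** * Proper subgroups *)

(** The map tr embeds the abstract group G in the triples of permutations, with
    image the list tab. *)
Section Model.
Variables (gT : finGroupType) (G : {group gT}) (tr : gT -> perms).
Hypothesis tr_tab : forall x, x \in G -> tr x \in tab.
Hypothesis tab_tr : forall t, t \in tab -> exists2 x, x \in G & tr x = t.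
Hypothesis tr_inj : {in G &, injective tr}.
Hypothesis tr_mul : forall x y, x \in G -> y \in G -> tr (x * y) = tcomp (tr x) (tr y).
Hypothesis tr_1 : tr 1 = t1.
Implicit Types (x y z : gT) (H : {group gT}).

Lemma tr_all (P : perms -> bool) x : all P tab -> x \in G -> P (tr x).
Proof. by move=> /allP h /tr_tab/h. Qed.

Lemma tr_has (P : perms -> bool) : has P tab -> exists2 x, x \in G & P (tr x).
Proof. by case/hasP=> t /tab_tr[x xG <-] Pt; exists x. Qed.

Lemma tr_wf x : x \in G ->
  [/\ size (tr x).1.1 = 7, size (tr x).1.2 = 7, size (tr x).2 = 8 &
   [/\ forall i, (i < 7)%N -> (gA (tr x) i < 7)%N, forall i, (i < 7)%N -> (gB (tr x) i < 7)%N
     & forall i, (i < 8)%N -> (gC (tr x) i < 8)%N]].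
Proof.
move=> /(tr_all tab_wf)/and5P[/eqP sA /eqP sB /eqP sC /allP hA /andP[/allP hB /allP hC]].
split=> //; split=> i i7; [apply: hA | apply: hB | apply: hC]; apply: mem_nth;
  by rewrite ?sA ?sB ?sC.
Qed.

Lemma gAM x y i : x \in G -> y \in G -> (i < 7)%N -> gA (tr (x * y)) i = gA (tr x) (gA (tr y) i).
Proof. by move=> xG yG i7; rewrite tr_mul //; apply: nth_map; case: (tr_wf yG) => ->. Qed.

Lemma gBM x y i : x \in G -> y \in G -> (i < 7)%N -> gB (tr (x * y)) i = gB (tr x) (gB (tr y) i).
Proof. by move=> xG yG i7; rewrite tr_mul //; apply: nth_map; case: (tr_wf yG) => _ ->. Qed.

Lemma gCM x y i : x \in G -> y \in G -> (i < 8)%N -> gC (tr (x * y)) i = gC (tr x) (gC (tr y) i).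
Proof. by move=> xG yG i7; rewrite tr_mul //; apply: nth_map; case: (tr_wf yG) => _ _ ->. Qed.

Lemma gA1 i : (i < 7)%N -> gA (tr 1) i = i.
Proof. by move=> i7; rewrite tr_1 /gA nth_iota. Qed.

Lemma gB1 i : (i < 7)%N -> gB (tr 1) i = i.
Proof. by move=> i7; rewrite tr_1 /gB nth_iota. Qed.

Lemma gC1 i : (i < 8)%N -> gC (tr 1) i = i.
Proof. by move=> i7; rewrite tr_1 /gC nth_iota. Qed.

Lemma tr_eq1 x : x \in G -> (tr x == t1) = (x == 1).
Proof.
move=> xG; rewrite -tr_1; apply/eqP/eqP => [|->//].
by apply: tr_inj => //; apply: group1.
Qed.

Lemma tr_pow x n : x \in G -> tr (x ^+ n) = tpow (tr x) n.
Proof.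
move=> xG; elim: n => [|n IHn]; first by rewrite expg0 tr_1.
by rewrite expgS tr_mul ?groupX // IHn.
Qed.

Lemma card_tr (P : perms -> bool) : #|[set x in G | P (tr x)]| = count P tab.
Proof.
rewrite cardE -[LHS](size_map tr) -size_filter; apply/perm_size/uniq_perm.
- rewrite map_inj_in_uniq; first exact: enum_uniq.
  move=> x y.
  by rewrite !mem_enum => /setIdP[xG _] /setIdP[yG _]; apply: tr_inj.
- exact/filter_uniq/tab_uniq.
move=> t; rewrite mem_filter; apply/mapP/andP => [[x]|[Pt /tab_tr[x xG xt]]].
  by rewrite mem_enum => /setIdP[xG Px] ->; split; last exact: tr_tab.
by exists x; last by []; rewrite mem_enum; apply/setIdP; rewrite xt.
Qed.

Lemma card_G : #|G| = 168.
Proof.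
have := card_tr predT; rewrite count_predT size_tab => <-.
by apply: eq_card => x; rewrite inE andbT.
Qed.

Lemma mem_fixA x i : x \in G -> (i \in fixA (tr x)) = (i < 7)%N && (gA (tr x) i == i).
Proof. by move=> xG; rewrite mem_filter mem_iota andbC. Qed.

Lemma mem_fixB x i : x \in G -> (i \in fixB (tr x)) = (i < 7)%N && (gB (tr x) i == i).
Proof. by move=> xG; rewrite mem_filter mem_iota andbC. Qed.

Lemma mem_fixC x i : x \in G -> (i \in fixC (tr x)) = (i < 8)%N && (gC (tr x) i == i).
Proof. by move=> xG; rewrite mem_filter mem_iota andbC. Qed.

(** FA, FB and FC say that H fixes a given point, line, or point of the projective
    line. *)
Definition FA H i := [forall x in H, gA (tr x) i == i].
Definition FB H i := [forall x in H, gB (tr x) i == i].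
Definition FC H i := [forall x in H, gC (tr x) i == i].

Definition uniqA H := exists2 i, (i < 7)%N & FA H i /\ forall i', (i' < 7)%N -> FA H i' -> i' = i.
Definition uniqB H := exists2 i, (i < 7)%N & FB H i /\ forall i', (i' < 7)%N -> FB H i' -> i' = i.
Definition uniqC H := exists2 i, (i < 8)%N & FC H i /\ forall i', (i' < 8)%N -> FC H i' -> i' = i.
Definition noA H := forall i, (i < 7)%N -> ~~ FA H i.
Definition noB H := forall i, (i < 7)%N -> ~~ FB H i.
Definition noC H := forall i, (i < 8)%N -> ~~ FC H i.

Lemma size1P (s : seq nat) : size s == 1%N -> exists i, s = [:: i].
Proof. by case: s => [|i [|? ?]] //; exists i. Qed.

Lemma kd7P x i : x \in G -> kd7 (tr x) -> (i < 7)%N -> gA (tr x) i != i.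
Proof.
move=> xG /eqP k7 i7; apply/negP=> xi; have := mem_fixA i xG.
by rewrite k7 i7 xi.
Qed.

Lemma noC_fix H x : H \subset G -> x \in H -> size (fixC (tr x)) == 0 -> noC H.
Proof.
move=> HG xH s0 i i8; apply/negP=> /forall_inP/(_ x xH) xi.
have := mem_fixC i (subsetP HG _ xH); rewrite i8 xi.
by rewrite (size0nil (eqP s0)).
Qed.

(** Let h in H have order 7 and fixed point c. If H moved c, then, h being transitive
    on the other points, conjugation in H would give elements of order 7 fixing
    any given point, hence all elements of order 7 by kd7_pow; they generate G
    by kd7_prod. *)
Lemma subgroup_kd7 H h : H \proper G -> h \in H -> kd7 (tr h) -> [/\ noA H, noB H & uniqC H].
Proof.
case/andP=> HG GH hH k7; have inG x : x \in H -> x \in G by apply: subsetP.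
have hG := inG h hH; have /andP[sC sB] := implyP (tr_all kd7_fixC hG) k7.
have [c cE] := size1P sC.
have [c8 hc] : (c < 8)%N /\ gC (tr h) c = c.
  by have := mem_fixC c hG; rewrite cE mem_head => /esym/andP[? /eqP].
split.
- by move=> i i7; apply/negP=> /forall_inP/(_ h hH); rewrite (negPf (kd7P hG k7 i7)).
- move=> i i7; apply/negP=> /forall_inP/(_ h hH) hi.
  by have := mem_fixB i hG; rewrite (eqP sB) i7 hi.
exists c => //; split; last first.
  move=> c' c'8 /forall_inP/(_ h hH) hc'.
  by have := mem_fixC c' hG; rewrite cE c'8 hc' inE => /eqP.
apply/forall_inP=> y yH; apply: contraT => yc; case/negP: GH.
have yG := inG y yH; have yc8 : (gC (tr y) c < 8)%N by have [_ _ _ [_ _]] := tr_wf yG; apply.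
have all7 h' : h' \in G -> kd7 (tr h') -> h' \in H.
  move=> h'G k7'; have /andP[sC' _] := implyP (tr_all kd7_fixC h'G) k7'.
  have [c' c'E] := size1P sC'.
  have [c'8 h'c'] : (c' < 8)%N /\ gC (tr h') c' = c'.
    by have := mem_fixC c' h'G; rewrite c'E mem_head => /esym/andP[? /eqP].
  (* Since h is transitive on the points other than c, H is transitive. *)
  have [k kH kc] : exists2 k, k \in H & gC (tr k) c = c'.
    have [cc'|cc'] := eqVneq c' c; first by exists 1; rewrite ?group1 // gC1.
    have := allP_iota (allP_iota (implyP (tr_all kd7_trans hG) k7) yc8) c'8.
    case/or3P=> [/eqP hyc|/eqP hc''|/hasP_iota[n _ /eqP hn]].
    - have := mem_fixC (gC (tr y) c) hG; rewrite yc8 hyc eqxx cE inE => /eqP E.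
      by rewrite E eqxx in yc.
    - have := mem_fixC c' hG; rewrite c'8 hc'' eqxx cE inE => /eqP E.
      by rewrite E eqxx in cc'.
    exists (h ^+ n * y); first by rewrite groupM ?groupX.
    by rewrite gCM ?groupX // tr_pow.
  have kG := inG k kH; pose h1 := k * h * k^-1.
  have h1H : h1 \in H by rewrite !groupM ?groupV.
  have h1G := inG _ h1H.
  have k71 : kd7 (tr h1).
    rewrite /kd7; case E: (fixA (tr h1)) => [//|i s].
    have := mem_fixA i h1G; rewrite E mem_head => /esym/andP[i7 /eqP h1i].
    have ki7 : (gA (tr k^-1) i < 7)%N by have [_ _ _ [+ _ _]] := tr_wf (groupVr kG); apply.
    case/eqP: (kd7P hG k7 ki7); rewrite -gAM ?groupV //.
    have -> : h * k^-1 = k^-1 * h1 by rewrite /h1 !mulgA mulVg mul1g.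
    by rewrite gAM ?groupV // h1i.
  have fC1 : fixC (tr h1) = [:: c'].
    have /andP[sC1 _] := implyP (tr_all kd7_fixC h1G) k71.
    have [d dE] := size1P sC1; have := mem_fixC c' h1G.
    have k'c : gC (tr k^-1) c' = c by rewrite -kc -gCM ?groupV // mulVg gC1.
    have h1c : gC (tr h1) c' = c' by rewrite /h1 gCM ?groupM ?groupV // k'c gCM // hc.
    by rewrite dE inE c'8 h1c eqxx => /eqP->.
  have := implyP (tr_all kd7_pow h1G) k71 => /allP/(_ _ (tr_tab h'G)).
  rewrite k7' fC1 c'E eqxx => /implyP/(_ isT)/hasP_iota[n _ /eqP].
  rewrite -tr_pow // => /tr_inj<- //; last by rewrite groupX.
  by rewrite groupX.
apply/subsetP=> g gG; have /tr_has[h1 h1G /andP[k1]] := tr_all kd7_prod gG.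
rewrite -tr_pow // -tr_mul ?groupX // => k2.
have h1H := all7 _ h1G k1; have := all7 _ _ k2; rewrite groupM ?groupX // => /(_ isT).
by rewrite groupMl ?groupX.
Qed.

(** If H has an element of order 7, the previous lemma applies. If it has an element
    x with one fixed point a and one fixed line b, then by pair_check each
    element of H fixes a or b, and a group is not the union of two proper
    subgroups; when moreover every element has a fixed point on the projective
    line, all are of order 1 or 3 and H is generated by x. Otherwise all
    elements are involutions, and if H has more than 3 elements it has two
    commuting ones, to which involutions_check applies. *)
Lemma subgroup_types H : H \proper G ->
  [\/ (#|H| <= 3)%N, noC H /\ (uniqA H \/ uniqB H) | [/\ noA H, noB H & uniqC H]].
Proof.
move=> HpG; have /andP[HG _] := HpG; have inG x : x \in H -> x \in G by apply: subsetP.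
have [/exists_inP[h hH k7]|/exists_inPn no7] := boolP [exists h in H, kd7 (tr h)].
  by constructor 3; apply: subgroup_kd7 hH k7.
have [/exists_inP[x xH s1]|/exists_inPn nos1] := boolP [exists x in H, size (fixA (tr x)) == 1%N].
  have xG := inG x xH; have s1B := implyP (tr_all tab_fixB xG) s1.
  have [a aE] := size1P s1; have [b bE] := size1P s1B.
  have [a7 xa] : (a < 7)%N /\ gA (tr x) a = a.
    by have := mem_fixA a xG; rewrite aE mem_head => /esym/andP[? /eqP].
  have [b7 xb] : (b < 7)%N /\ gB (tr x) b = b.
    by have := mem_fixB b xG; rewrite bE mem_head => /esym/andP[? /eqP].
  have pairs y : y \in H -> (gA (tr y) a == a) || (gB (tr y) b == b).
    move=> yH; have yG := inG y yH.
    have := implyP (tr_all pair_check xG) s1 => /allP/(_ _ (tr_tab yG)).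
    rewrite -!tr_mul ?groupM // aE bE /= !orbF !(negPf (no7 _ _)) ?groupM //=.
    by rewrite orbF.
  (* The group H is the union of its stabilisers of a and of b. *)
  have AB : uniqA H \/ uniqB H.
    have [/forall_inP Ha|/forall_inPn[y yH ya]] := boolP (FA H a).
      left; exists a => //; split; first exact/forall_inP.
      move=> i i7 /forall_inP/(_ x xH) xi; have := mem_fixA i xG.
      by rewrite aE i7 xi inE => /eqP.
    right; exists b => //; split; last first.
      move=> i i7 /forall_inP/(_ x xH) xi; have := mem_fixB i xG.
      by rewrite bE i7 xi inE => /eqP.
    apply/forall_inP=> z zH; apply: contraT => zb.
    have zG := inG z zH; have yG := inG y yH.
    have yb : gB (tr y) b = b by have := pairs y yH; rewrite (negPf ya) => /eqP.
    have za : gA (tr z) a = a by have := pairs z zH; rewrite (negPf zb) orbF => /eqP.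
    have := pairs (y * z) (groupM yH zH).
    rewrite gAM // gBM // za (negPf ya) /= => /eqP yzb; case/negP: zb.
    have zb7 : (gB (tr z) b < 7)%N by have [_ _ _ [_ + _]] := tr_wf zG; apply.
    rewrite -[X in X == _]gB1 // -(mulVg y) gBM ?groupV // yzb -{1}yb -gBM ?groupV // mulVg gB1 //.
  have [/exists_inP[y yH sC]|/exists_inPn noC0] := boolP [exists y in H, size (fixC (tr y)) == 0].
    by constructor 2; split=> //; apply: noC_fix sC.
  have kinds y : y \in H -> (tr y == t1) || ord3 (tr y).
    move=> yH; have yG := inG y yH; have := tr_all tab_kinds yG.
    rewrite (negPf (no7 y yH)) (negPf (noC0 y yH)) !andbF orbF.
    case/or4P=> [->//|o2|->|//]; rewrite ?orbT //.
    by have := implyP (tr_all tab_order2 yG) o2; rewrite (negPf (noC0 y yH)) !andbF.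
  have x1 : tr x != t1 by apply: contraTneq s1 => ->.
  have x3 : ord3 (tr x) by have := kinds x xH; rewrite (negPf x1).
  constructor 1; apply: (@leq_trans #|[set 1; x; x * x]|); last first.
    by rewrite setUC cardsU1 cards2 !inE; case: (~~ _); case: (_ != _).
  apply: subset_leq_card; apply/subsetP=> y yH; rewrite !inE -(tr_eq1 (inG y yH)).
  have [//|y1] := eqVneq (tr y) t1; have y3 : ord3 (tr y) by have := kinds y yH; rewrite (negPf y1).
  have := implyP (allP (implyP (tr_all order3_check xG) x3) _ (tr_tab (inG y yH))) y3.
  have yG := inG y yH.
  rewrite -!tr_mul ?groupM // !kinds ?groupM //= !orbF.
  by case/orP=> /eqP/tr_inj-> //; rewrite ?eqxx ?orbT ?groupM.
have [//|lt3] := leqP #|H| 3; first by constructor 1.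
have kinds y : y \in H -> (y == 1) || ord2 (tr y).
  move=> yH; have yG := inG y yH; have := tr_all tab_kinds yG.
  rewrite (negPf (no7 y yH)) (negPf (nos1 y yH)) /= orbF tr_eq1 //.
  case/or3P=> [->//|->|o3]; rewrite ?orbT //.
  by have := implyP (tr_all tab_order3 yG) o3; rewrite (negPf (nos1 y yH)).
(* Two distinct involutions x and y of H, whose product is an involution. *)
have [x xH x1] : exists2 x, x \in H & x != 1.
  by apply/trivgPn; rewrite -cardG_gt1; lia.
have [y yH /norP[y1 yx]] : exists2 y, y \in H & ~~ ((y == 1) || (y == x)).
  apply/exists_inP; apply: contraLR lt3; rewrite negb_exists_in => /forall_inP sub.
  rewrite -leqNgt; apply: (@leq_trans #|[set 1; x]|).
    apply: subset_leq_card; apply/subsetP=> z zH; rewrite !inE.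
    by have := sub z zH; rewrite negbK.
  by rewrite cards2; case: (_ == _).
have x2 : ord2 (tr x) by have := kinds x xH; rewrite (negPf x1).
have y2 : ord2 (tr y) by have := kinds y yH; rewrite (negPf y1).
have xG := inG x xH; have yG := inG y yH.
have sq z : z \in G -> ord2 (tr z) -> z * z = 1.
  by move=> zG /andP[_]; rewrite -tr_mul // tr_eq1 ?groupM // => /eqP.
have mul_ord2 z w : z \in H -> w \in H -> ord2 (tr z) -> w != z -> ord2 (tr (z * w)).
  move=> zH wH z2 wz; have := kinds (z * w) (groupM zH wH); case/predU1P=> // zw1.
  case/eqP: wz; rewrite -[w]mul1g -(sq z (inG z zH) z2) -mulgA zw1 mulg1 //.
have xy2 : ord2 (tr (x * y)) by apply: mul_ord2.
have xT : tr x \in tab2 by rewrite mem_filter x2 tr_tab.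
have yT : tr y \in [seq t' <- tab2 | ord2 (tcomp (tr x) t')].
  by rewrite !mem_filter -tr_mul // xy2 y2 tr_tab.
have third z : z \in H -> z != 1 -> z != x -> z != y ->
    tr z \in [seq t'' <- tab2 | ord2 (tcomp (tr x) t'') && ord2 (tcomp (tr y) t'')].
  move=> zH z1 zx zy; have zG := inG z zH.
  have z2 : ord2 (tr z) by have := kinds z zH; rewrite (negPf z1).
  by rewrite !mem_filter -!tr_mul // !mul_ord2 // z2 tr_tab.
have noC_H : noC H.
  by apply: (noC_fix HG xH); case/and3P: (implyP (tr_all tab_order2 xG) x2).
constructor 2; split=> //.
have := allP (allP involutions_check _ xT) _ yT; case/orP=> /andP[/size1P[i iE] /allP klein]; [left | right].
  have := mem_head i [::]; rewrite -iE mem_filter mem_fixA // => /and3P[/eqP yi i7 /eqP xi].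
  exists i => //; split.
    apply/forall_inP=> z zH; have [->|z1] := eqVneq z 1; first by rewrite gA1.
    have [->|zx] := eqVneq z x; first by rewrite xi.
    have [->|zy] := eqVneq z y; first by rewrite yi.
    by have := klein _ (third z zH z1 zx zy); rewrite iE /= andbT.
  move=> i' i'7 /forall_inP h; have : i' \in [:: i]; last by rewrite inE => /eqP.
  by rewrite -iE mem_filter mem_fixA // i'7 !h.
have := mem_head i [::]; rewrite -iE mem_filter mem_fixB // => /and3P[/eqP yi i7 /eqP xi].
exists i => //; split.
  apply/forall_inP=> z zH; have [->|z1] := eqVneq z 1; first by rewrite gB1.
  have [->|zx] := eqVneq z x; first by rewrite xi.
  have [->|zy] := eqVneq z y; first by rewrite yi.
  by have := klein _ (third z zH z1 zx zy); rewrite iE /= andbT.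
move=> i' i'7 /forall_inP h; have : i' \in [:: i]; last by rewrite inE => /eqP.
by rewrite -iE mem_filter mem_fixB // i'7 !h.
Qed.

(** * Cosets as vertices *)
Local Notation V := (coset_poset G).

Lemma vP (v : V) : exists x (H : {group gT}), [/\ x \in G, H \proper G & val v = x *: H].
Proof.
case: v => A /= /existsP[H /andP[HG /lcosetsP[x xG ->]]].
by exists x, H.
Qed.

Lemma proper_cosetP x H : x \in G -> H \proper G -> proper_coset G (x *: H).
Proof.
by move=> xG HG; apply/existsP; exists H; rewrite HG; apply/lcosetsP; exists x.
Qed.

Lemma one_proper : 1%G \proper G.
Proof. by rewrite properEcard sub1G cards1 card_G. Qed.

Definition v0 : V := CosetPoset (proper_cosetP (group1 G) one_proper).
Definition vtx (A : {set gT}) : V := insubd v0 A.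

Lemma val_vtx A : proper_coset G A -> val (vtx A) = A.
Proof. exact: insubdK. Qed.

Lemma vtx_val (v : V) : vtx (val v) = v.
Proof. exact: valKd. Qed.

Lemma v_sub (v : V) : val v \subset G.
Proof. by have [x [H [xG /proper_sub HG ->]]] := vP v; rewrite mul_subG ?sub1set. Qed.

Lemma v_coset (v : V) x : x \in val v -> exists2 H : {group gT}, H \proper G & val v = x *: H.
Proof.
have [y [H [yG HG ->]]] := vP v => xv; exists H => //.
by apply: lcoset_eqP; rewrite lcoset_sym.
Qed.

Lemma v_gt0 (v : V) : (0 < #|val v|)%N.
Proof. by have [x [H [xG HG ->]]] := vP v; rewrite card_lcoset. Qed.

Lemma card_dvd (u v : V) : val u \subset val v -> (#|val u| %| #|val v|)%N.
Proof.
move=> uv; have /card_gt0P[x xu] := v_gt0 u.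
have [H HG uE] := v_coset xu; have [K KG vE] := v_coset (subsetP uv x xu).
rewrite uE vE !card_lcoset cardSg //; apply/subsetP=> h hH.
have : x * h \in val v by rewrite (subsetP uv) // uE mem_lcoset mulKg.
by rewrite vE mem_lcoset mulKg.
Qed.

Lemma card_v (v : V) : (#|val v| %| 168)%N /\ (#|val v| < 168)%N.
Proof.
have [x [H [xG HG ->]]] := vP v; rewrite card_lcoset -card_G.
by rewrite cardSg ?proper_card ?proper_sub.
Qed.

Lemma singleton_coset x : x \in G -> proper_coset G [set x].
Proof. by move=> xG; rewrite -[[set x]]mulg1; apply: (proper_cosetP xG one_proper). Qed.

Definition cmp (u v : V) := (val u \proper val v) || (val v \proper val u).

(** One of the three actions on n objects, with stabilisers of order m. The set
    gset i j of the elements taking i to j is a coset of the stabiliser of i. *)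
Section Action.
Variables (g : perms -> nat -> nat) (n m : nat).
Hypothesis gM : forall x y i, x \in G -> y \in G -> (i < n)%N -> g (tr (x * y)) i = g (tr x) (g (tr y) i).
Hypothesis g1 : forall i, (i < n)%N -> g (tr 1) i = i.
Hypothesis g_lt : forall x i, x \in G -> (i < n)%N -> (g (tr x) i < n)%N.
Hypothesis g_count : all (fun i => all (fun j => count (fun t => g t i == j) tab == m) (iota 0 n)) (iota 0 n).
Hypothesis m_bound : (0 < m < 168)%N.
Hypothesis g_sep : all (fun i => all (fun k => (i == k) || has (fun t => (g t i == i) && (g t k != k)) tab) (iota 0 n)) (iota 0 n).

Definition fx H i := [forall x in H, g (tr x) i == i].
Definition gset i j : {set gT} := [set x in G | g (tr x) i == j].

Lemma gK x i : x \in G -> (i < n)%N -> g (tr x^-1) (g (tr x) i) = i.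
Proof. by move=> xG i_n; rewrite -gM ?groupV // mulVg g1. Qed.

Lemma card_gset i j : (i < n)%N -> (j < n)%N -> #|gset i j| = m.
Proof.
move=> i_n j_n; rewrite (card_tr (fun t => g t i == j)).
exact/eqP/(allP_iota (allP_iota g_count i_n) j_n).
Qed.

(** The second disjunct makes this a group for every natural number i. *)
Definition stab i := [set x in G | (g (tr x) i == i) || (n <= i)%N].

Lemma stab_group_set i : group_set (stab i).
Proof.
apply/group_setP; split=> [|x y]; rewrite !inE ?group1 /=.
  by case: leqP => // i_n; rewrite ?orbT // g1 ?eqxx.
case: leqP => i_n; rewrite ?orbT ?orbF; first by rewrite !andbT; apply: groupM.
move=> /andP[xG /eqP xi] /andP[yG /eqP yi]; rewrite groupM // gM //=.
by rewrite yi xi.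
Qed.
Canonical stab_group i := Group (stab_group_set i).

Lemma in_stab i x : (i < n)%N -> (x \in stab i) = (x \in G) && (g (tr x) i == i).
Proof. by move=> i_n; rewrite inE leqNgt i_n orbF. Qed.

Lemma card_stab i : (i < n)%N -> #|stab i| = m.
Proof.
move=> i_n; rewrite -(card_gset i_n i_n); congr #|pred_of_set _|.
by apply/setP=> x; rewrite in_stab // !inE.
Qed.

Lemma stab_proper i : (i < n)%N -> stab i \proper G.
Proof.
move=> i_n; rewrite properEcard card_G card_stab //; case/andP: m_bound => _ ->.
by rewrite andbT; apply/subsetP=> x; rewrite inE => /andP[].
Qed.

Lemma gset_lcoset x i : x \in G -> (i < n)%N -> gset i (g (tr x) i) = x *: stab i.
Proof.
move=> xG i_n; apply/setP=> y; rewrite mem_lcoset in_stab // inE.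
have [yG|yG] := boolP (y \in G); last first.
  rewrite /=; symmetry; apply/negbTE; apply: contra yG => /andP[h _].
  by rewrite -(mulKVg x y) groupM.
rewrite groupM ?groupV //= gM ?groupV //; apply/eqP/eqP => [->|E]; first exact: gK.
by rewrite -{2}E -gM ?g_lt ?groupV // mulgV g1 // g_lt.
Qed.

Lemma gset_ex i j : (i < n)%N -> (j < n)%N -> exists2 x, x \in G & g (tr x) i = j.
Proof.
move=> i_n j_n; have /card_gt0P[x] : (0 < #|gset i j|)%N by rewrite card_gset //; case/andP: m_bound.
by rewrite inE => /andP[xG /eqP]; exists x.
Qed.

Lemma gset_proper i j : (i < n)%N -> (j < n)%N -> proper_coset G (gset i j).
Proof.
move=> i_n j_n; have [x xG <-] := gset_ex i_n j_n; rewrite gset_lcoset //.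
exact: (@proper_cosetP x (stab_group i) xG (stab_proper i_n)).
Qed.

Lemma val_gset i j : (i < n)%N -> (j < n)%N -> val (vtx (gset i j)) = gset i j.
Proof. by move=> i_n j_n; apply/val_vtx/gset_proper. Qed.

Lemma fx_stab H i : H \subset G -> (i < n)%N -> fx H i = (H \subset stab i).
Proof.
move=> HG i_n; apply/forall_inP/subsetP => h x xH.
  by rewrite in_stab // (subsetP HG) // h.
by have := h x xH; rewrite in_stab // => /andP[].
Qed.

Lemma sub_gset x H i j : x \in G -> H \subset G -> (i < n)%N ->
  (x *: H \subset gset i j) = (g (tr x) i == j) && fx H i.
Proof.
move=> xG HG i_n; have [xij|xij] /= := eqVneq (g (tr x) i) j.
  by rewrite -xij gset_lcoset // fx_stab // sub_lcoset -lcosetM mulVg lcoset1.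
apply/negbTE; apply: contra xij => /subsetP/(_ x); rewrite mem_lcoset mulVg group1.
by move=> /(_ isT); rewrite inE => /andP[].
Qed.

Definition isg (v : V) := [exists i : 'I_n, exists j : 'I_n, val v == gset i j].

Lemma isgP v : reflect (exists i j, [/\ (i < n)%N, (j < n)%N & val v = gset i j]) (isg v).
Proof.
apply: (iffP existsP) => [[i /existsP[j /eqP ->]]|[i [j [i_n j_n vE]]]]; first by exists i, j.
by exists (Ordinal i_n); apply/existsP; exists (Ordinal j_n); apply/eqP.
Qed.

Lemma isg_gset i j : (i < n)%N -> (j < n)%N -> isg (vtx (gset i j)).
Proof. by move=> i_n j_n; apply/isgP; exists i, j; rewrite val_gset. Qed.

Lemma card_isg v : isg v -> #|val v| = m.
Proof. by case/isgP=> i [j [i_n j_n ->]]; apply: card_gset. Qed.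

Lemma gset_inj i j i' j' : (i < n)%N -> (j < n)%N -> (i' < n)%N -> (j' < n)%N ->
  gset i j = gset i' j' -> i = i' /\ j = j'.
Proof.
move=> i_n j_n i'_n j'_n E; have [x xG xi] := gset_ex i_n j_n.
have xi' : g (tr x) i' = j'.
  by have /setP/(_ x) := E; rewrite !inE xG xi eqxx => /esym/eqP.
have ii' : i = i'.
  apply/eqP; case/orP: (allP_iota (allP_iota g_sep i_n) i'_n) => // /tr_has[y yG /andP[/eqP yi /eqP yi']].
  have /setP/(_ (x * y)) := E; rewrite !inE groupM // !gM // yi xi eqxx /= => /esym/eqP E'.
  by case: yi'; rewrite -(gK xG (g_lt yG i'_n)) E' -xi' gK.
by split=> //; rewrite -xi -xi' ii'.
Qed.

(** The coset x H lies in gset i j exactly when x takes i to j and H fixes i. *)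
Lemma card_over x H (v : V) : x \in G -> H \subset G -> val v = x *: H ->
  #|[set w : V | isg w && (val v \subset val w)]| = #|[set i : 'I_n | fx H i]|.
Proof.
move=> xG HG vE; pose f (i : 'I_n) := vtx (gset i (g (tr x) i)).
have fE (i : 'I_n) : val (f i) = gset i (g (tr x) i) by rewrite val_gset ?g_lt.
have f_inj : injective f.
  by move=> i j /(congr1 val); rewrite !fE => /gset_inj[] //; rewrite ?g_lt // => /val_inj.
rewrite -(card_imset _ f_inj); apply: eq_card => w; rewrite inE.
apply/andP/imsetP => [[/isgP[i [j [i_n j_n wE]]]]|[i]].
  rewrite vE wE sub_gset // => /andP[/eqP xi Hi]; exists (Ordinal i_n); first by rewrite inE.
  by apply: val_inj; rewrite fE wE xi.
by rewrite inE => Hi ->; rewrite fE vE sub_gset // eqxx Hi isg_gset ?g_lt.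
Qed.

Lemma card_fx_cycle h : h \in G ->
  #|[set i : 'I_n | fx <[h]> i]| = size [seq i <- iota 0 n | g (tr h) i == i].
Proof.
move=> hG; rewrite size_filter -sum1_count -sum1_card.
have -> : iota 0 n = index_iota 0 n by rewrite /index_iota subn0.
rewrite big_mkord.
by apply: eq_bigl => i; rewrite inE fx_stab ?cycle_subG // in_stab // hG.
Qed.

End Action.

Implicit Types (a b c u v w t : V).

Lemma gA_lt x i : x \in G -> (i < 7)%N -> (gA (tr x) i < 7)%N.
Proof. by move=> /tr_wf[_ _ _ [+ _ _]]; apply. Qed.
Lemma gB_lt x i : x \in G -> (i < 7)%N -> (gB (tr x) i < 7)%N.
Proof. by move=> /tr_wf[_ _ _ [_ + _]]; apply. Qed.
Lemma gC_lt x i : x \in G -> (i < 8)%N -> (gC (tr x) i < 8)%N.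
Proof. by move=> /tr_wf[_ _ _ [_ _]]; apply. Qed.

Local Notation Aset := (gset gA).
Local Notation Bset := (gset gB).
Local Notation Cset := (gset gC).
(** The elements taking a point i to a point j form the coset va i j; similarly vb
    and vc for lines and for points of the projective line. *)
Definition va i j := vtx (Aset i j).
Definition vb i j := vtx (Bset i j).
Definition vc i j := vtx (Cset i j).
Definition isA := isg gA 7.
Definition isB := isg gB 7.
Definition isC := isg gC 8.

Lemma val_va i j : (i < 7)%N -> (j < 7)%N -> val (va i j) = Aset i j.
Proof. exact: (val_gset gAM gA1 gA_lt count_A). Qed.
Lemma val_vb i j : (i < 7)%N -> (j < 7)%N -> val (vb i j) = Bset i j.
Proof. exact: (val_gset gBM gB1 gB_lt count_B). Qed.
Lemma val_vc i j : (i < 8)%N -> (j < 8)%N -> val (vc i j) = Cset i j.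
Proof. exact: (val_gset gCM gC1 gC_lt count_C). Qed.

Lemma isAP v : reflect (exists i j, [/\ (i < 7)%N, (j < 7)%N & v = va i j]) (isA v).
Proof.
apply: (iffP (isgP _ _ _)) => -[i [j [i7 j7 E]]]; exists i, j; split=> //; last by rewrite E val_va.
by apply: val_inj; rewrite val_va.
Qed.
Lemma isBP v : reflect (exists i j, [/\ (i < 7)%N, (j < 7)%N & v = vb i j]) (isB v).
Proof.
apply: (iffP (isgP _ _ _)) => -[i [j [i7 j7 E]]]; exists i, j; split=> //; last by rewrite E val_vb.
by apply: val_inj; rewrite val_vb.
Qed.
Lemma isCP v : reflect (exists i j, [/\ (i < 8)%N, (j < 8)%N & v = vc i j]) (isC v).
Proof.
apply: (iffP (isgP _ _ _)) => -[i [j [i7 j7 E]]]; exists i, j; split=> //; last by rewrite E val_vc.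
by apply: val_inj; rewrite val_vc.
Qed.

Lemma card_isA v : isA v -> #|val v| = 24.
Proof. exact: (card_isg count_A). Qed.
Lemma card_isB v : isB v -> #|val v| = 24.
Proof. exact: (card_isg count_B). Qed.
Lemma card_isC v : isC v -> #|val v| = 21.
Proof. exact: (card_isg count_C). Qed.

(** The stabiliser of a point does not fix any line. *)
Lemma isA_isB v : isA v -> isB v -> false.
Proof.
case/isAP=> i [j [i7 j7 ->]] /isBP[k [l [k7 l7 E]]].
have [x xG xi] := gset_ex count_A isT i7 j7.
have [y yG /andP[/eqP yi yk]] := tr_has (allP_iota (allP_iota stab_A_B i7) k7).
have := congr1 val E; rewrite val_va // val_vb // => /setP h.
have := h x; rewrite !inE xG xi eqxx /= => /esym/eqP xk.
have := h (x * y); rewrite !inE groupM // gAM // gBM // yi xi eqxx /= => /esym/eqP xyk.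
by case/eqP: yk; rewrite -(gK gBM gB1 xG (gB_lt yG k7)) xyk -xk (gK gBM gB1).
Qed.

(** * The graph *)
(** The colouring by kinds; the cosets of kind 6 are those to be removed. *)
Definition kd (v : V) : nat :=
  if (#|val v| <= 3)%N then #|val v|.-1 else
  if isA v then 3 else if isB v then 4 else if isC v then 5 else 6.

Lemma kd_small i v : (i < 3)%N -> (kd v == i) = (#|val v| == i.+1).
Proof.
move=> i3; have := v_gt0 v; rewrite /kd; move: #|val v| => n.
move=> v0; have [n3|n3] := leqP n 3; first by case: n v0 {n3}.
rewrite (_ : (n == i.+1) = false); last by lia.
by case: isA; [|case: isB; [|case: isC]]; lia.
Qed.

Lemma kd3 v : (kd v == 3) = isA v.
Proof.
rewrite /kd; case: leqP => [v3|_]; last by case: isA => //; case: isB => //; case: isC.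
rewrite (_ : (_ == 3) = false); last by lia.
by apply/esym/negbTE/negP => /card_isA; lia.
Qed.

Lemma kd4 v : (kd v == 4) = isB v.
Proof.
rewrite /kd; case: leqP => [v3|_].
  rewrite (_ : (_ == 4) = false); last by lia.
  by apply/esym/negbTE/negP => /card_isB; lia.
have [A|_] := boolP (isA v); last by case: isB => //; case: isC.
by apply/esym/negbTE/negP => /(isA_isB A).
Qed.

Lemma kd5 v : (kd v == 5) = isC v.
Proof.
rewrite /kd; case: leqP => [v3|_].
  rewrite (_ : (_ == 5) = false); last by lia.
  by apply/esym/negbTE/negP => /card_isC; lia.
have [/card_isA A|_] := boolP (isA v); first by apply/esym/negbTE/negP => /card_isC; rewrite A.
have [/card_isB B|_] := boolP (isB v); first by apply/esym/negbTE/negP => /card_isC; rewrite B.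
by case: isC.
Qed.

Lemma kd_card v : (kd v < 6)%N -> #|val v| = nth 0%N [:: 1; 2; 3; 24; 24; 21]%N (kd v).
Proof.
case E: (kd v) => [|[|[|[|[|[|n]]]]]] //= _.
- by apply/eqP; rewrite -(@kd_small 0) ?E.
- by apply/eqP; rewrite -(@kd_small 1) ?E.
- by apply/eqP; rewrite -(@kd_small 2) ?E.
- by apply: card_isA; rewrite -kd3 E.
- by apply: card_isB; rewrite -kd4 E.
- by apply: card_isC; rewrite -kd5 E.
Qed.

Definition adj (u v : V) := cmp u v ||
  (((kd u == 3) && (kd v == 4) || (kd u == 4) && (kd v == 3)) && (val u :&: val v != set0)).

Lemma cmp_sym : symmetric cmp.
Proof. by move=> u v; apply: orbC. Qed.

Lemma adj_sym : symmetric adj.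
Proof.
move=> u v; apply: (congr2 orb (cmp_sym u v)); rewrite (setIC (val u)).
by move: (kd u) (kd v) => i j; rewrite orbC ![(i == _) && _]andbC.
Qed.

Lemma adj_irr : irreflexive adj.
Proof. by move=> u; rewrite /adj /cmp properxx; case: eqP => [->|]; rewrite ?andbF. Qed.

Lemma adj_lt u v : (kd u < 3)%N -> (#|val u| < #|val v|)%N -> adj u v = (val u \subset val v).
Proof.
move=> u3 uv; have -> : adj u v = cmp u v by rewrite /adj; case: (kd u) u3 => [|[|[]]] //= _; rewrite orbF.
rewrite /cmp orbC (_ : (val v \proper val u) = false) /=; last first.
  by apply/negP=> /proper_card; rewrite ltnNge ltnW.
by rewrite properEcard uv andbT.
Qed.

(** Apart from the edges between the cosets of kinds 3 and 4, edges are inclusions, so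
    that the size of one end properly divides that of the other. *)
Lemma adj_ok u v : adj u v -> (kd u < 6)%N -> (kd v < 6)%N ->
  okpair (kd u) (kd v) || okpair (kd v) (kd u).
Proof.
case/orP; last by case/andP=> /orP[]/andP[/eqP-> /eqP->].
have cmp_ok (a b : V) : val a \proper val b -> (kd a < 6)%N -> (kd b < 6)%N -> okpair (kd a) (kd b).
  move=> ab a6 b6; have := proper_card ab; have := card_dvd (proper_sub ab).
  rewrite !kd_card //; move: (kd a) (kd b) a6 b6.
  by do 6?[case=> [|]//]; do 6?[case=> [|]//].
by case/orP=> uv u6 v6; rewrite (cmp_ok _ _ uv) ?orbT.
Qed.

Lemma kd_lt v w : (kd v < 3)%N -> (3 <= kd w < 6)%N -> (#|val v| < #|val w|)%N.
Proof.
move=> v3 /andP[w3 w6]; rewrite !kd_card //; last exact: ltn_trans v3 _.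
by move: (kd v) (kd w) v3 w3 w6; do 3?[case=> [|]//]; do 6?[case=> [|]//].
Qed.

Lemma kd_lt0 v w : kd v = 0%N -> (0 < kd w < 6)%N -> (#|val v| < #|val w|)%N.
Proof.
move=> v0 /andP[w3 w6]; rewrite !kd_card ?v0 //.
by move: (kd w) w3 w6; do 6?[case=> [|]//].
Qed.

Lemma tri0 t g v : (kd t == 1%N) || (kd t == 2%N) -> kd g = 0%N ->
  kd v \in [:: 3; 4; 5]%N -> adj t g -> adj t v -> adj g v.
Proof.
move=> t12 g0 v345.
have t3 : (kd t < 3)%N by case/orP: t12 => /eqP->.
have v36 : (3 <= kd v < 6)%N by move: v345; rewrite !inE => /or3P[]/eqP->.
have gt : (#|val g| < #|val t|)%N by apply: (kd_lt0 g0); case/orP: t12 => /eqP->.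
have tv : (#|val t| < #|val v|)%N by apply: kd_lt.
have gv : (#|val g| < #|val v|)%N by apply: ltn_trans tv.
by rewrite adj_sym !adj_lt ?g0 // => /subset_trans h /h.
Qed.

Lemma tri34 t a b : (kd t < 3)%N -> kd a = 3%N -> kd b = 4%N -> adj t a -> adj t b -> adj a b.
Proof.
move=> t3 a3 b4; rewrite !(adj_lt t3) ?(kd_lt t3) ?a3 ?b4 //.
move=> ta tb; rewrite /adj a3 b4 /=; apply/orP; right.
have /card_gt0P[x xt] := v_gt0 t; apply/set0Pn; exists x.
by rewrite inE (subsetP ta) ?(subsetP tb).
Qed.

(** * Neighbours *)
Lemma card_nb0 v : (0 < kd v < 6)%N -> #|nb adj kd v 0| = #|val v|.
Proof.
move=> v06; pose f x := vtx [set x].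
have fE x : x \in G -> val (f x) = [set x] by move=> xG; rewrite val_vtx ?singleton_coset.
have inG x : x \in val v -> x \in G by apply: subsetP; apply: v_sub.
rewrite -[RHS](@card_in_imset _ _ f); last first.
  by move=> x y /inG xG /inG yG /(congr1 val); rewrite !fE // => /set1_inj.
apply: eq_card => w; rewrite inE; apply/andP/imsetP => [[vw w0]|[x xv ->]].
  have wv : val w \subset val v by rewrite adj_sym adj_lt ?(eqP w0) ?(kd_lt0 (eqP w0)) // in vw.
  move: w0; rewrite kd_small // => /cards1P[x wE].
  have xv : x \in val v by move: wv; rewrite wE sub1set.
  by exists x; rewrite // -[w]vtx_val wE.
have w0 : kd (f x) = 0%N by apply/eqP; rewrite kd_small // fE ?inG // cards1.
split; last by rewrite w0.
by rewrite adj_sym adj_lt ?w0 ?(kd_lt0 w0) // fE ?inG // sub1set.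
Qed.

Lemma nb_over v i : (kd v < 3)%N -> (3 <= i < 6)%N ->
  nb adj kd v i = [set w | (kd w == i) && (val v \subset val w)].
Proof.
move=> v3 i36; apply/setP=> w; rewrite !inE andbC; case: eqP => //= wi.
by rewrite adj_lt // kd_lt ?wi.
Qed.

Section Over.
Variables (v : V) (x h : gT).
Hypotheses (xG : x \in G) (hG : h \in G) (v3 : (kd v < 3)%N) (vE : val v = x *: <[h]>).

Let hGs : <[h]> \subset G. Proof. by rewrite cycle_subG. Qed.

Lemma card_nb3 : #|nb adj kd v 3| = size (fixA (tr h)).
Proof.
rewrite nb_over //; under eq_finset do rewrite kd3.
by rewrite (card_over gAM gA1 gA_lt count_A isT stab_A_A xG hGs vE); apply: card_fx_cycle gAM gA1 _ hG.
Qed.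

Lemma card_nb4 : #|nb adj kd v 4| = size (fixB (tr h)).
Proof.
rewrite nb_over //; under eq_finset do rewrite kd4.
by rewrite (card_over gBM gB1 gB_lt count_B isT stab_B_B xG hGs vE); apply: card_fx_cycle gBM gB1 _ hG.
Qed.

Lemma card_nb5 : #|nb adj kd v 5| = size (fixC (tr h)).
Proof.
rewrite nb_over //; under eq_finset do rewrite kd5.
by rewrite (card_over gCM gC1 gC_lt count_C isT stab_C_C xG hGs vE); apply: card_fx_cycle gCM gC1 _ hG.
Qed.

End Over.

Lemma prime_coset v x p : prime p -> #|val v| = p -> x \in val v ->
  exists2 h, h \in G & [/\ val v = x *: <[h]>, h != 1 & h ^+ p = 1].
Proof.
move=> p_pr vp xv; have [H HG vE] := v_coset xv.
have cH : #|H| = p by rewrite -vp vE card_lcoset.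
have /cyclicP[h hE] : cyclic H by rewrite prime_cyclic ?cH.
have oh : #[h] = p by rewrite -cH hE.
exists h; first by rewrite (subsetP (proper_sub HG)) // hE cycle_id.
split; first by rewrite vE hE.
  by rewrite -order_gt1 oh prime_gt1.
by rewrite -oh expg_order.
Qed.

Lemma in_G v x : x \in val v -> x \in G.
Proof. exact/subsetP/v_sub. Qed.

Lemma c10 t : kd t = 1%N -> #|nb adj kd t 0| = 2.
Proof. by move=> t1; rewrite card_nb0 ?t1 // kd_card t1. Qed.
Lemma c20 t : kd t = 2%N -> #|nb adj kd t 0| = 3.
Proof. by move=> t1; rewrite card_nb0 ?t1 // kd_card t1. Qed.

Lemma over0 v : kd v = 0%N -> #|nb adj kd v 3| = 7 /\ #|nb adj kd v 4| = 7.
Proof.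
move=> v0; have /eqP/cards1P[x vE] : #|val v| = 1%N by rewrite kd_card v0.
have xG : x \in G by apply: (@in_G v); rewrite vE set11.
have vE' : val v = x *: <[1 : gT]> by rewrite cycle1 mulg1.
by rewrite (card_nb3 xG _ _ vE') ?(card_nb4 xG _ _ vE') ?v0 // tr_1.
Qed.

Lemma over1 v : kd v = 1%N -> #|nb adj kd v 3| = 3 /\ #|nb adj kd v 4| = 3.
Proof.
move=> v1; have /card_gt0P[x xv] := v_gt0 v; have xG := in_G xv.
have v2 : #|val v| = 2 by rewrite kd_card v1.
have [h hG [vE h1 h2]] := prime_coset (isT : prime 2) v2 xv.
have o2 : ord2 (tr h) by rewrite /ord2 tr_eq1 // h1 -tr_mul // tr_eq1 ?groupM // -expg2 h2 eqxx.
have /and3P[/eqP fA /eqP fB _] := implyP (tr_all tab_order2 hG) o2.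
by rewrite (card_nb3 xG hG _ vE) ?(card_nb4 xG hG _ vE) ?v1.
Qed.

Lemma over2 v : kd v = 2%N -> [/\ #|nb adj kd v 3| = 1%N, #|nb adj kd v 4| = 1%N & #|nb adj kd v 5| = 2].
Proof.
move=> v1; have /card_gt0P[x xv] := v_gt0 v; have xG := in_G xv.
have v2 : #|val v| = 3 by rewrite kd_card v1.
have [h hG [vE h1 h2]] := prime_coset (isT : prime 3) v2 xv.
have o3 : ord3 (tr h) by rewrite /ord3 tr_eq1 // h1 -!tr_mul ?groupM // tr_eq1 ?groupM // -expg2 -expgS h2 eqxx.
have /and3P[/eqP fA /eqP fB /eqP fC] := implyP (tr_all tab_order3 hG) o3.
by rewrite (card_nb3 xG hG _ vE) ?(card_nb4 xG hG _ vE) ?(card_nb5 xG hG _ vE) ?v1.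
Qed.

(** * Numbers of small cosets *)
Lemma n0 : #|[set v | kd v == 0%N]| = 168.
Proof.
rewrite -card_G -(@card_in_imset _ _ (fun x => vtx [set x]) G); last first.
  by move=> x y xG yG /(congr1 val); rewrite !val_vtx ?singleton_coset // => /set1_inj.
apply: eq_card => v; rewrite inE kd_small //; apply/cards1P/imsetP => [[x vE]|[x xG ->]].
  by exists x; rewrite -?vE ?vtx_val //; apply: (@in_G v); rewrite vE set11.
by exists x; rewrite val_vtx ?singleton_coset.
Qed.

Lemma card_offdiag (T : finType) (A : {set T}) :
  #|[set e : T * T | [&& e.1 \in A, e.2 \in A & e.1 != e.2]]| = (#|A| * #|A| - #|A|)%N.
Proof.
have /(canRL (addnK _))<- // : (#|[set e : T * T | [&& e.1 \in A, e.2 \in A & e.1 != e.2]]| + #|A|)%N = (#|A| * #|A|)%N.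
rewrite -cardsX -(cardsID [set e : T * T | e.1 != e.2] (setX A A)); congr (_ + _)%N.
  by apply: eq_card => e; rewrite !inE andbA.
rewrite -(card_imset _ (f := fun x : T => (x, x))); last by move=> x y [].
apply: eq_card => -[x y]; rewrite !inE negbK /=; apply/imsetP/idP => [[z zA [-> ->]]|].
  by rewrite eqxx zA.
by case/and3P=> /eqP<- xA _; exists x.
Qed.

(** Count ordered pairs of distinct elements: each coset with p elements contains
    p (p - 1) of them, and a pair x, y lies in a unique such coset exactly when
    the quotient of y by x has order p. *)
Lemma count_prime p k (ordp : perms -> bool) : prime p -> (p < 168)%N -> count ordp tab = k ->
  (forall h, h \in G -> ordp (tr h) = (h != 1) && (h ^+ p == 1)) ->
  (#|[set v : V | #|val v| == p]| * (p * p - p))%N = (168 * k)%N.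
Proof.
move=> p_pr p168 ck ordpE.
(* The pairs with quotient of order p, each of which is sent by f to the coset
   which it spans. *)
pose D := [pred e : gT * gT | (e.1 \in G) && (e.1^-1 * e.2 \in [set h in G | ordp (tr h)])].
pose f (e : gT * gT) := vtx (e.1 *: <[e.1^-1 * e.2]>).
have ordP h : h \in G -> ordp (tr h) -> #[h] = p.
  by move=> hG; rewrite ordpE // => /andP[h1 hp]; apply: (prime_nt_dvdP p_pr); rewrite ?order_eq1 // order_dvdn.
have f_val e : D e -> val (f e) = e.1 *: <[e.1^-1 * e.2]> /\ #|val (f e)| = p.
  case/andP=> e1 /setIdP[hG hp]; have vE : val (f e) = e.1 *: <[e.1^-1 * e.2]>.
    apply/val_vtx/(@proper_cosetP _ <[e.1^-1 * e.2]>%G) => //.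
    by rewrite properEcard cycle_subG hG -orderE (ordP _ hG hp) card_G.
  by rewrite vE card_lcoset -orderE (ordP _ hG hp).
have <- : (\sum_(e | D e) 1 = 168 * k)%N.
  rewrite -(pair_big_dep (mem G) (fun x y => x^-1 * y \in [set h in G | ordp (tr h)]) (fun _ _ => 1%N)) /=.
  rewrite (eq_bigr (fun=> k)) => [|x xG]; first by rewrite sum_nat_const card_G.
  rewrite sum1_card (eq_card (B := x *: [set h in G | ordp (tr h)])) => [|y].
    by rewrite card_lcoset (card_tr ordp) ck.
  by rewrite mem_lcoset.
rewrite (partition_big f (fun v : V => #|val v| == p)) /=; last by move=> e /f_val[_ ->].
rewrite -sum1_card big_distrl /= -(eq_bigl _ _ (fun v => in_set (fun v : V => #|val v| == p) v)).
apply: eq_bigr => v vp; rewrite mul1n sum1_card; rewrite inE in vp.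
rewrite -[p in (p * p - p)%N](eqP vp) -card_offdiag; apply: eq_card => -[x y].
rewrite inE unfold_in /=; apply/and3P/andP => [[xv yv xy]|[De /eqP fE]].
  have [h hG [vE h1 hp]] := prime_coset p_pr (eqP vp) xv.
  have xG := in_G xv; have yG := in_G yv.
  have zh : x^-1 * y \in <[h]> by rewrite -mem_lcoset -vE.
  have z1 : x^-1 * y != 1 by rewrite -(inj_eq (mulgI x)) mulKVg mulg1 eq_sym.
  have zG : x^-1 * y \in G by rewrite groupM ?groupV.
  have zp : (x^-1 * y) ^+ p = 1 by case/cycleP: zh => i ->; rewrite -expgM mulnC expgM hp expg1n.
  have De : D (x, y) by rewrite /= xG inE zG ordpE // z1 zp eqxx.
  split=> //; apply/eqP/val_inj; rewrite (f_val _ De).1 /= vE; congr (_ *: _).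
  apply/eqP; rewrite eqEcard cycle_subG zh -!orderE (ordP _ zG) ?ordpE ?z1 ?zp ?eqxx //=.
  by rewrite (ordP _ hG) // ordpE // h1 hp eqxx.
have [vE _] := f_val _ De; rewrite -fE vE /= mem_lcoset cycle_id; split=> //.
  by rewrite -[X in is_true X]/(x \in x *: <[x^-1 * y]>) mem_lcoset mulVg group1.
case/andP: De => /= xG /setIdP[zG]; rewrite ordpE // => /andP[z1 _].
by apply: contraNneq z1 => ->; rewrite mulVg.
Qed.

Lemma n1 : #|[set v | kd v == 1%N]| = 1764.
Proof.
have -> : [set v : V | kd v == 1%N] = [set v : V | #|val v| == 2] by apply/setP=> v; rewrite !inE kd_small.
have o2 h : h \in G -> ord2 (tr h) = (h != 1) && (h ^+ 2 == 1).
  by move=> hG; rewrite /ord2 tr_eq1 // -tr_mul // tr_eq1 ?groupM // expgS expg1.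
have := count_prime (isT : prime 2) isT count_ord2 o2; lia.
Qed.

Lemma n2 : #|[set v | kd v == 2%N]| = 1568.
Proof.
have -> : [set v : V | kd v == 2%N] = [set v : V | #|val v| == 3] by apply/setP=> v; rewrite !inE kd_small.
have o3 h : h \in G -> ord3 (tr h) = (h != 1) && (h ^+ 3 == 1).
  by move=> hG; rewrite /ord3 tr_eq1 // -!tr_mul ?groupM // tr_eq1 ?groupM // !expgS expg0 mulg1.
have := count_prime (isT : prime 3) isT count_ord3 o3; lia.
Qed.

(** * Links of the largest cosets *)
Lemma gset_elt (v : V) x : x \in G -> [set x] \subset val v -> kd v != 0%N -> (kd v < 6)%N ->
  vtx [set x] \in nb adj kd v 0.
Proof.
move=> xG xv v0 v6; have xE : val (vtx [set x]) = [set x] by rewrite val_vtx ?singleton_coset.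
have x0 : kd (vtx [set x]) = 0%N by apply/eqP; rewrite kd_small // xE cards1.
have lt : (#|val (vtx [set x])| < #|val v|)%N by apply: (kd_lt0 x0); rewrite lt0n v0.
by rewrite inE x0 eqxx andbT adj_sym adj_lt ?x0 // xE.
Qed.

Lemma triple (c : V) x (w : gT) : kd c = 5%N -> x \in G -> w \in G -> ord3 (tr w) -> x *: <[w]> \subset val c ->
  exists2 u, u \in nb adj kd c 2 & adj u (vtx [set x]) /\ adj u (vtx [set x * w]).
Proof.
move=> c5 xG wG w3 sub.
have [w1 www] : w != 1 /\ w ^+ 3 = 1.
  case/andP: w3; rewrite tr_eq1 // => w1; rewrite -!tr_mul ?groupM // tr_eq1 ?groupM // => /eqP www.
  by rewrite w1 !expgS expg0 mulg1.
have ow : #[w] = 3 by apply: (prime_nt_dvdP (isT : prime 3)); rewrite ?order_eq1 // order_dvdn www.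
have uE : val (vtx (x *: <[w]>)) = x *: <[w]>.
  apply/val_vtx/(@proper_cosetP _ <[w]>%G) => //.
  by rewrite properEcard cycle_subG wG -orderE ow card_G.
have u2 : kd (vtx (x *: <[w]>)) = 2%N by apply/eqP; rewrite kd_small // uE card_lcoset -orderE ow.
have elt y : y \in x *: <[w]> -> adj (vtx (x *: <[w]>)) (vtx [set y]).
  move=> yu; have yG : y \in G by apply: (@in_G (vtx (x *: <[w]>))); rewrite uE.
  suff : vtx [set y] \in nb adj kd (vtx (x *: <[w]>)) 0 by rewrite inE => /andP[].
  by apply: gset_elt; rewrite ?u2 // uE sub1set.
have lt : (#|val (vtx (x *: <[w]>))| < #|val c|)%N by apply: kd_lt; rewrite ?u2 ?c5.
exists (vtx (x *: <[w]>)); first by rewrite inE u2 eqxx andbT adj_sym adj_lt ?u2 // uE.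
by split; apply: elt; rewrite mem_lcoset ?mulVg ?mulKg ?group1 ?cycle_id.
Qed.

(** With g0 = x0 and g = x0 h, take w from borel_check: the cosets x0 <w> and x0 w <k>
    with k = w^-1 h both contain x0 w. *)
Lemma cC c : kd c = 5%N -> exists2 g0, g0 \in nb adj kd c 0 &
  forall g, g \in nb adj kd c 0 -> exists g' u u', [/\ g' \in nb adj kd c 0, u \in nb adj kd c 2, u' \in nb adj kd c 2 &
    [/\ adj u g, adj u g', adj u' g' & adj u' g0]].
Proof.
move=> c5; have /card_gt0P[x0 x0c] := v_gt0 c.
have x0G := in_G x0c.
have [i [j [i8 j8 cE]]] : exists i j, [/\ (i < 8)%N, (j < 8)%N & val c = Cset i j].
  by apply/isgP; rewrite -/(isC c) -kd5 c5.
have x0i : gC (tr x0) i = j by move: x0c; rewrite cE inE => /andP[_ /eqP].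
have cS : val c = x0 *: stab_group gCM gC1 i by rewrite cE -x0i (gset_lcoset gCM gC1 gC_lt).
have inS y : (y \in stab_group gCM gC1 i) = (y \in G) && (gC (tr y) i == i) by apply: in_stab.
have inc0 y : y \in val c -> vtx [set y] \in nb adj kd c 0.
  by move=> yc; apply: gset_elt; rewrite ?c5 ?sub1set // (in_G yc).
exists (vtx [set x0]); first exact: inc0.
move=> g; rewrite inE => /andP[cg g0].
have gc : val g \subset val c by rewrite adj_sym adj_lt ?(eqP g0) ?(kd_lt0 (eqP g0)) ?c5 // in cg.
move: g0; rewrite kd_small // => /cards1P[x gE].
have {gc} xc : x \in val c by move: gc; rewrite gE sub1set.
have {gE} -> : g = vtx [set x] by rewrite -gE vtx_val.
have xG := in_G xc.
have [h hS ->] : exists2 h, h \in stab_group gCM gC1 i & x = x0 * h by apply/lcosetP; rewrite -cS.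
have [hG hi] : h \in G /\ gC (tr h) i == i by apply/andP; rewrite -inS.
have := allP (allP_iota borel_check i8) _ (tr_tab hG); rewrite hi.
case/tr_has=> w wG /and3P[wi w3]; rewrite -!tr_mul ?groupM // => w3'.
have wS : w \in stab_group gCM gC1 i by rewrite inS wG.
have w2 : (w * w)%g = w^-1.
  case/andP: w3 => _; rewrite -!tr_mul ?groupM // tr_eq1 ?groupM // => /eqP www.
  by apply: (mulgI w); rewrite www mulgV.
rewrite w2 in w3'; set k := w^-1 * _ in w3'.
have kS : k \in stab_group gCM gC1 i by rewrite groupM ?groupV.
have kG : k \in G by rewrite groupM ?groupV.
have sub y z : y \in stab_group gCM gC1 i -> z \in stab_group gCM gC1 i -> x0 * y *: <[z]> \subset val c.
  move=> yS zS; rewrite cS lcosetM lcosetS //.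
  by rewrite mul_subG ?sub1set // cycle_subG.
have [u' u'c [u'1 u'2]] := triple c5 x0G wG w3 (eq_ind _ (fun y => y *: _ \subset _) (sub _ _ (group1 _) wS) _ (mulg1 x0)).
have [u uc [u1 u2]] := triple c5 (groupM x0G wG) kG w3' (sub _ _ wS kS).
have kE : x0 * w * k = x0 * h by rewrite /k mulgA mulgK.
rewrite kE in u2; exists (vtx [set x0 * w]), u, u'; split=> //.
by apply: inc0; rewrite cS mem_lcoset mulKg.
Qed.

(** * Points and lines *)
Lemma kd_va i j : (i < 7)%N -> (j < 7)%N -> kd (va i j) = 3.
Proof. by move=> i7 j7; apply/eqP; rewrite kd3; apply/isAP; exists i, j. Qed.
Lemma kd_vb i j : (i < 7)%N -> (j < 7)%N -> kd (vb i j) = 4.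
Proof. by move=> i7 j7; apply/eqP; rewrite kd4; apply/isBP; exists i, j. Qed.

Lemma kd3P v : kd v = 3 -> exists i j, [/\ (i < 7)%N, (j < 7)%N & v = va i j].
Proof. by move=> v3; apply/isAP; rewrite -kd3 v3. Qed.
Lemma kd4P v : kd v = 4 -> exists i j, [/\ (i < 7)%N, (j < 7)%N & v = vb i j].
Proof. by move=> v4; apply/isBP; rewrite -kd4 v4. Qed.

Lemma incM x i k : x \in G -> (i < 7)%N -> (k < 7)%N -> inc i k = inc (gA (tr x) i) (gB (tr x) k).
Proof. by move=> xG i7 k7; apply/eqP/(allP_iota (allP_iota (tr_all tab_inc xG) i7) k7). Qed.

Lemma flag i k : (i < 7)%N -> (k < 7)%N ->
  exists2 y, y \in G & gA (tr y) 0 = i /\ gB (tr y) (inc i k) = k.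
Proof.
by move=> i7 k7; have /tr_has[y yG /andP[/eqP yi /eqP yk]] := allP_iota (allP_iota tab_flag i7) k7; exists y.
Qed.

Lemma gA_div x y i i' : x \in G -> y \in G -> (i < 7)%N -> gA (tr x) i = i' -> gA (tr (y * x^-1)) i' = gA (tr y) i.
Proof. by move=> xG yG i7 <-; rewrite gAM ?groupV ?gA_lt // (gK gAM gA1). Qed.
Lemma gB_div x y i i' : x \in G -> y \in G -> (i < 7)%N -> gB (tr x) i = i' -> gB (tr (y * x^-1)) i' = gB (tr y) i.
Proof. by move=> xG yG i7 <-; rewrite gBM ?groupV ?gB_lt // (gK gBM gB1). Qed.

(** The pairs formed by a point and a line have two orbits, given by incidence: some
    element takes i to j and k to l exactly when both pairs are incident or both
    are not. *)
Lemma adj_ab i j k l : (i < 7)%N -> (j < 7)%N -> (k < 7)%N -> (l < 7)%N ->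
  adj (va i j) (vb k l) = (inc i k == inc j l).
Proof.
move=> i7 j7 k7 l7; rewrite /adj kd_va // kd_vb //= (_ : cmp _ _ = false) /=; last first.
  have aE : #|val (va i j)| = 24 by rewrite kd_card kd_va.
  have bE : #|val (vb k l)| = 24 by rewrite kd_card kd_vb.
  by apply/negP=> /orP[]/proper_card; rewrite aE bE.
rewrite val_va // val_vb //; apply/set0Pn/eqP => [[x]|E].
  by rewrite !inE => /andP[/andP[xG /eqP<-] /andP[_ /eqP<-]]; apply: incM.
have [x xG [xi xk]] := flag i7 k7; have [y yG [yj yl]] := flag j7 l7.
have b7 : (inc i k < 7)%N by case: (inc i k).
by exists (y * x^-1); rewrite !inE groupM ?groupV // (gA_div _ _ _ xi) // (gB_div _ _ _ xk) // yj E yl !eqxx.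
Qed.

Lemma kd_single x : x \in G -> kd (vtx [set x]) = 0%N.
Proof. by move=> xG; apply/eqP; rewrite kd_small // val_vtx ?singleton_coset // cards1. Qed.

Lemma adj_single v x : x \in val v -> (0 < kd v < 6)%N -> adj (vtx [set x]) v.
Proof.
move=> xv v06; have xG := in_G xv.
by rewrite adj_lt ?kd_single ?(kd_lt0 (kd_single xG)) // val_vtx ?singleton_coset // sub1set.
Qed.

Lemma adj_single_a x i j : x \in G -> (i < 7)%N -> (j < 7)%N -> gA (tr x) i = j -> adj (vtx [set x]) (va i j).
Proof.
by move=> xG i7 j7 xi; apply: adj_single; rewrite ?kd_va // val_va // inE xG xi eqxx.
Qed.
Lemma adj_single_b x i j : x \in G -> (i < 7)%N -> (j < 7)%N -> gB (tr x) i = j -> adj (vtx [set x]) (vb i j).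
Proof.
by move=> xG i7 j7 xi; apply: adj_single; rewrite ?kd_vb // val_vb // inE xG xi eqxx.
Qed.

Definition lt7 := [pred i : nat | i < 7].

Lemma mem_quadruples i1 i2 k1 k2 : all lt7 [:: i1; i2; k1; k2] -> i1 != i2 -> k1 != k2 ->
  (i1, i2, k1, k2) \in quadruples.
Proof.
case/and5P=> i17 i27 k17 k27 _ i12 k12; rewrite mem_filter i12 k12 !mem_pairs !mem_iota.
by rewrite [(i1 < _)%N]i17 [(i2 < _)%N]i27 [(k1 < _)%N]k17 [(k2 < _)%N]k27.
Qed.

Lemma quadruple_rep q : q \in quadruples -> exists2 q0, (q0 \in qreps) && (qpat q0 == qpat q) &
  exists2 x, x \in G & (gA (tr x) q0.1.1.1, gA (tr x) q0.1.1.2, gB (tr x) q0.1.2, gB (tr x) q0.2) = q.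
Proof.
move=> /(allP tab_quadruple)/hasP[[[[i1 i2] k1] k2] q0R /andP[pat /tr_has[x xG /eqP xE]]].
by exists (i1, i2, k1, k2); [rewrite q0R|exists x].
Qed.

Lemma qreps_lt q : q \in qreps -> all lt7 [:: q.1.1.1; q.1.1.2; q.1.2; q.2].
Proof.
by move: q; apply/allP; vm_compute.
Qed.

(** The quadruples of sources and of targets have the same incidences, hence the same
    representative, and an element takes the former to the latter. It belongs to
    all four cosets. *)
Lemma fill_nondeg i1 i2 k1 k2 j1 j2 l1 l2 : all lt7 [:: i1; i2; k1; k2] -> all lt7 [:: j1; j2; l1; l2] ->
  i1 != i2 -> k1 != k2 -> j1 != j2 -> l1 != l2 -> ipat i1 i2 k1 k2 = ipat j1 j2 l1 l2 ->
  filled adj kd (va i1 j1) (va i2 j2) (vb k1 l1) (vb k2 l2).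
Proof.
move=> lti ltj i12 k12 j12 l12 pat.
have [q /andP[qR /eqP qp] [x xG]] := quadruple_rep (mem_quadruples lti i12 k12).
have [q' /andP[q'R /eqP q'p] [y yG]] := quadruple_rep (mem_quadruples ltj j12 l12).
have -> : q' = q.
  have eqp : qpat q' = qpat q by rewrite qp q'p -[RHS]/(ipat i1 i2 k1 k2) pat.
  have [[n n_lt nE] [n' n'_lt n'E]] := (nthP q qR, nthP q q'R).
  suff nn : n' == n by rewrite -nE -n'E (eqP nn).
  rewrite -(nth_uniq (qpat q) _ _ qreps_pat) ?size_map // !(nth_map q) //.
  by rewrite nE n'E eqp.
move: q qR qp => [[[p1 p2] m1] m2] qR _ {q' q'R q'p} [/= y1 y2 y3 y4] [/= x1 x2 x3 x4].
have /and5P[/= p17 p27 m17 m27 _] := qreps_lt qR.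
have zG : y * x^-1 \in G by rewrite groupM ?groupV.
case/and5P: lti => i17 i27 k17 k27 _; case/and5P: ltj => j17 j27 l17 l27 _.
apply: (FillG (g := vtx [set y * x^-1])); first exact: kd_single.
- by apply: adj_single_a => //; rewrite (gA_div xG yG p17 x1) y1.
- by apply: adj_single_a => //; rewrite (gA_div xG yG p27 x2) y2.
- by apply: adj_single_b => //; rewrite (gB_div xG yG m17 x3) y3.
- by apply: adj_single_b => //; rewrite (gB_div xG yG m27 x4) y4.
Qed.

Lemma common_point k1 k2 (e : bool) : (k1 < 7)%N -> (k2 < 7)%N ->
  exists2 i, (i < 7)%N & inc i k1 = e /\ inc i k2 = e.
Proof.
move=> k17 k27; have /andP[h1 h2] := allP_iota (allP_iota pat_exists k17) k27.
case: e; first by have [i i7 /andP[e1 e2]] := hasP_iota h1; exists i; rewrite ?e1 ?e2.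
by have [i i7 /andP[/negbTE e1 /negbTE e2]] := hasP_iota h2; exists i; rewrite ?e1 ?e2.
Qed.

Lemma common_line i1 i2 (e : bool) : (i1 < 7)%N -> (i2 < 7)%N ->
  exists2 k, (k < 7)%N & inc i1 k = e /\ inc i2 k = e.
Proof.
move=> k17 k27; have /andP[h1 h2] := allP_iota (allP_iota pat_exists' k17) k27.
case: e; first by have [i i7 /andP[e1 e2]] := hasP_iota h1; exists i; rewrite ?e1 ?e2.
by have [i i7 /andP[/negbTE e1 /negbTE e2]] := hasP_iota h2; exists i; rewrite ?e1 ?e2.
Qed.

(** If the two lines have the same source or the same target, then both have the same
    incidences with the two points, and a third line which is incident with both
    points, or with none, and differs from them in its incidences cuts the
    4-cycle into two nondegenerate ones. *)
Lemma fill_deg_b i1 i2 k1 k2 j1 j2 l1 l2 : all lt7 [:: i1; i2; k1; k2] -> all lt7 [:: j1; j2; l1; l2] ->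
  i1 != i2 -> j1 != j2 -> ipat i1 i2 k1 k2 = ipat j1 j2 l1 l2 ->
  filled adj kd (va i1 j1) (va i2 j2) (vb k1 l1) (vb k2 l2).
Proof.
move=> lti ltj i12 j12 pat.
have [/andP[k12 l12]|deg] := boolP ((k1 != k2) && (l1 != l2)); first exact: fill_nondeg.
have /= /and5P[i17 i27 k17 k27 _] := lti; have /= /and5P[j17 j27 l17 l27 _] := ltj.
case: (pat) => p11 p12 p21 p22.
have same : inc i1 k1 = inc i1 k2 /\ inc i2 k1 = inc i2 k2.
  by move: deg; rewrite negb_and !negbK => /orP[]/eqP E; rewrite ?E // p11 p21 p12 p22 E.
(* The constant pattern e is realised by a common line, and differs from the given one. *)
have [e e1] : exists e : bool, (e, e) != (inc i1 k1, inc i2 k1).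
  by case: (inc i1 k1); case: (inc i2 k1); [exists false|exists true|exists true|exists true].
have [k3 k37 [ik1 ik2]] := common_line e i17 i27.
have [l3 l37 [jl1 jl2]] := common_line e j17 j27.
have k13 : k1 != k3 by apply: contraNneq e1 => ->; rewrite ik1 ik2.
have k32 : k3 != k2 by case: same e1 => -> ->; apply: contraNneq => <-; rewrite ik1 ik2.
have l13 : l1 != l3 by rewrite p11 p21 in e1; apply: contraNneq e1 => ->; rewrite jl1 jl2.
have l32 : l3 != l2 by case: same e1 => -> ->; rewrite p12 p22; apply: contraNneq => <-; rewrite jl1 jl2.
apply: (FillB (b0 := vb k3 l3)); rewrite ?kd_vb // ?adj_ab ?ik1 ?ik2 ?jl1 ?jl2 //.
  by apply: fill_nondeg; rewrite //= ?i17 ?i27 ?j17 ?j27 ?k17 ?k37 ?l17 ?l37 // /ipat ik1 ik2 jl1 jl2 p11 p21.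
by apply: fill_nondeg; rewrite //= ?i17 ?i27 ?j17 ?j27 ?k27 ?k37 ?l27 ?l37 // /ipat ik1 ik2 jl1 jl2 p12 p22.
Qed.

(** The dual argument when the two points have the same source or the same target. *)
Lemma fill_all i1 i2 k1 k2 j1 j2 l1 l2 : all lt7 [:: i1; i2; k1; k2] -> all lt7 [:: j1; j2; l1; l2] ->
  ipat i1 i2 k1 k2 = ipat j1 j2 l1 l2 ->
  filled adj kd (va i1 j1) (va i2 j2) (vb k1 l1) (vb k2 l2).
Proof.
move=> lti ltj pat.
have [/andP[i12 j12]|deg] := boolP ((i1 != i2) && (j1 != j2)); first exact: fill_deg_b.
have /= /and5P[i17 i27 k17 k27 _] := lti; have /= /and5P[j17 j27 l17 l27 _] := ltj.
case: (pat) => p11 p12 p21 p22.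
have same : inc i1 k1 = inc i2 k1 /\ inc i1 k2 = inc i2 k2.
  by move: deg; rewrite negb_and !negbK => /orP[]/eqP E; rewrite ?E // p11 p21 p12 p22 E.
have [e e1] : exists e : bool, (e, e) != (inc i1 k1, inc i1 k2).
  by case: (inc i1 k1); case: (inc i1 k2); [exists false|exists true|exists true|exists true].
have [i3 i37 [ik1 ik2]] := common_point e k17 k27.
have [j3 j37 [jl1 jl2]] := common_point e l17 l27.
have i13 : i1 != i3 by apply: contraNneq e1 => ->; rewrite ik1 ik2.
have i32 : i3 != i2 by case: same e1 => -> ->; apply: contraNneq => <-; rewrite ik1 ik2.
have j13 : j1 != j3 by rewrite p11 p12 in e1; apply: contraNneq e1 => ->; rewrite jl1 jl2.
have j32 : j3 != j2 by case: same e1 => -> ->; rewrite p21 p22; apply: contraNneq => <-; rewrite jl1 jl2.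
apply: (FillA (a0 := va i3 j3)); rewrite ?kd_va // ?adj_ab ?ik1 ?ik2 ?jl1 ?jl2 //.
  by apply: fill_deg_b; rewrite //= ?i17 ?i37 ?j17 ?j37 ?k17 ?k27 ?l17 ?l27 // /ipat ik1 ik2 jl1 jl2 p11 p12.
by apply: fill_deg_b; rewrite //= ?i27 ?i37 ?j27 ?j37 ?k17 ?k27 ?l17 ?l27 // /ipat ik1 ik2 jl1 jl2 p21 p22.
Qed.

Lemma cfill a a' b b' : kd a = 3%N -> kd a' = 3%N -> kd b = 4%N -> kd b' = 4%N ->
  adj a b -> adj a b' -> adj a' b -> adj a' b' -> filled adj kd a a' b b'.
Proof.
move=> /kd3P[i1 [j1 [i17 j17 ->]]] /kd3P[i2 [j2 [i27 j27 ->]]].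
move=> /kd4P[k1 [l1 [k17 l17 ->]]] /kd4P[k2 [l2 [k27 l27 ->]]].
rewrite !adj_ab // => /eqP p11 /eqP p12 /eqP p21 /eqP p22.
by apply: fill_all; rewrite /= ?i17 ?i27 ?j17 ?j27 ?k17 ?k27 ?l17 ?l27 // /ipat p11 p12 p21 p22.
Qed.

Lemma cnb43 b : kd b = 4%N -> exists2 a, kd a = 3%N & adj a b.
Proof.
move=> /kd4P[k [l [k7 l7 ->]]].
have [i i7 [ik _]] := common_point true k7 k7; have [j j7 [jl _]] := common_point true l7 l7.
by exists (va i j); rewrite ?kd_va // adj_ab // ik jl.
Qed.

Lemma cnb50 c : kd c = 5%N -> exists2 g, kd g = 0%N & adj c g.
Proof.
move=> c5; have /card_gt0P[x xc] := v_gt0 c; exists (vtx [set x]); first exact/kd_single/(in_G xc).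
by rewrite adj_sym; apply: adj_single; rewrite // c5.
Qed.

Lemma mem_nmasks i1 i2 i3 : all lt7 [:: i1; i2; i3] -> nmask i1 i2 i3 \in nmasks.
Proof.
case/and4P=> i17 i27 i37 _; apply: (allP nmasks_all (i1, i2, i3)).
by rewrite !mem_pairs !mem_iota [(i1 < _)%N]i17 [(i2 < _)%N]i27 [(i3 < _)%N]i37.
Qed.

(** The lines realise enough incidence patterns with three points for two triples of
    points to have always a pattern in common. *)
Lemma cnb3 a1 a2 a3 : kd a1 = 3%N -> kd a2 = 3%N -> kd a3 = 3%N ->
  exists2 b, kd b = 4%N & [/\ adj a1 b, adj a2 b & adj a3 b].
Proof.
move=> /kd3P[i1 [j1 [i17 j17 ->]]] /kd3P[i2 [j2 [i27 j27 ->]]] /kd3P[i3 [j3 [i37 j37 ->]]].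
have mi : nmask i1 i2 i3 \in nmasks by apply: mem_nmasks; rewrite /= i17 i27 i37.
have mj : nmask j1 j2 j3 \in nmasks by apply: mem_nmasks; rewrite /= j17 j27 j37.
have [n n8 /andP[]] := hasP_iota (allP (allP nmasks_meet _ mi) _ mj).
pose p := nth (true, true, true) bools3 n.
rewrite !(nth_map (true, true, true)) // => /mapP[k k7 pk] /mapP[l l7 pl].
rewrite !mem_iota /= in k7 l7; move: pl; rewrite pk => -[e1 e2 e3].
by exists (vb k l); rewrite ?kd_vb // !adj_ab // e1 e2 e3 !eqxx.
Qed.

(** * Reduction to the six kinds of vertices *)
Lemma contain_a v x H i j : val v = x *: H -> x \in G -> H \subset G -> (i < 7)%N -> (j < 7)%N ->
  (val v \subset val (va i j)) = (gA (tr x) i == j) && FA H i.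
Proof. by move=> vE xG HG i7 j7; rewrite vE val_va // (sub_gset gAM gA1 gA_lt). Qed.
Lemma contain_b v x H i j : val v = x *: H -> x \in G -> H \subset G -> (i < 7)%N -> (j < 7)%N ->
  (val v \subset val (vb i j)) = (gB (tr x) i == j) && FB H i.
Proof. by move=> vE xG HG i7 j7; rewrite vE val_vb // (sub_gset gBM gB1 gB_lt). Qed.
Lemma contain_c v x H i j : val v = x *: H -> x \in G -> H \subset G -> (i < 8)%N -> (j < 8)%N ->
  (val v \subset val (vc i j)) = (gC (tr x) i == j) && FC H i.
Proof. by move=> vE xG HG i7 j7; rewrite vE val_vc // (sub_gset gCM gC1 gC_lt). Qed.

Lemma adj_kd6 u v : kd v = 6 -> adj u v = cmp u v.
Proof. by move=> v6; rewrite /adj v6; case: (kd u == 3); case: (kd u == 4); rewrite ?orbF. Qed.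

Lemma meet_adj u v w : val u \subset val v -> val u \subset val w -> kd v = 3 -> kd w = 4 -> adj v w && adj w v.
Proof.
move=> uv uw v3 w4; rewrite adj_sym andbb /adj v3 w4 /=; apply/orP; right.
have /card_gt0P[x xu] := v_gt0 u; apply/set0Pn; exists x.
by rewrite inE (subsetP uv) ?(subsetP uw).
Qed.

(** The condition of dismantle for the measure which is the number of elements of a
    coset. *)
Definition dominated v p := [/\ (kd p < 6)%N, adj p v &
  forall u, adj u v -> (kd u < 6)%N || (#|val u| <= #|val v|)%N -> u != p -> adj u p].

Lemma dominatedI v p : kd v = 6 -> (kd p < 6)%N -> val v \subset val p ->
  (forall u, kd u \in [:: 3; 4; 5]%N -> val v \subset val u -> u != p -> adj u p) -> dominated v p.
Proof.
move=> v6 p6 vp dom; have vlt : val v \proper val p.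
  rewrite properE vp; apply: contraTN p6 => pv; have : v = p by apply/val_inj/eqP; rewrite eqEsubset vp.
  by move <-; rewrite v6.
split=> //; first by rewrite adj_kd6 // /cmp vlt orbT.
move=> u; rewrite adj_kd6 // => /orP[uv|vu] small up.
  by rewrite /adj /cmp (proper_trans uv vlt).
apply: dom => //; last exact: proper_sub.
have u6 : (kd u < 6)%N.
  by case/orP: small => //; rewrite leqNgt proper_card.
have v3 : (3 < #|val v|)%N by rewrite ltnNge; apply: contra_eqN v6 => v3; rewrite /kd v3; case: #|val v| v3 => [|[|[|[|]]]].
have : (3 < #|val u|)%N by apply: ltn_trans v3 (proper_card vu).
by rewrite kd_card //; case: (kd u) u6 => [|[|[|[|[|[|]]]]]].
Qed.

(** For a coset x H of kind 6 take the coset of the stabiliser of the unique object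
    which H fixes. If H fixes a point, a coset of kind 4 containing x H meets that
    coset and is adjacent to it, the same holds with points and lines exchanged,
    and all other cosets of kinds 3, 4 and 5 containing x H are excluded by
    subgroup_types. *)
Lemma dominated_ex v : exists p, kd v = 6 -> dominated v p.
Proof.
have [v6|] := eqVneq (kd v) 6; last by move=> /eqP ne; exists v => /ne.
have [x [H [xG HpG vE]]] := vP v; have HG := proper_sub HpG.
have cH : #|val v| = #|H| by rewrite vE card_lcoset.
have A7 i := gA_lt (i := i) xG; have B7 i := gB_lt (i := i) xG; have C8 i := gC_lt (i := i) xG.
have no3 u : noA H -> val v \subset val u -> kd u != 3.
  move=> nA vu; apply/eqP => /kd3P[i [j [i7 j7 uE]]].
  by move: vu; rewrite uE (contain_a vE) // (negbTE (nA i i7)) andbF.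
have no4 u : noB H -> val v \subset val u -> kd u != 4.
  move=> nA vu; apply/eqP => /kd4P[i [j [i7 j7 uE]]].
  by move: vu; rewrite uE (contain_b vE) // (negbTE (nA i i7)) andbF.
have no5 u : noC H -> val v \subset val u -> kd u != 5.
  move=> nA vu; apply/eqP => u5; have /isCP[i [j [i7 j7 uE]]] : isC u by rewrite -kd5 u5.
  by move: vu; rewrite uE (contain_c vE) // (negbTE (nA i i7)) andbF.
have [small|[nC [[i i7 [Hi uniq]]|[i i7 [Hi uniq]]]]|[nA nB [i i7 [Hi uniq]]]] := subgroup_types HpG.
- by move: v6; rewrite /kd cH small; case: #|H| small => [|[|[|[|]]]].
- have vp : val v \subset val (va i (gA (tr x) i)) by rewrite (contain_a vE) ?A7 // eqxx.
  exists (va i (gA (tr x) i)) => _; apply: dominatedI => //; first by rewrite kd_va ?A7.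
  move=> u; rewrite !inE => /or3P[/eqP u3|/eqP u4|u5] vu up.
  + have /kd3P[k [l [k7 l7 uE]]] := u3; move: vu; rewrite uE (contain_a vE) // => /andP[/eqP xk Hk].
    by case/eqP: up; rewrite uE -xk (uniq k).
  + by have /andP[_] := meet_adj vp vu (kd_va i7 (A7 _ i7)) u4.
  by have := no5 u nC vu; rewrite u5.
- have vp : val v \subset val (vb i (gB (tr x) i)) by rewrite (contain_b vE) ?B7 // eqxx.
  exists (vb i (gB (tr x) i)) => _; apply: dominatedI => //; first by rewrite kd_vb ?B7.
  move=> u; rewrite !inE => /or3P[/eqP u3|/eqP u4|u5] vu up.
  + by have /andP[] := meet_adj vu vp u3 (kd_vb i7 (B7 _ i7)).
  + have /kd4P[k [l [k7 l7 uE]]] := u4; move: vu; rewrite uE (contain_b vE) // => /andP[/eqP xk Hk].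
    by case/eqP: up; rewrite uE -xk (uniq k).
  by have := no5 u nC vu; rewrite u5.
have vp : val v \subset val (vc i (gC (tr x) i)) by rewrite (contain_c vE) ?C8 // eqxx.
have p5 : kd (vc i (gC (tr x) i)) = 5.
  by apply/eqP; rewrite kd5; apply/isCP; exists i, (gC (tr x) i); rewrite C8.
exists (vc i (gC (tr x) i)) => _; apply: dominatedI => //; first by rewrite p5.
move=> u; rewrite !inE => /or3P[u3|u4|u5] vu up.
- by have := no3 u nA vu; rewrite u3.
- by have := no4 u nB vu; rewrite u4.
have /isCP[k [l [k7 l7 uE]]] : isC u by rewrite -kd5.
move: vu; rewrite uE (contain_c vE) // => /andP[/eqP xk Hk].
by case/eqP: up; rewrite uE -xk (uniq k).
Qed.

Lemma retr_kinds (r : V -> nat) : injective r -> retr r (clique adj predT) (K adj kd all_ks).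
Proof.
move=> r_inj; have -> : K adj kd all_ks = clique adj (mem [set v | (kd v < 6)%N]).
  by apply/funext=> s; apply/idP/idP; apply: clique_sub => v; rewrite /= !inE; lia.
have [p pP] := choice dominated_ex.
apply: (dismantle r_inj adj_sym (p := p) (m := fun v => #|val v|)) => v; rewrite inE -leqNgt => v6.
have {v6} /pP[p6 pv dom] : kd v = 6.
  move: v6; rewrite /kd; have [v3|_] := leqP #|val v| 3; first by case: #|val v| v3 => [|[|[|[|]]]].
  by case: isA => //; case: isB => //; case: isC.
by split=> // [|u uv uS up]; rewrite ?inE //; apply: dom => //; rewrite inE in uS.
Qed.

Lemma cap_coset u v : val u :&: val v != set0 -> proper_coset G (val u :&: val v).
Proof.
case/set0Pn=> x /setIP[xu xv]; have [H HG uE] := v_coset xu; have [L LG vE] := v_coset xv.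
have -> : val u :&: val v = x *: (H :&: L).
  by apply/setP=> y; rewrite inE uE vE !mem_lcoset inE.
apply: (@proper_cosetP x (H :&: L)%G (in_G xu)).
by apply: sub_proper_trans HG; apply: subsetIl.
Qed.

(** The order of a proper subgroup containing a stabiliser of order 24 would be a
    proper multiple of 24 and a proper divisor of 168 = 7 * 24. *)
Lemma maximal24 u a : #|val a| = 24 -> cmp u a -> val u \proper val a.
Proof.
move=> a24 /orP[//|au]; have := proper_card au; have := card_dvd (proper_sub au).
have [dvd lt] := card_v u; rewrite a24; move: lt dvd; rewrite -[_ < 168]/(_ < 7 * 24)%N.
move=> lt + /dvdnP[q uE]; rewrite uE in lt *; rewrite ltn_pmul2r // in lt.
by move: q lt {uE}; do 7?[case=> [|]//].
Qed.

(** If a and b meet without being comparable, their common neighbours are comparable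
    with both: by Lagrange a and b are maximal, so that the common neighbours lie
    in the intersection, and the intersection is their apex. *)
Lemma retr_edges (r : V -> nat) : injective r -> retr r (clique adj predT) (clique cmp predT).
Proof.
move=> r_inj; apply: (remove_edges r_inj (q := fun u v => vtx (val u :&: val v))).
- exact: adj_sym.
- exact: cmp_sym.
- exact: adj_irr.
- by move=> u v uv; rewrite /adj uv.
move=> a b; rewrite {1}/adj => /orP[->//|/andP[k34 meet] ncmp].
have qE : val (vtx (val a :&: val b)) = val a :&: val b by rewrite val_vtx ?cap_coset.
have [a24 b24] : #|val a| = 24 /\ #|val b| = 24.
  by case/orP: k34 => /andP[/eqP ka /eqP kb]; rewrite !kd_card ?ka ?kb.
have nsub : ~~ (val a \subset val b).
  apply: contra ncmp => ab; have ab' : a = b by apply/val_inj/eqP; rewrite eqEcard ab a24 b24.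
  by move: k34; rewrite ab'; case: (kd b) => [|[|[|[|[|n]]]]].
have nsub' : ~~ (val b \subset val a).
  apply: contra ncmp => ab; have ab' : b = a by apply/val_inj/eqP; rewrite eqEcard ab a24 b24.
  by move: k34; rewrite ab'; case: (kd a) => [|[|[|[|[|n]]]]].
split.
- by rewrite /cmp qE properE subsetIl subsetI subxx nsub.
- by rewrite /cmp qE properE subsetIr subsetI subxx andbT nsub'.
move=> u ua ub uq.
have key (c d : V) : (kd c == 3) && (kd d == 4) || (kd c == 4) && (kd d == 3) ->
    adj u c -> adj u d -> cmp u c.
  move=> k uc ud; have [//|ncmp'] := boolP (cmp u c).
  move: uc; rewrite {1}/adj (negPf ncmp') => /andP[ku _].
  have uk : kd u = kd d by case/orP: k ku => /andP[/eqP-> /eqP->]; rewrite ?andbF ?orbF /= ?orbF => /andP[/eqP->].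
  have u6 : (kd u < 6)%N by rewrite uk; case/orP: k => /andP[_ /eqP->].
  have d6 : (kd d < 6)%N by rewrite -uk.
  move: ud; rewrite /adj uk => /orP[/orP[]/proper_card|/andP[]].
  - by rewrite !kd_card // uk ltnn.
  - by rewrite !kd_card // uk ltnn.
  by case: (kd d) => [|[|[|[|[|n]]]]].
have ab' := key a b k34 ua ub.
have ba' : cmp u b by apply: (key b a) ub ua; rewrite orbC ![(kd b == _) && _]andbC.
have := maximal24 a24 ab' => /proper_sub uA; have := maximal24 b24 ba' => /proper_sub uB.
by rewrite /cmp qE properEneq subsetI uA uB -qE (inj_eq val_inj) uq.
Qed.

(** * The homology of the coset poset *)
Local Notation r := (@linext _ V).
Local Notation KR := (K adj kd all_ks).
Local Notation K1 := (clique adj predT).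

Let rI : injective r := @linext_inj _ V.

Lemma chains_cmp : @ischain _ V = clique cmp predT.
Proof.
apply/funext=> s; apply/ischainP/cliqueP => [cs u us|cs u v us vs].
  split=> // v vs uv; have := cs u v us vs; rewrite /Order.comparable !coset_poset_leE /cmp !properEneq.
  by rewrite !(inj_eq val_inj) [v == u]eq_sym uv.
have [->|uv] := eqVneq u v; first exact: Order.POrderTheory.comparablexx.
have [_ /(_ v vs uv)] := cs u us; rewrite /Order.comparable !coset_poset_leE /cmp.
by case/orP=> /proper_sub->; rewrite ?orbT.
Qed.

Lemma chains_sub s : @ischain _ V s -> K1 s.
Proof.
rewrite chains_cmp => /cliqueP cs; apply/cliqueP=> u us; split=> // v vs uv.
by have [_ /(_ v vs uv)] := cs u us; rewrite /adj => ->.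
Qed.

Lemma kinds_sub s : KR s -> K1 s.
Proof. by apply: clique_sub. Qed.

Lemma retr_chains : retr r K1 (@ischain _ V).
Proof. by rewrite chains_cmp; apply: (retr_edges rI). Qed.

Lemma kinds_dim s : KR s -> (#|s| < 5)%N.
Proof. exact: no_simplex5 adj_ok _. Qed.

Let RK := retr_kinds rI.

Lemma c03 v : kd v = 0%N -> #|nb adj kd v 3| = 7%N. Proof. by case/over0. Qed.
Lemma c04 v : kd v = 0%N -> #|nb adj kd v 4| = 7%N. Proof. by case/over0. Qed.
Lemma c13 v : kd v = 1%N -> #|nb adj kd v 3| = 3%N. Proof. by case/over1. Qed.
Lemma c14 v : kd v = 1%N -> #|nb adj kd v 4| = 3%N. Proof. by case/over1. Qed.
Lemma c23 v : kd v = 2%N -> #|nb adj kd v 3| = 1%N. Proof. by case/over2. Qed.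
Lemma c24 v : kd v = 2%N -> #|nb adj kd v 4| = 1%N. Proof. by case/over2. Qed.
Lemma c25 v : kd v = 2%N -> #|nb adj kd v 5| = 2%N. Proof. by case/over2. Qed.

Lemma coset_H0 : trivial_zmod (rhomology V 0).
Proof.
apply: rhomology_trivial; apply: (retr_trivial rI chains_sub kinds_sub retr_chains RK).
exact: (H0_trivial rI adj_sym adj_irr c13 c03 c23 n0 cnb3 cnb43 cnb50).
Qed.

Lemma coset_H1 : trivial_zmod (rhomology V 1).
Proof.
apply: rhomology_trivial; apply: (retr_trivial rI chains_sub kinds_sub retr_chains RK).
exact: (H1_trivial rI adj_sym adj_irr adj_ok tri0 tri34 c10 c13 c14 c03 c04 c20 c23 n0 n1 n2 cC cfill cnb3 cnb43).
Qed.

Lemma coset_H_high m : (3 < m)%N -> trivial_zmod (rhomology V m).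
Proof.
move=> m3; apply: rhomology_trivial; apply: (retr_trivial rI chains_sub kinds_sub retr_chains RK).
by move=> z; apply: (cyc_high kinds_dim).
Qed.

Lemma coset_H3_torsion_free : torsion_free (rhomology V 3).
Proof.
apply: rhomology_torsion_free => z c c0 cz bz.
exact: (top_torsion_free rI chains_sub retr_chains RK kinds_dim c0 cz bz).
Qed.

Lemma coset_H2_rank : (tfrank (rhomology V 2) <= 1568 * 4 + 168 * 36)%N.
Proof.
apply: rhomology_rank; apply: (retr_dep rI chains_sub kinds_sub retr_chains RK).
exact: (H2_bound rI adj_sym adj_irr adj_ok tri0 tri34 c10 c13 c14 c03 c04 c20 c23 c25 n0 n2).
Qed.

Lemma coset_H3_rank : (tfrank (rhomology V 3) <= 1764 * 6)%N.
Proof.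
apply: rhomology_rank; apply: (retr_dep rI chains_sub kinds_sub retr_chains RK).
exact: (H3_bound adj_sym adj_ok c10 c13 c14 c24 n1).
Qed.

(** The nonzero top cycle has infinite order in homology. *)
Lemma coset_H3_gt0 : (0 < tfrank (rhomology V 3))%N.
Proof.
have [z cz z_free] := top_nonzero rI chains_sub kinds_sub retr_chains RK kinds_dim
  (H3_nonzero rI adj_sym adj_irr adj_ok tri0 tri34 c10 c13 c14 c03 c04 n0 n1).
exact: rhomology_gt0 cz z_free.
Qed.

Lemma coset_euler_char : (euler_char V <= (tfrank (rhomology V 2))%:Z)%R.
Proof.
rewrite (euler_char_rank v0 _ coset_H0 coset_H1 coset_H_high).
  by have := coset_H3_gt0; move: (tfrank _) (tfrank _) => h2 h3; lia.
apply: leq_trans (max_card [set v : V | kd v == 0%N]).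
by rewrite n0.
Qed.
End Model.

Local Open Scope ring_scope.

Theorem mainTheorem6 :
  let CG := coset_poset (PSL 2 'F_7) in
  [/\ trivial_zmod (rhomology CG 0),
      trivial_zmod (rhomology CG 1) &
      trivial_zmod (rhomology CG 4)] /\
  torsion_free (rhomology CG 3) /\
  (euler_char CG <= (tfrank (rhomology CG 2))%:Z) /\
  (tfrank (rhomology CG 2) <= 14616)%N /\
  (tfrank (rhomology CG 3) <= 11760)%N.
Proof.
split; [split|split; [|split; [|split]]].
- exact: (coset_H0 tr_tab tab_tr tr_inj tr_mul tr1).
- exact: (coset_H1 tr_tab tab_tr tr_inj tr_mul tr1).
- exact: (coset_H_high tr_tab tab_tr tr_inj tr_mul tr1).
- exact: (coset_H3_torsion_free tr_tab tab_tr tr_inj tr_mul tr1).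
- exact: (coset_euler_char tr_tab tab_tr tr_inj tr_mul tr1).
- exact: (leq_trans (coset_H2_rank tr_tab tab_tr tr_inj tr_mul tr1)).
exact: (leq_trans (coset_H3_rank tr_tab tab_tr tr_inj tr_mul tr1)).
Qed.
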